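(* Let $\Omega$ be a bounded domain in $\mathbb{C}$ with weakly uniformly perfect boundary. Let $h_1,h_2$ be functions such that $\partial\Omega$ satisfies condition $(U)_{h_1}$ but does not satisfy condition $(U)_{h_2}$. Assume that $\frac{h_i(t)}{t}$ $(i=1,2)$ is continuous and increasing, and that $$\log\frac{h_1(t)}{t}\asymp\log\frac{h_2(t)}{t}\to-\infty,\qquad t\to0 .$$ Put $\tilde h_1(t)=\frac15h_1(t)$. If there exists a constant $0<C<2$ such that, for all sufficiently small $t>0$, $$C\log\frac{\tilde h_1(t)}{t}\le\log\frac{\tilde h_1\circ\tilde h_1(t)}{\tilde h_1(t)},$$ then there exists a sequence of points $w_n\in\Omega$ with $w_n\to\partial\Omega$ such that $$b_\Omega(w_n)\ll\delta_\Omega(w_n)^{-1},\quad\text{i.e. } b_\Omega(w_n)\,\delta_\Omega(w_n)\to0\text{ as }n\to\infty.$$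
   Context: $A^2(\Omega)$ is the Bergman space of square-integrable holomorphic functions on $\Omega$; $K_\Omega(z)=K_\Omega(z,z)$ is the Bergman kernel on the diagonal; $\delta_\Omega(w)$ is the Euclidean distance from $w\in\Omega$ to $\partial\Omega$. With $$K^{(1)}_{\Omega}(z):=\sup\{|f'(z)|^2: f\in A^2(\Omega),\ f(z)=0,\ \|f\|_{L^2(\Omega)}=1\},$$ the Bergman metric is $b_\Omega(z)^2\,dz\otimes d\bar z$, where $b_\Omega(z)\ge 0$ and $b_\Omega(z)^2=K^{(1)}_\Omega(z)/K_\Omega(z)$. Let $h$ be a (positive) monotonically increasing function on some interval $(0,r_0)$ with $h(r)<r$. A closed set $E\subset\mathbb{C}$ satisfies condition $(U)_h$ if there exists $r_0>0$ such that $E\cap\{z\in\mathbb{C}: h(r)\le|z-a|\le r\}\neq\emptyset$ for every $a\in E$ and every $r\in(0,r_0)$. A set is weakly uniformly perfect if it satisfies $(U)_h$ for some such $h$ but is not uniformly perfect, where uniformly perfect means satisfying $(U)_h$ with $h(r)=cr$ for some $c\in(0,1)$. ''$\log\frac{h_1(t)}{t}\asymp\log\frac{h_2(t)}{t}$ as $t\to0$'' means that the quotient of the two sides is bounded above and below by positive constants for all sufficiently small $t>0$. ''$w_n\to\partial\Omega$'' means $\delta_\Omega(w_n)\to0$. *)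

(* Defs.v *)
(* MathComp-Analysis, over an arbitrary [R : realType]; the complex plane is
   [R[i]^o], i.e. [R[i]] as a normed module over itself, so that [derivable] and
   [derive1] are complex differentiability and the complex derivative. *)
From HB Require Import structures.
From mathcomp Require Export all_boot all_order all_algebra.
From mathcomp Require Export all_classical all_reals all_analysis.
From mathcomp Require Export complex.

Set Implicit Arguments.
Unset Strict Implicit.
Unset Printing Implicit Defensive.

Export Order.TTheory GRing.Theory Num.Theory.
Export numFieldNormedType.Exports.
Export ComplexField.Normc.

Local Open Scope classical_set_scope.
Local Open Scope ring_scope.
Local Open Scope complex_scope.

Section bergman.
Variable R : realType.
Local Notation C := (R[i]^o).
Implicit Types (Omega E : set C) (f g : C -> C) (z w : C) (h : R -> R).

Definition domain Omega : Prop :=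
  [/\ Omega !=set0, open Omega & connected Omega].

Definition boundary E : set C := closure E `\` E°.

Definition bdist Omega z : R :=
  inf [set normc (z - a) | a in boundary Omega].

Definition holomorphic_on Omega f : Prop :=
  forall z, Omega z -> derivable f z 1.

(* Area measure is the product Lebesgue measure on the pairs (Re z, Im z). *)
Local Notation area := (@lebesgue_measure R \x @lebesgue_measure R)%E.

Definition of_pair (p : R * R) : C := p.1 +i* p.2.

(* Functions on [Omega] are represented by total functions; nothing below
   depends on their values outside the open set [Omega]. *)
Definition bergman_space Omega : set (C -> C) :=
  [set f | holomorphic_on Omega f /\
    area.-integrable (of_pair @^-1` Omega)
      (fun p => (normc (f (of_pair p)) ^+ 2)%:E)].

Definition L2norm Omega f : R :=
  Num.sqrt (\int[area]_(p in of_pair @^-1` Omega) (normc (f (of_pair p)) ^+ 2)).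

Definition L2inner Omega f g : C :=
  (\int[area]_(p in of_pair @^-1` Omega)
      complex.Re (f (of_pair p) * conjc (g (of_pair p)))) +i*
  (\int[area]_(p in of_pair @^-1` Omega)
      complex.Im (f (of_pair p) * conjc (g (of_pair p)))).

(* [k] represents the evaluation at [w]; its values on [Omega] are unique. *)
Definition reproducing Omega w (k : C -> C) : Prop :=
  bergman_space Omega k /\
  forall f, bergman_space Omega f -> f w = L2inner Omega f k.

Definition bergman_kernel Omega z w : C :=
  get [set k : C -> C | reproducing Omega w k] z.

Definition bergman_diag Omega z : R := complex.Re (bergman_kernel Omega z z).

Definition bergman_K1 Omega z : R :=
  sup [set normc (derive1 f z) ^+ 2 | f in
    [set f | [/\ bergman_space Omega f, f z = 0 & L2norm Omega f = 1]]].

Definition bergman_metric Omega z : R :=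
  Num.sqrt (bergman_K1 Omega z / bergman_diag Omega z).

(* Monotonicity is understood in the weak sense. *)
Definition scale_function (r0 : R) h : Prop :=
  [/\ 0 < r0,
      forall r, 0 < r < r0 -> 0 < h r < r &
      {in `]0, r0[ &, {homo h : r s / r <= s}}].

Definition condition_U h E : Prop :=
  exists2 r0 : R, 0 < r0 &
    forall a r, E a -> 0 < r < r0 ->
      E `&` [set z | h r <= normc (z - a) <= r] !=set0.

Definition uniformly_perfect E : Prop :=
  exists2 c : R, 0 < c < 1 & condition_U (fun r => c * r) E.

Definition weakly_uniformly_perfect E : Prop :=
  (exists r0 h, scale_function r0 h /\ condition_U h E) /\
  ~ uniformly_perfect E.

Definition asymp0 (u v : R -> R) : Prop :=
  exists c1 c2 : R, [/\ 0 < c1, 0 < c2 &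
    \forall t \near (0 : R)^'+, c1 <= u t / v t <= c2].

End bergman.

(* Main.v *)
Require Import Defs.
From mathcomp Require Import ring lra measurable_realfun.

(** Since the boundary [E] of the domain fails (U)_h2, there are points [a] of [E] and arbitrarily
    small [r] for which the annulus [h <= |z - a| <= r], with [h = h2 r], lies in the domain; let
    [w] be a point of it at distance [rho = sqrt (r h)] from [a].
    If [f] has norm 1 and vanishes at [w], then Cauchy's theorem for [(z - a) f(z) / (z - w)^2] on
    rectangles near the two ends of the annulus, chosen by Fubini such that the integral of [|f|]
    over them is bounded, yields [|f'(w)| <= c / (r rho)].
    The kernel on the diagonal is bounded from below by testing it on the difference of the Cauchy
    transforms of two measures. Each is carried by a Cantor subset of [E], one near [a] and one
    near a boundary point at distance at least [r], that (U)_h1 allows to construct as a binary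
    tree; as [C < 2], its energy is [O(log (r / h1 r))], while the transforms are of size
    [1 / rho] at [w].
    Altogether [b(w)^2 rho^2 <= c (h / r) log (r / h1 r)], which tends to 0 because [log (r / h1
      r)]
    is comparable with [log (r / h)]. *)

Set Implicit Arguments.
Unset Strict Implicit.
Unset Printing Implicit Defensive.

Local Open Scope classical_set_scope.
Local Open Scope ring_scope.
Local Open Scope complex_scope.

(** * The complex plane in coordinates *)

Arguments normc : simpl never.

Section complex_plane.
Variable R : realType.
Local Notation C := (R[i]^o).
Implicit Types (f g : C -> C) (z w v d : C).

(** The radius [rho = sqrt (r h)] balances the two ends of the annulus: the inner contour
    contributes a multiple of [h / rho ^ 3] to [|f'(w)|], the outer one a multiple of [1 / (r rho)],
    and these agree when [rho ^ 2 = r h]. Rectangles replace circles because Fubini's theorem in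
    Cartesian coordinates selects each of the four sides separately. The main obstacle is the L2
    norm of a Cauchy transform. The squared integral of [1 / |z - p|] against a probability measure
    expands into mutual energies, and the product of [1 / |z - p|] and [1 / |z - q|], integrated
    over a disc of radius [R], is of the order of the number of dyadic scales between [|p - q|] and
    [R]. Hence [1 / |z - p|] is majorized by a sum of weighted indicators of dyadic boxes: their
    products have explicit integrals, and logarithms become numbers of boxes. No limit measure is
    constructed. The energies are estimated for uniform averages over the leaves of finite trees,
    with bounds independent of the depth, and Fatou's lemma carries them over to the limit of the
    averages. *)

Lemma normc_ge0 z : 0 <= normc z.
Proof. by case: z => x y; exact: sqrtr_ge0. Qed.

Lemma normcB z w : normc (z - w) = normc (w - z).
Proof. by rewrite -normcN opprB. Qed.

Lemma normc_le_tri z w v : normc (z - w) <= normc (z - v) + normc (v - w).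
Proof. by rewrite (le_trans _ (le_normcD _ _))// addrA subrK. Qed.

Lemma normc_gt0 z : (0 < normc z) = (z != 0).
Proof.
rewrite lt_def normc_ge0 andbT; apply/idP/idP; apply: contra_neq.
  by move=> ->; exact: normc0.
exact: eq0_normc.
Qed.

Lemma normr_normc z : `|z| = (normc z)%:C.
Proof. by []. Qed.

Lemma norm_Re_le z : `|complex.Re z| <= normc z.
Proof. by rewrite /normc; case: z => x y /=; rewrite -sqrtr_sqr ler_wsqrtr// lerDl sqr_ge0. Qed.

Lemma norm_Im_le z : `|complex.Im z| <= normc z.
Proof. by rewrite /normc; case: z => x y /=; rewrite -sqrtr_sqr ler_wsqrtr// lerDr sqr_ge0. Qed.

Lemma normc_le_ReIm z : normc z <= `|complex.Re z| + `|complex.Im z|.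
Proof.
rewrite /normc; case: z => x y /=.
rewrite -[leRHS]ger0_norm ?addr_ge0// -sqrtr_sqr ler_wsqrtr//.
by rewrite sqrrD !real_normK ?num_real// addrAC lerDl mulrn_wge0 ?mulr_ge0.
Qed.

Lemma normc_sqr z : normc z ^+ 2 = complex.Re z ^+ 2 + complex.Im z ^+ 2.
Proof. by rewrite /normc; case: z => x y /=; rewrite sqr_sqrtr// addr_ge0 ?sqr_ge0. Qed.

Lemma normc_real (x : R) : normc x%:C = `|x|.
Proof. by rewrite /normc /= expr0n addr0 sqrtr_sqr. Qed.

(** The norm of [C] over itself takes values in [R[i]], where a positive number has imaginary part
    0. Passing to its real part gives neighbourhoods with real radii, used from here on. *)
Lemma normc_nbhs z (A : set C) :
  nbhs z A <-> exists2 e : R, 0 < e & forall w, normc (w - z) < e -> A w.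
Proof.
split.
  move=> /nbhs_ballP[e e0 sA]; exists (complex.Re e).
    by move: e0; rewrite /= ltcE => /andP[].
  move=> w wz; apply: sA; rewrite -ball_normE /= distrC normr_normc.
  move: e0; rewrite /= !ltcE /= => /andP[/eqP -> _].
  by rewrite eqxx.
move=> [e e0 sA]; apply/nbhs_ballP; exists e%:C => /=; first by rewrite ltcR.
by move=> w; rewrite -ball_normE /= distrC normr_normc ltcR; exact: sA.
Qed.

(** The first-order expansion with a real modulus: division by the increment is avoided, so [v = 0]
    needs no exception. *)
Definition is_cderiv f z d := forall e : R, 0 < e -> exists2 dl : R, 0 < dl &
  forall v, normc v < dl -> normc (f (z + v) - f z - d * v) <= e * normc v.

Lemma derivable_is_cderiv f z : derivable f z 1 -> is_cderiv f z ('D_1 f z).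
Proof.
move=> df e e0.
have : (fun h => h^-1 *: (f (h *: (1 : C) + z) - f z)) @ (0 : C)^' --> 'D_1 f z.
  exact: df.
move=> /cvgr_dist_le /(_ e%:C); rewrite ltcR => /(_ e0).
rewrite near_withinE => /normc_nbhs[dl dl0 H].
exists dl => // v vdl.
have [->|v0] := eqVneq v 0; first by rewrite mulr0 addr0 subrr subr0 normc0 mulr0.
have := H v; rewrite subr0 => /(_ vdl v0).
rewrite distrC normr_normc lecR (mulr1 v : v *: (1 : C) = v) -[_ *: _]/(_ * _) => {}H.
have -> : f (z + v) - f z - 'D_1 f z * v = (v^-1 * (f (v + z) - f z) - 'D_1 f z) * v.
  by rewrite mulrBl mulrAC mulVf// mul1r (addrC v).
by rewrite normcM ler_wpM2r ?normc_ge0.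
Qed.

Lemma is_cderiv_derivable f z d : is_cderiv f z d -> derivable f z 1.
Proof.
move=> df; apply/cvg_ex; exists d; apply/cvgrPdist_le => e e1.
have [e0 eE] : 0 < complex.Re e /\ e = (complex.Re e)%:C.
  by move: e1; case: e => x y; rewrite ltcE /= => /andP[/eqP -> ].
have [dl dl0 H] := df _ e0.
rewrite near_withinE; apply/normc_nbhs; exists dl => // v; rewrite subr0 => vdl v0.
rewrite eE distrC normr_normc lecR (mulr1 v : v *: (1 : C) = v) -[_ *: _]/(_ * _).
have := H v vdl.
have -> : f (z + v) - f z - d * v = (v^-1 * (f (v + z) - f z) - d) * v.
  by rewrite mulrBl mulrAC mulVf// mul1r (addrC v).
by rewrite normcM ler_pM2r ?normc_gt0.
Qed.


Lemma derivable_frac f (a w z : C) : z != w -> derivable f z 1 ->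
  derivable (fun u : C => (u - a) * f u / (u - w) ^+ 2) z 1.
Proof.
move=> zw df.
have dB b : derivable (fun u : C => u - b) z 1.
  by apply: derivableB; [exact: derivable_id|exact: derivable_cst].
have d1 : derivable (fun u : C => (u - a) * f u) z 1.
  exact: (@derivableM _ C _ _ z 1 (dB a) df).
have d2 : derivable (fun u : C => (u - w) ^+ 2) z 1.
  exact: (@derivableX _ C _ 2 z 1 (dB w)).
have d3 : derivable (fun u : C => ((u - w) ^+ 2)^-1) z 1.
  by apply: (@derivableV _ C _ z 1 _ d2); rewrite expf_neq0// subr_eq0.
exact: (@derivableM _ C _ _ z 1 d1 d3).
Qed.

Definition ccont f z := forall e : R, 0 < e -> exists2 dl : R, 0 < dl &
  forall v, normc v < dl -> normc (f (z + v) - f z) < e.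

Lemma is_cderiv_ccont f z d : is_cderiv f z d -> ccont f z.
Proof.
move=> df e e0; have [dl dl0 H] := df 1 ltr01.
have k0 : 0 < 1 + normc d by rewrite ltr_pwDl ?normc_ge0.
exists (Num.min dl (e / (2 * (1 + normc d)))).
  by rewrite lt_min dl0 divr_gt0 ?mulr_gt0.
move=> v; rewrite lt_min ltr_pdivlMr ?mulr_gt0// => /andP[/H vdl ve].
have -> : f (z + v) - f z = (f (z + v) - f z - d * v) + d * v by rewrite subrK.
rewrite (le_lt_trans (le_normcD _ _))// normcM.
have := mulr_ge0 (normc_ge0 d) (normc_ge0 v); have := normc_ge0 v; lra.
Qed.

Lemma derivable_ccont f z : derivable f z 1 -> ccont f z.
Proof. by move=> /derivable_is_cderiv/is_cderiv_ccont. Qed.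

Lemma open_normc (A : set C) z : open A -> A z ->
  exists2 e : R, 0 < e & forall w, normc (w - z) < e -> A w.
Proof. by move=> oA Az; apply/normc_nbhs; apply: open_nbhs_nbhs; split. Qed.

Lemma normc_open (A : set C) :
  (forall z, A z -> exists2 e : R, 0 < e & forall w, normc (w - z) < e -> A w) ->
  open A.
Proof. by move=> H; rewrite openE => z /H /normc_nbhs. Qed.

Lemma boundary_near (A : set C) a (e : R) : boundary A a -> 0 < e ->
  exists2 z, A z & normc (z - a) < e.
Proof.
move=> [clA _] e0.
have : nbhs a [set z | normc (z - a) < e] by apply/normc_nbhs; exists e.
by move=> /clA [z [Az /=]]; exists z.
Qed.

Lemma boundary_notin (A : set C) a : open A -> boundary A a -> ~ A a.
Proof. by move=> oA [_ /[swap] Aa]; apply; apply: open_nbhs_nbhs; split. Qed.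

Lemma bdist_le (A : set C) a w : boundary A a -> bdist A w <= normc (w - a).
Proof.
move=> bA; apply: ge_inf; last by exists a.
by exists 0 => _ [b _ <-]; exact: normc_ge0.
Qed.

Lemma bdist_ge0 (A : set C) a w : boundary A a -> 0 <= bdist A w.
Proof.
move=> bA; apply: lb_le_inf; first by exists (normc (w - a)); exists a.
by move=> _ [b _ <-]; exact: normc_ge0.
Qed.

End complex_plane.

(** * Measurability in the coordinates of the plane *)

Section plane_measurable.
Variable R : realType.
Local Notation C := (R[i]^o).

Definition box_open (U : set (R * R)) := forall p, U p ->
  exists2 e : R, 0 < e & forall q, `|q.1 - p.1| < e -> `|q.2 - p.2| < e -> U q.

(** The set is the union of the countably many rational boxes that it contains; a box that is not
    contained is replaced by the empty set. *)
Lemma box_open_measurable (U : set (R * R)) : box_open U -> measurable U.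
Proof.
move=> oU.
pose B (a b c d : rat) : set (R * R) :=
  `]ratr a, ratr b[%classic `*` `]ratr c, ratr d[%classic.
pose B' a b c d := if pselect (B a b c d `<=` U) then B a b c d else set0.
have -> : U = \bigcup_a \bigcup_b \bigcup_c \bigcup_d B' a b c d.
  apply/seteqP; split => [p /[dup] Up /oU[e e0 H]|p].
    have rl (x : R) : exists a : rat, ratr a \in `]x - e, x[.
      by apply: rat_in_itvoo; rewrite ltrBlDr ltrDl.
    have rr (x : R) : exists a : rat, ratr a \in `]x, x + e[.
      by apply: rat_in_itvoo; rewrite ltrDl.
    have [a ha] := rl p.1; have [b hb] := rr p.1.
    have [c hc] := rl p.2; have [d hd] := rr p.2.
    rewrite !in_itv /= in ha hb hc hd; move: ha hb hc hd.
    move=> /andP[al ar] /andP[bl br] /andP[cl cr] /andP[dl dr].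
    exists a => //; exists b => //; exists c => //; exists d => //.
    rewrite /B'; case: (pselect (B a b c d `<=` U)) => [sB|nB].
      by split; rewrite /= in_itv /= ?ar ?bl ?cr ?dl.
    exfalso; apply: nB => q [] /=; rewrite !in_itv /= => /andP[q1 q2] /andP[q3 q4].
    by apply: H; rewrite ltr_distlC; apply/andP; split; lra.
  move=> [a _ [b _ [c _ [d _ ]]]]; rewrite /B'.
  by case: (pselect (B a b c d `<=` U)) => [sB /sB|nB].
apply: bigcupT_measurable_rat => a; apply: bigcupT_measurable_rat => b.
apply: bigcupT_measurable_rat => c; apply: bigcupT_measurable_rat => d.
rewrite /B'; case: (pselect (B a b c d `<=` U)) => [sB|nB]; last exact: measurable0.
by apply: measurableX; exact: measurable_itv.
Qed.

Lemma box_continuous_measurable (U : set (R * R)) (g : R * R -> R) : box_open U ->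
  (forall p, U p -> forall e : R, 0 < e -> exists2 d : R, 0 < d &
    forall q, `|q.1 - p.1| < d -> `|q.2 - p.2| < d -> `|g q - g p| < e) ->
  measurable_fun U g.
Proof.
move=> oU cg.
apply: (measurability _ (RGenOInfty.measurableE R)).
move=> _ [_ [t ->] <-]; apply: box_open_measurable => p [Up /=].
rewrite in_itv/= andbT => tg.
have [e e0 H] := oU _ Up.
have [d d0 K] := cg _ Up (g p - t) ltac:(by rewrite subr_gt0).
exists (Num.min e d); first by rewrite lt_min e0.
move=> q; rewrite !lt_min => /andP[q1 q2] /andP[q3 q4]; split; first exact: H.
have := K _ q2 q4; rewrite /= in_itv/= andbT ltr_distlC => /andP[]; lra.
Qed.

Lemma of_pairB (p q : R * R) : of_pair q - of_pair p = (q.1 - p.1) +i* (q.2 - p.2) :> C.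
Proof. by []. Qed.

Lemma normc_of_pair_lt (p q : R * R) (e : R) : `|q.1 - p.1| < e / 2 ->
  `|q.2 - p.2| < e / 2 -> normc (of_pair q - of_pair p : C) < e.
Proof.
by move=> h1 h2; rewrite (le_lt_trans (normc_le_ReIm _))// of_pairB /=; lra.
Qed.

Lemma box_open_preimage (A : set C) : open A -> box_open (@of_pair R @^-1` A).
Proof.
move=> oA p /(open_normc oA)[e e0 H]; exists (e / 2); first by rewrite divr_gt0.
by move=> q q1 q2; apply: H; exact: normc_of_pair_lt.
Qed.

Lemma measurable_preimage (A : set C) : open A -> measurable (@of_pair R @^-1` A).
Proof. by move=> /box_open_preimage/box_open_measurable. Qed.

(** A 1-Lipschitz [phi] covers the modulus, the real part and the imaginary part at once. *)
Lemma measurable_ccont (A : set C) (f : C -> C) (phi : C -> R) : open A ->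
  (forall z, A z -> ccont f z) ->
  (forall z w, `|phi z - phi w| <= normc (z - w)) ->
  measurable_fun (@of_pair R @^-1` A) (fun p => phi (f (of_pair p))).
Proof.
move=> oA cf lp; apply: box_continuous_measurable; first exact: box_open_preimage.
move=> p /cf cfp e /cfp[d d0 H]; exists (d / 2); first by rewrite divr_gt0.
move=> q q1 q2; rewrite (le_lt_trans (lp _ _))//.
have := H (of_pair q - of_pair p) (normc_of_pair_lt q1 q2).
by rewrite (addrC (of_pair p)) subrK.
Qed.

Lemma normc_lipschitz (z w : C) : `|normc z - normc w| <= normc (z - w).
Proof.
have h1 := le_normcD (z - w) w; have h2 := le_normcD (w - z) z.
rewrite !subrK in h1 h2; rewrite (normcB w) in h2.
by rewrite ler_norml; lra.
Qed.

Lemma Re_lipschitz (z w : C) : `|complex.Re z - complex.Re w| <= normc (z - w).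
Proof. by have := norm_Re_le (z - w); case: z w => [? ?] [? ?]. Qed.

Lemma Im_lipschitz (z w : C) : `|complex.Im z - complex.Im w| <= normc (z - w).
Proof. by have := norm_Im_le (z - w); case: z w => [? ?] [? ?]. Qed.

End plane_measurable.

(** * Contour integrals over rectangles *)

Section segment_integral.
Variable R : realType.
Local Notation C := (R[i]^o).
Local Notation mu := (@lebesgue_measure R).
Implicit Types (g : R -> C) (a b : R).

Definition lcont g a b := forall t, a <= t <= b -> forall e : R, 0 < e ->
  exists2 d : R, 0 < d & forall s, `|s - t| < d -> normc (g s - g t) < e.

Definition cint g a b : C :=
  (\int[mu]_(t in `[a, b]) complex.Re (g t)) +i*
  (\int[mu]_(t in `[a, b]) complex.Im (g t)).

Lemma lcont_integrable g a b (phi : C -> R) : lcont g a b ->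
  (forall z w, `|phi z - phi w| <= normc (z - w)) ->
  mu.-integrable `[a, b] (EFin \o (fun t => phi (g t))).
Proof.
move=> cg lp; apply: continuous_compact_integrable; first exact: segment_compact.
apply: continuous_in_subspaceT => t; rewrite inE /= in_itv /= => tab.
apply/cvgrPdist_lt => e e0; have [d d0 H] := cg _ tab _ e0.
near=> s; rewrite distrC (le_lt_trans (lp _ _))// H//.
Unshelve. all: by end_near. Qed.

Lemma lcont_Re g a b : lcont g a b ->
  mu.-integrable `[a, b] (EFin \o (fun t => complex.Re (g t))).
Proof. by move=> /lcont_integrable; apply; exact: Re_lipschitz. Qed.

Lemma lcont_Im g a b : lcont g a b ->
  mu.-integrable `[a, b] (EFin \o (fun t => complex.Im (g t))).
Proof. by move=> /lcont_integrable; apply; exact: Im_lipschitz. Qed.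

Lemma lcont_normc g a b : lcont g a b ->
  mu.-integrable `[a, b] (EFin \o (fun t => normc (g t))).
Proof. by move=> /lcont_integrable; apply; exact: normc_lipschitz. Qed.

Lemma lcont_cst a b (c : C) : lcont (fun=> c) a b.
Proof. by move=> t _ e e0; exists 1 => // s _; rewrite subrr normc0. Qed.

Lemma lcontZ g a b (c : C) : lcont g a b -> lcont (fun t => c * g t) a b.
Proof.
move=> cg t tab e e0.
have c0 : 0 < 1 + normc c by rewrite ltr_pwDl ?normc_ge0.
have [d d0 H] := cg t tab (e / (1 + normc c)) ltac:(by rewrite divr_gt0).
exists d => // s /H; rewrite ltr_pdivlMr// -mulrBr normcM.
apply: le_lt_trans; rewrite mulrC ler_wpM2l ?normc_ge0//.
by rewrite lerDr.
Qed.

Lemma cintD f g a b : lcont f a b -> lcont g a b ->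
  cint (fun t => f t + g t) a b = cint f a b + cint g a b.
Proof.
move=> cf cg; rewrite /cint; apply/eqP; rewrite eq_complex /=; apply/andP; split; apply/eqP.
  rewrite -RintegralD//; [|exact: lcont_Re|exact: lcont_Re].
  by apply: eq_Rintegral => t _; case: (f t) (g t) => [? ?] [? ?].
rewrite -RintegralD//; [|exact: lcont_Im|exact: lcont_Im].
by apply: eq_Rintegral => t _; case: (f t) (g t) => [? ?] [? ?].
Qed.

Lemma cintZ g a b (c : C) : lcont g a b ->
  cint (fun t => c * g t) a b = c * cint g a b.
Proof.
move=> cg; have iR := lcont_Re cg; have iI := lcont_Im cg.
have Z (k : R) h : mu.-integrable `[a, b] (EFin \o h) ->
   mu.-integrable `[a, b] (EFin \o (fun t => k * h t)).
  move=> ih; have -> : EFin \o (fun t => k * h t) = (fun t => k%:E * (EFin \o h) t)%E.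
    by apply/funext => t /=; rewrite EFinM.
  by apply: integrableZl.
case: c => x y; rewrite /cint; apply/eqP; rewrite eq_complex /=; apply/andP; split; apply/eqP.
  rewrite -!RintegralZl// -RintegralB//; [|exact: Z|exact: Z].
  by apply: eq_Rintegral => t _; case: (g t).
rewrite -!RintegralZl// -RintegralD//; [|exact: Z|exact: Z].
by apply: eq_Rintegral => t _; case: (g t).
Qed.

Lemma eq_cint f g a b : (forall t, a <= t <= b -> f t = g t) -> cint f a b = cint g a b.
Proof.
move=> fg; rewrite /cint; congr (_ +i* _); apply: eq_Rintegral => t;
  by rewrite inE /= in_itv /= => /fg ->.
Qed.

Lemma cintB f g a b : lcont f a b -> lcont g a b ->
  cint (fun t => f t - g t) a b = cint f a b - cint g a b.
Proof.
move=> cf cg; rewrite -[- cint g a b]mulN1r -cintZ// -cintD//; last exact: lcontZ.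
by apply: eq_cint => t _; rewrite mulN1r.
Qed.

Lemma cint_cst a b (c : C) : a <= b -> cint (fun=> c) a b = (b - a)%:C * c.
Proof.
move=> ab; case: c => x y; rewrite /cint !Rintegral_cst//= lebesgue_measure_itv /= lte_fin.
have -> : fine (if a < b then (b%:E - a%:E)%E else 0%E) = b - a.
  case: ltP => //= ba; have -> : a = b by apply/eqP; rewrite eq_le ab.
  by rewrite subrr.
apply/eqP; rewrite eq_complex /=; apply/andP; split; apply/eqP; ring.
Qed.

Lemma Rint_split (h : R -> R) a b c : a <= b -> b <= c ->
  mu.-integrable `[a, c] (EFin \o h) ->
  \int[mu]_(t in `[a, c]) h t = \int[mu]_(t in `[a, b]) h t + \int[mu]_(t in `[b, c]) h t.
Proof.
move=> ab bc ih.
rewrite [X in _ + X](_ : _ = \int[mu]_(t in `]b, c]) h t); last first.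
  rewrite Rintegral_itv_obnd_cbnd//; apply: integrableS ih => //.
  by move=> t /=; rewrite !in_itv /= => /andP[/ltW h1 ->]; rewrite (le_trans ab h1).
rewrite -Rintegral_setU//=.
- by congr Rintegral; rewrite -itv_bndbnd_setU//= bnd_simp.
- by rewrite -itv_bndbnd_setU//= bnd_simp.
- apply/disj_setPS => t [] /=; rewrite !in_itv /= => /andP[_ h1] /andP[h2 _].
  by have := lt_le_trans h2 h1; rewrite ltxx.
Qed.

Lemma cint_split g a b c : a <= b -> b <= c -> lcont g a c ->
  cint g a c = cint g a b + cint g b c.
Proof.
move=> ab bc cg; rewrite /cint (Rint_split ab bc); last exact: lcont_Re.
by rewrite (Rint_split ab bc)//; exact: lcont_Im.
Qed.

(** Real and imaginary parts are estimated separately; the factor 2 so lost only affects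
    constants. *)
Lemma normc_cint g a b : lcont g a b ->
  normc (cint g a b) <= 2 * \int[mu]_(t in `[a, b]) normc (g t).
Proof.
move=> cg; rewrite (le_trans (normc_le_ReIm _))// mulr2n mulrDl mul1r /=.
have H h : mu.-integrable `[a, b] (EFin \o h) -> (forall t, `|h t| <= normc (g t)) ->
    `|\int[mu]_(t in `[a, b]) h t| <= \int[mu]_(t in `[a, b]) normc (g t).
  move=> ih hg; rewrite (le_trans (le_normr_Rintegral _ _))//.
  apply: le_Rintegral => //; [|exact: lcont_normc].
  exact: (integrable_norm ih).
apply: lerD; apply: H.
- exact: lcont_Re.
- by move=> t; exact: norm_Re_le.
- exact: lcont_Im.
- by move=> t; exact: norm_Im_le.
Qed.

Lemma cint_le g a b (M : R) : a <= b -> lcont g a b ->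
  (forall t, a <= t <= b -> normc (g t) <= M) -> normc (cint g a b) <= 2 * M * (b - a).
Proof.
move=> ab cg gM; rewrite (le_trans (normc_cint cg))// -mulrA ler_pM2l//.
have -> : M * (b - a) = \int[mu]_(t in `[a, b]) M.
  have := cint_cst M%:C ab; rewrite /cint /= => /(congr1 (@complex.Re R)) /= ->.
  ring.
apply: le_Rintegral => //; first exact: lcont_normc.
  have := lcont_Re (@lcont_cst a b M%:C); exact.
Qed.

End segment_integral.

Arguments cint : simpl never.

Section rectangle_integral.
Variable R : realType.
Local Notation C := (R[i]^o).
Implicit Types (q : C -> C) (x y : R).

(** The integral of [q dz] over the counterclockwise boundary of the rectangle: [dz] is [dx] on
    horizontal sides and ['i dy] on vertical ones. *)
Definition rint q x0 x1 y0 y1 : C :=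
  cint (fun x => q (x +i* y0)) x0 x1 - cint (fun x => q (x +i* y1)) x0 x1 +
  'i * (cint (fun y => q (x1 +i* y)) y0 y1 - cint (fun y => q (x0 +i* y)) y0 y1).

Definition rcont q x0 x1 y0 y1 := forall x y, x0 <= x <= x1 -> y0 <= y <= y1 ->
  ccont q (x +i* y).

Lemma lcont_horizontal q a b y : (forall x, a <= x <= b -> ccont q (x +i* y)) ->
  lcont (fun x => q (x +i* y)) a b.
Proof.
move=> cq t /cq ct e /ct[d d0 H]; exists d => // s sd.
have := H (s - t)%:C; rewrite normc_real => /(_ sd).
by rewrite (_ : (t +i* y) + (s - t)%:C = s +i* y)//; apply/eqP; rewrite eq_complex /= addr0
  subrKC !eqxx.
Qed.

Lemma normc_im (y : R) : normc (0 +i* y) = `|y|.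
Proof. by rewrite /normc /= expr0n add0r sqrtr_sqr. Qed.

Lemma lcont_vertical q a b x : (forall y, a <= y <= b -> ccont q (x +i* y)) ->
  lcont (fun y => q (x +i* y)) a b.
Proof.
move=> cq t /cq ct e /ct[d d0 H]; exists d => // s sd.
have := H (0 +i* (s - t)); rewrite normc_im => /(_ sd).
by rewrite (_ : (x +i* t) + (0 +i* (s - t)) = x +i* s)//; apply/eqP; rewrite eq_complex /= addr0
  subrKC !eqxx.
Qed.

Lemma rcont_sub q x0 x1 y0 y1 x0' x1' y0' y1' :
  x0 <= x0' -> x1' <= x1 -> y0 <= y0' -> y1' <= y1 ->
  rcont q x0 x1 y0 y1 -> rcont q x0' x1' y0' y1'.
Proof.
by move=> h1 h2 h3 h4 cq x y /andP[h5 h6] /andP[h7 h8]; apply: cq;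
   apply/andP; split; lra.
Qed.

Definition edges (P : C -> Prop) x0 x1 y0 y1 :=
  (forall x, x0 <= x <= x1 -> P (x +i* y0) /\ P (x +i* y1)) /\
  (forall y, y0 <= y <= y1 -> P (x0 +i* y) /\ P (x1 +i* y)).

Definition econt q := edges (ccont q).

Section fixed.
Variables (x0 x1 y0 y1 : R).

Lemma econt_bot q : econt q x0 x1 y0 y1 -> lcont (fun x => q (x +i* y0)) x0 x1.
Proof. by move=> [cq _]; apply: lcont_horizontal => x /cq[]. Qed.

Lemma econt_top q : econt q x0 x1 y0 y1 -> lcont (fun x => q (x +i* y1)) x0 x1.
Proof. by move=> [cq _]; apply: lcont_horizontal => x /cq[]. Qed.

Lemma econt_left q : econt q x0 x1 y0 y1 -> lcont (fun y => q (x0 +i* y)) y0 y1.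
Proof. by move=> [_ cq]; apply: lcont_vertical => x /cq[]. Qed.

Lemma econt_right q : econt q x0 x1 y0 y1 -> lcont (fun y => q (x1 +i* y)) y0 y1.
Proof. by move=> [_ cq]; apply: lcont_vertical => x /cq[]. Qed.

Lemma rintD f g : econt f x0 x1 y0 y1 -> econt g x0 x1 y0 y1 ->
  rint (fun z => f z + g z) x0 x1 y0 y1 = rint f x0 x1 y0 y1 + rint g x0 x1 y0 y1.
Proof.
move=> cf cg; rewrite /rint.
rewrite (cintD (econt_bot cf) (econt_bot cg)) (cintD (econt_top cf) (econt_top cg)).
rewrite (cintD (econt_left cf) (econt_left cg)) (cintD (econt_right cf) (econt_right cg)).
move: (cint _ _ _) (cint _ _ _) (cint _ _ _) (cint _ _ _) (cint _ _ _) (cint _ _ _) (cint _ _ _)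
  (cint _ _ _) => a b c d a' b' c' d'.
ring.
Qed.

Lemma rintZ f c : econt f x0 x1 y0 y1 ->
  rint (fun z => c * f z) x0 x1 y0 y1 = c * rint f x0 x1 y0 y1.
Proof.
move=> cf; rewrite /rint.
rewrite (cintZ _ (econt_bot cf)) (cintZ _ (econt_top cf)).
rewrite (cintZ _ (econt_left cf)) (cintZ _ (econt_right cf)).
move: (cint _ _ _) (cint _ _ _) (cint _ _ _) (cint _ _ _) => a' b' c' d'.
ring.
Qed.

Hypotheses (xx : x0 <= x1) (yy : y0 <= y1).

Lemma rcont_econt q : rcont q x0 x1 y0 y1 -> econt q x0 x1 y0 y1.
Proof. by move=> cq; split => t tb; split; apply: cq; rewrite ?lexx ?xx ?yy. Qed.

Lemma rint_cst c : rint (fun=> c) x0 x1 y0 y1 = 0.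
Proof. by rewrite /rint !subrr mulr0 addr0. Qed.

Lemma ccont_id z : @ccont R (fun z => z) z.
Proof. by move=> e e0; exists e => // v; rewrite addrAC subrr add0r. Qed.

(** The values of the identity on opposite sides differ by a constant, so no primitive is involved.
    With [rint_cst] this disposes of affine functions in Goursat's theorem. *)
Lemma rint_id : rint (fun z => z) x0 x1 y0 y1 = 0.
Proof.
have cid : econt (fun z => z) x0 x1 y0 y1 by split => t _; split; exact: ccont_id.
rewrite /rint -(cintB (econt_bot cid) (econt_top cid)).
rewrite -(cintB (econt_right cid) (econt_left cid)).
rewrite [X in X + _](@eq_cint _ _ (fun=> 0 +i* (y0 - y1))); last first.
  by move=> t _; apply/eqP; rewrite eq_complex /= subrr !eqxx.
rewrite [X in _ + _ * X](@eq_cint _ _ (fun=> (x1 - x0)%:C)); last first.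
  by move=> t _; apply/eqP; rewrite eq_complex /= subrr !eqxx.
rewrite !cint_cst//; apply/eqP; rewrite eq_complex /=.
by apply/andP; split; apply/eqP; ring.
Qed.

Lemma normc_i : normc ('i : C) = 1.
Proof. by rewrite /normc /= expr0n add0r expr1n sqrtr1. Qed.

Lemma rint_le q (M : R) : econt q x0 x1 y0 y1 ->
  edges (fun z => normc (q z) <= M) x0 x1 y0 y1 ->
  normc (rint q x0 x1 y0 y1) <= 4 * M * ((x1 - x0) + (y1 - y0)).
Proof.
move=> cq [qx qy]; rewrite /rint.
have H1 := cint_le xx (econt_bot cq) (fun t tb => (qx t tb).1).
have H2 := cint_le xx (econt_top cq) (fun t tb => (qx t tb).2).
have H3 := cint_le yy (econt_left cq) (fun t tb => (qy t tb).1).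
have H4 := cint_le yy (econt_right cq) (fun t tb => (qy t tb).2).
move: H1 H2 H3 H4.
move: (cint _ _ _) (cint _ _ _) (cint _ _ _) (cint _ _ _) => d c b a.
move=> H1 H2 H3 H4.
have h1 := le_normcD (a - b) ('i * (d - c)).
have h2 := le_normcD a (- b); have h3 := le_normcD d (- c).
rewrite normcM normc_i mul1r in h1; rewrite normcN in h2; rewrite normcN in h3.
move: H1 H2 H3 H4 h1 h2 h3; clear.
move: (normc a) (normc b) (normc c) (normc d) (normc (a - b)) (normc (d - c)).
move: (normc (a - b + 'i * (d - c))) => n1 n2 n3 n4 n5 n6 n7.
move=> H1 H2 H3 H4 h1 h2 h3.
lra.
Qed.

End fixed.

Lemma rint_splitx q x0 x1 x2 y0 y1 : x0 <= x1 -> x1 <= x2 ->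
  econt q x0 x2 y0 y1 -> rint q x0 x2 y0 y1 = rint q x0 x1 y0 y1 + rint q x1 x2 y0 y1.
Proof.
move=> h1 h2 cq; rewrite /rint.
rewrite (cint_split h1 h2 (econt_bot cq)) (cint_split h1 h2 (econt_top cq)).
move: (cint _ _ _) (cint _ _ _) (cint _ _ _) (cint _ _ _) (cint _ _ _) (cint _ _ _) (cint _ _ _)
  => a b c d e f g.
ring.
Qed.

Lemma rint_splity q x0 x1 y0 y1 y2 : y0 <= y1 -> y1 <= y2 ->
  econt q x0 x1 y0 y2 -> rint q x0 x1 y0 y2 = rint q x0 x1 y0 y1 + rint q x0 x1 y1 y2.
Proof.
move=> h2 h3 cq; rewrite /rint.
rewrite (cint_split h2 h3 (econt_left cq)) (cint_split h2 h3 (econt_right cq)).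
move: (cint _ _ _) (cint _ _ _) (cint _ _ _) (cint _ _ _) (cint _ _ _) (cint _ _ _) (cint _ _ _)
  => a b c d e f g.
ring.
Qed.

End rectangle_integral.

Arguments rint : simpl never.

(** * Goursat's theorem on rectangles *)

Section goursat.
Variable R : realType.
Local Notation C := (R[i]^o).
Implicit Types (q f g : C -> C) (x y : R).

Lemma ccontD f g z : ccont f z -> ccont g z -> ccont (fun u => f u + g u) z.
Proof.
move=> cf cg e e0; have e2 : 0 < e / 2 by rewrite divr_gt0.
have [d d0 H] := cf _ e2; have [d' d'0 K] := cg _ e2.
exists (Num.min d d'); first by rewrite lt_min d0.
move=> v; rewrite lt_min => /andP[/H hv /K kv].
by rewrite opprD addrACA [e]splitr (le_lt_trans (le_normcD _ _))// ltrD.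
Qed.

Lemma ccont_affine (a b z : C) : ccont (fun u => a * u + b) z.
Proof.
move=> e e0; have c0 : 0 < 1 + normc a by rewrite ltr_pwDl ?normc_ge0.
exists (e / (1 + normc a)); first by rewrite divr_gt0.
move=> v; rewrite ltr_pdivlMr// => ve.
rewrite (_ : _ - _ = a * v); last by ring.
rewrite normcM; apply: le_lt_trans ve; rewrite mulrC ler_wpM2l ?normc_ge0//.
by rewrite lerDr.
Qed.

Lemma nested_intervals (a b : nat -> R) : (forall n, a n <= a n.+1) ->
  (forall n, b n.+1 <= b n) -> (forall n, a n <= b n) ->
  exists X, forall n, a n <= X <= b n.
Proof.
move=> ai bd ab.
have Ai : {homo a : n m / (n <= m)%N >-> n <= m} by apply/nondecreasing_seqP.
have Bd : {homo b : n m / (n <= m)%N >-> m <= n} by apply/nonincreasing_seqP.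
have anb n m : a n <= b m.
  have [nm|mn] := leqP n m; first by rewrite (le_trans (Ai _ _ nm)).
  by rewrite (le_trans (ab n))// Bd// ltnW.
exists (sup (range a)) => n; apply/andP; split.
  apply: ub_le_sup; last by exists n.
  by exists (b 0%N) => _ [m _ <-].
by apply: ge_sup; [exists (a 0%N); exists 0%N|move=> _ [m _ <-]].
Qed.

Section bisection.
Variables (q : C -> C) (x0 y0 w h e : R).
Hypotheses (w0 : 0 <= w) (h0 : 0 <= h) (e0 : 0 < e).
Hypothesis dq : forall x y, x0 <= x <= x0 + w -> y0 <= y <= y0 + h ->
  exists d, is_cderiv q (x +i* y) d.

Let sz (a : R) n := a / 2 ^+ n.

Let bad n (p : R * R) := e * (sz w n + sz h n) ^+ 2 <
  normc (rint q p.1 (p.1 + sz w n) p.2 (p.2 + sz h n)).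

Let inbox n (p : R * R) := [/\ x0 <= p.1, p.1 + sz w n <= x0 + w,
  y0 <= p.2 & p.2 + sz h n <= y0 + h].

Let szS a n : sz a n = sz a n.+1 + sz a n.+1.
Proof. by rewrite /sz exprS invfM; lra. Qed.

Let sz_ge0 a n : 0 <= a -> 0 <= sz a n.
Proof. by move=> a0; rewrite divr_ge0// exprn_ge0. Qed.

Let inbox_rcont n p : inbox n p -> rcont q p.1 (p.1 + sz w n) p.2 (p.2 + sz h n).
Proof.
case=> h1 h2 h3 h4 x y /andP[h5 h6] /andP[h7 h8].
have [||d /is_cderiv_ccont//] := dq (x := x) (y := y).
  by move: (sz w n) (sz h n) h2 h4 h6 h8 => ? ? *; apply/andP; split; lra.
by move: (sz w n) (sz h n) h2 h4 h6 h8 => ? ? *; apply/andP; split; lra.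
Qed.

(** The threshold in [bad] is quadratic in the half-perimeter, so each quarter receives a fourth of
    it: four good quarters would make the whole rectangle good. *)
Lemma bisection_next n p : inbox n p -> bad n p -> exists p', [/\ inbox n.+1 p',
  bad n.+1 p', p.1 <= p'.1 /\ p'.1 + sz w n.+1 <= p.1 + sz w n &
  p.2 <= p'.2 /\ p'.2 + sz h n.+1 <= p.2 + sz h n].
Proof.
move=> ip bp; apply: contrapT => np.
have wn := sz_ge0 n.+1 w0; have hn := sz_ge0 n.+1 h0.
have cq := inbox_rcont ip.
move: ip bp np cq; rewrite /inbox /bad (szS w n) (szS h n).
move: (sz w n.+1) (sz h n.+1) wn hn => a b a0 b0 [i1 i2 i3 i4] bp np cq.
have H x y : p.1 <= x -> x + a <= p.1 + (a + a) -> p.2 <= y -> y + b <= p.2 + (b + b) ->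
    normc (rint q x (x + a) y (y + b)) <= e * (a + b) ^+ 2.
  move=> h1 h2 h3 h4; rewrite leNgt; apply/negP => bxy; apply: np.
  by exists (x, y); split => /=; [split; lra| |split; lra|split; lra].
have cq' x0' x1' y0' y1' : p.1 <= x0' -> x1' <= p.1 + (a + a) -> p.2 <= y0' ->
    y1' <= p.2 + (b + b) -> rcont q x0' x1' y0' y1'.
  by move=> h1 h2 h3 h4; apply: rcont_sub cq.
have E : rint q p.1 (p.1 + (a + a)) p.2 (p.2 + (b + b)) =
  (rint q p.1 (p.1 + a) p.2 (p.2 + b) + rint q p.1 (p.1 + a) (p.2 + b) (p.2 + b + b)) +
  (rint q (p.1 + a) (p.1 + a + a) p.2 (p.2 + b) +
   rint q (p.1 + a) (p.1 + a + a) (p.2 + b) (p.2 + b + b)).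
  rewrite !addrA.
  have la x : x <= x + a by rewrite lerDl.
  have lb x : x <= x + b by rewrite lerDl.
  have ea x : x + a + a <= x + (a + a) by rewrite addrA.
  have eb x : x + b + b <= x + (b + b) by rewrite addrA.
  have laa x := le_trans (la (x + a)) (ea x).
  have lbb x := le_trans (lb (x + b)) (eb x).
  rewrite (rint_splitx (la _) (la _) (rcont_econt (le_trans (la _) (la _)) (le_trans (lb _) (lb
    _)) (cq' _ _ _ _ (lexx _) (ea _) (lexx _) (eb _)))).
  rewrite (rint_splity (lb _) (lb _) (rcont_econt (la _) (le_trans (lb _) (lb _)) (cq' _ _ _ _
    (lexx _) (laa _) (lexx _) (eb _)))).
  rewrite (rint_splity (lb _) (lb _) (rcont_econt (la _) (le_trans (lb _) (lb _)) (cq' _ _ _ _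
    (la _) (ea _) (lexx _) (eb _)))).
  by rewrite !addrA.
move: bp; apply/negP; rewrite -leNgt E; clear E np cq cq'.
have e1 := H p.1 p.2; have e2 := H p.1 (p.2 + b); have e3 := H (p.1 + a) p.2.
have e4 := H (p.1 + a) (p.2 + b).
move: e1 e2 e3 e4.
move: (rint _ _ _ _ _) (rint _ _ _ _ _) (rint _ _ _ _ _) (rint _ _ _ _ _) => r4 r3 r2 r1.
have t1 := le_normcD (r1 + r2) (r3 + r4).
have t2 := le_normcD r1 r2; have t3 := le_normcD r3 r4.
move=> /(_ ltac:(lra) ltac:(lra) ltac:(lra) ltac:(lra)) n1.
move=> /(_ ltac:(lra) ltac:(lra) ltac:(lra) ltac:(lra)) n2.
move=> /(_ ltac:(lra) ltac:(lra) ltac:(lra) ltac:(lra)) n3.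
move=> /(_ ltac:(lra) ltac:(lra) ltac:(lra) ltac:(lra)) n4.
have -> : e * (a + a + (b + b)) ^+ 2 = 4 * (e * (a + b) ^+ 2) by ring.
clear H; lra.
Qed.

(** Otherwise nested bad rectangles shrink to a point where [q] is differentiable. Subtracting the
    affine part of [q] there does not change the integral, and the remainder is too small for a bad
    rectangle. *)
Lemma goursat_le : normc (rint q x0 (x0 + w) y0 (y0 + h)) <= e * (w + h) ^+ 2.
Proof.
rewrite leNgt; apply/negP => b0.
have sz0 a : sz a 0 = a by rewrite /sz expr0 divr1.
have /choice[g Hg] : forall np : nat * (R * R), exists p' : R * R,
    inbox np.1 np.2 -> bad np.1 np.2 ->
    [/\ inbox np.1.+1 p', bad np.1.+1 p',
    np.2.1 <= p'.1 /\ p'.1 + sz w np.1.+1 <= np.2.1 + sz w np.1 &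
    np.2.2 <= p'.2 /\ p'.2 + sz h np.1.+1 <= np.2.2 + sz h np.1].
  move=> [n p] /=.
  have [ip|nip] := pselect (inbox n p); last by exists p.
  have [bp|nbp] := pselect (bad n p); last by exists p.
  by have [p' H] := bisection_next ip bp; exists p'.
pose fix c n := if n is m.+1 then g (m, c m) else (x0, y0).
have cP n : inbox n (c n) /\ bad n (c n).
  elim: n => [|n [ih1 ih2]] /=; last by have [] := Hg (n, c n) ih1 ih2.
  by rewrite /inbox /bad /= !sz0.
have cS n : [/\ (c n).1 <= (c n.+1).1, (c n.+1).1 + sz w n.+1 <= (c n).1 + sz w n,
    (c n).2 <= (c n.+1).2 & (c n.+1).2 + sz h n.+1 <= (c n).2 + sz h n].
  by have [ih1 ih2] := cP n; have [_ _ [? ?] [? ?]] := Hg (n, c n) ih1 ih2.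
have [X HX] := @nested_intervals (fun n => (c n).1) (fun n => (c n).1 + sz w n)
  (fun n => let: And4 h _ _ _ := cS n in h) (fun n => let: And4 _ h _ _ := cS n in h)
  ltac:(by move=> n; rewrite lerDl sz_ge0).
have [Y HY] := @nested_intervals (fun n => (c n).2) (fun n => (c n).2 + sz h n)
  (fun n => let: And4 _ _ h _ := cS n in h) (fun n => let: And4 _ _ _ h := cS n in h)
  ltac:(by move=> n; rewrite lerDl sz_ge0).
have [d dz] : exists d, is_cderiv q (X +i* Y) d.
  apply: dq; first by have := HX 0%N; rewrite /= sz0.
  by have := HY 0%N; rewrite /= sz0.
(* The 4 cancels the constant of [rint_le], so that the remainder gives exactly the threshold of
   [bad]. *)
have [dl dl0 H] := dz (e / 4) ltac:(by rewrite divr_gt0).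
have [n Hn] : exists n, sz w n + sz h n < dl.
  have wh : 0 <= (w + h) / dl by rewrite divr_ge0 ?addr_ge0// ltW.
  exists (Num.bound ((w + h) / dl)).
  rewrite /sz -mulrDl ltr_pdivrMr ?exprn_gt0// mulrC -ltr_pdivrMr//.
  rewrite (lt_trans (archi_boundP wh))// -natrX ltr_nat; exact: ltn_expl.
have [ib] := cP n; rewrite /bad; apply/negP; rewrite -leNgt.
have cq := inbox_rcont ib.
set z : C := X +i* Y.
have aff : rcont (fun u => d * u + (q z - d * z)) (c n).1 ((c n).1 + sz w n) (c n).2 ((c n).2 +
  sz h n).
  by move=> x y _ _; exact: ccont_affine.
have aff' : rcont (fun u => (- d) * u + - (q z - d * z)) (c n).1 ((c n).1 + sz w n) (c n).2 ((c
  n).2 + sz h n).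
  by move=> x y _ _; exact: ccont_affine.
have wn := sz_ge0 n w0; have hn := sz_ge0 n h0.
have ww : (c n).1 <= (c n).1 + sz w n by rewrite lerDl.
have hh : (c n).2 <= (c n).2 + sz h n by rewrite lerDl.
pose r u := q u + ((- d) * u + - (q z - d * z)).
have rc : rcont r (c n).1 ((c n).1 + sz w n) (c n).2 ((c n).2 + sz h n).
  by move=> x y xb yb; apply: ccontD; [exact: cq|exact: aff'].
have idc (a b a' b' : R) : rcont (fun z : C => z) a b a' b' by move=> *; exact: ccont_id.
have cstc (k : C) (a b a' b' : R) : rcont (fun z : C => k) a b a' b'.
  by move=> x y _ _ e' e'0; exists 1 => // v _; rewrite subrr normc0.
have mulc (a b a' b' : R) : rcont (fun u => d * u) a b a' b'.
  by move=> x y _ _; have := ccont_affine d 0 (x +i* y); under eq_fun do rewrite addr0.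
have E : rint q (c n).1 ((c n).1 + sz w n) (c n).2 ((c n).2 + sz h n) =
         rint r (c n).1 ((c n).1 + sz w n) (c n).2 ((c n).2 + sz h n).
  have -> : q = (fun u => r u + (d * u + (q z - d * z))).
    by apply/funext => u; rewrite /r; ring.
  rewrite rintD; [|exact: rcont_econt..].
  rewrite [X in _ + X](@rintD _ _ _ _ _ (fun u => d * u) (fun=> q z - d * z)); [|exact:
    rcont_econt..].
  by rewrite rintZ ?rint_id ?rint_cst ?mulr0 ?addr0//; exact: rcont_econt.
rewrite E; have := @rint_le _ _ _ _ _ ww hh r (e / 4 * (sz w n + sz h n)) (rcont_econt ww hh rc).
have -> : forall x y a b, 4 * (e / 4 * (a + b)) * ((x + a) - x + ((y + b) - y)) = e * (a + b) ^+
  2.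
  by move=> *; field.
suff H' x y : (c n).1 <= x <= (c n).1 + sz w n -> (c n).2 <= y <= (c n).2 + sz h n ->
    normc (r (x +i* y)) <= e / 4 * (sz w n + sz h n).
  by apply; split => t tb; split; apply: H'; rewrite ?lexx ?ww ?hh.
move=> /andP[x1 x2] /andP[y1 y2].
have := HX n; have := HY n => /andP[Y1 Y2] /andP[X1 X2].
have v1 : normc ((x - X) +i* (y - Y)) <= sz w n + sz h n.
  rewrite (le_trans (normc_le_ReIm _))//= lerD// ler_norml; apply/andP; split; lra.
have := H _ (le_lt_trans v1 Hn).
have -> : z + ((x - X) +i* (y - Y)) = x +i* y.
  by apply/eqP; rewrite eq_complex /= !subrKC !eqxx.
rewrite /r (_ : _ - _ - _ = q (x +i* y) + (- d * (x +i* y) - (q z - d * z))); last first.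
  have -> : ((x - X) +i* (y - Y)) = (x +i* y) - z by [].
  by ring.
move=> /le_trans; apply; rewrite ler_wpM2l// divr_ge0//; exact: ltW.
Qed.

End bisection.

Lemma goursat q x0 x1 y0 y1 : x0 <= x1 -> y0 <= y1 ->
  (forall x y, x0 <= x <= x1 -> y0 <= y <= y1 -> derivable q (x +i* y) 1) ->
  rint q x0 x1 y0 y1 = 0.
Proof.
move=> xx yy dq; apply: eq0_normc; apply/eqP; rewrite eq_le normc_ge0 andbT.
apply/ler_addgt0Pl => e e0; rewrite addr0.
have k0 : 0 < 1 + (x1 - x0 + (y1 - y0)) ^+ 2 by rewrite ltr_pwDl ?sqr_ge0.
have := @goursat_le q x0 y0 (x1 - x0) (y1 - y0) (e / (1 + (x1 - x0 + (y1 - y0)) ^+ 2)).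
rewrite !subr_ge0 !subrKC => /(_ xx yy ltac:(by rewrite divr_gt0)) H.
rewrite (le_trans (H _))//.
  by move=> x y xb yb; exists ('D_1 q (x +i* y)); apply: derivable_is_cderiv; exact: dq.
rewrite -mulrA ger_pMr// mulrC ler_pdivrMr// mul1r lerDr//.
Qed.

End goursat.

(** * Rectangles around a hole or a simple pole *)

Section pole.
Variable R : realType.
Local Notation C := (R[i]^o).
Local Notation mu := (@lebesgue_measure R).
Implicit Types (q f g : C -> C) (x y : R).

(** Two full-height strips at the left and right, and the two pieces above and below the inner
    rectangle, fill the frame; Goursat's theorem removes each of them. *)
Lemma rint_hollow q X0 x0 x1 X1 Y0 y0 y1 Y1 :
  X0 <= x0 -> x0 <= x1 -> x1 <= X1 -> Y0 <= y0 -> y0 <= y1 -> y1 <= Y1 ->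
  (forall x y, X0 <= x <= X1 -> Y0 <= y <= Y1 -> ~~ ((x0 < x < x1) && (y0 < y < y1)) ->
    derivable q (x +i* y) 1) ->
  rint q X0 X1 Y0 Y1 = rint q x0 x1 y0 y1.
Proof.
move=> a1 a2 a3 b1 b2 b3 dq.
have oX x : x <= x0 \/ x1 <= x -> X0 <= x <= X1 -> forall y, Y0 <= y <= Y1 -> derivable q (x +i*
  y) 1.
  move=> xx xb y yb; apply: dq => //; rewrite !negb_and -!leNgt.
  by case: xx => ->; rewrite ?orbT.
have oY y : y <= y0 \/ y1 <= y -> Y0 <= y <= Y1 -> forall x, X0 <= x <= X1 -> derivable q (x +i*
  y) 1.
  move=> yy yb x xb; apply: dq => //; rewrite !negb_and -!leNgt.
  by case: yy => ->; rewrite ?orbT.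
have le3 (a b c d x : R) : a <= b -> d <= c -> b <= x <= d -> a <= x <= c.
  by move=> ab cd /andP[bx xd]; rewrite (le_trans ab bx) (le_trans xd cd).
have hY0 := le_trans b1 (le_trans b2 b3); have hX0 := le_trans a1 (le_trans a2 a3).
have bY0 x : X0 <= x <= X1 -> ccont q (x +i* Y0).
  by move=> xb; apply: derivable_ccont; apply: (oY _ _ _ x) => //; [left|rewrite lexx].
have bY1 x : X0 <= x <= X1 -> ccont q (x +i* Y1).
  by move=> xb; apply: derivable_ccont; apply: (oY _ _ _ x) => //; [right|rewrite lexx andbT].
have bX x : x <= x0 \/ x1 <= x -> X0 <= x <= X1 -> forall y, Y0 <= y <= Y1 -> ccont q (x +i* y).
  by move=> xx xb y yb; apply: derivable_ccont; exact: oX.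
rewrite (@rint_splitx _ q X0 x0 X1) ?(le_trans a2 a3)//; last first.
  split=> t tb; split; [exact: bY0|exact: bY1| |].
    by apply: bX => //; [left|rewrite lexx].
  by apply: bX => //; [right|rewrite lexx andbT].
rewrite (@rint_splitx _ q x0 x1 X1)//; last first.
  split=> t tb; split; [apply: bY0; exact: le3 tb|apply: bY1; exact: le3 tb| |].
    by apply: bX => //; [left|rewrite a1 (le_trans a2)].
  by apply: bX => //; [right|rewrite lexx andbT].
rewrite (@goursat _ q X0 x0)//; last first.
  move=> x y xb yb; apply: oX yb; first by left; case/andP: xb.
  by apply: le3 xb => //; rewrite (le_trans a2).
rewrite (@goursat _ q x1 X1)//; last first.
  move=> x y xb yb; apply: oX yb; first by right; case/andP: xb.
  by apply: le3 xb => //; rewrite (le_trans a1).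
rewrite add0r addr0.
rewrite (@rint_splity _ q x0 x1 Y0 y0 Y1) ?(le_trans b2 b3)//; last first.
  split=> t tb; split; [apply: bY0; exact: le3 tb|apply: bY1; exact: le3 tb| |].
    by apply: bX => //; [left|rewrite a1 (le_trans a2)].
  by apply: bX => //; [right|rewrite a3 (le_trans a1)].
rewrite (@rint_splity _ q x0 x1 y0 y1 Y1)//; last first.
  split=> t tb; split.
  - apply: derivable_ccont; apply: oY; [by left|by rewrite b1 (le_trans b2)|exact: le3 tb].
  - by apply: bY1; exact: le3 tb.
  - by apply: bX => //; [left|rewrite a1 (le_trans a2)|exact: le3 tb].
  - by apply: bX => //; [right|rewrite a3 (le_trans a1)|exact: le3 tb].
rewrite (@goursat _ q x0 x1 Y0)//; last first.
  move=> x y xb yb; apply: oY; [by left; case/andP: yb| |exact: le3 xb].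
  by apply: le3 yb => //; rewrite (le_trans b2).
rewrite (@goursat _ q x0 x1 y1)//; last first.
  move=> x y xb yb; apply: oY; [by right; case/andP: yb| |exact: le3 xb].
  by apply: le3 yb => //; rewrite (le_trans b1).
by rewrite add0r addr0.
Qed.

Lemma cint_Re_ge (g : R -> C) a b (m : R) : a <= b -> lcont g a b ->
  (forall t, a <= t <= b -> m <= complex.Re (g t)) -> m * (b - a) <= complex.Re (cint g a b).
Proof.
move=> ab cg gm.
have -> : m * (b - a) = \int[mu]_(t in `[a, b]) m.
  have := cint_cst m%:C ab; rewrite /cint /= => /(congr1 (@complex.Re R)) /= ->.
  ring.
apply: le_Rintegral => //.
- have := lcont_Re (@lcont_cst _ a b m%:C); exact.
- exact: lcont_Re.
Qed.

Lemma derivable_pole (w z : C) : z != w -> derivable (fun u : C => (u - w)^-1) z 1.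
Proof.
move=> zw.
have d2 : derivable (fun u : C => u - w) z 1.
  by apply: derivableB; [exact: derivable_id|exact: derivable_cst].
by apply: (@derivableV _ C _ z 1 _ d2); rewrite subr_eq0.
Qed.

(** A lower bound replaces the exact value [2 pi i]. On each side, of length [2 e], the contribution
    to the imaginary part has density at least [1 / (2 e)], so every side yields at least 1. *)
Lemma rint_pole_ge (w1 w2 e : R) : 0 < e ->
  4 <= normc (rint (fun z => (z - (w1 +i* w2))^-1) (w1 - e) (w1 + e) (w2 - e) (w2 + e)).
Proof.
move=> e0.
pose g z : C := (z - (w1 +i* w2))^-1.
have ne1 x y : y - w2 != 0 -> (x +i* y : C) != w1 +i* w2.
  by apply: contra => /eqP[_ ->]; rewrite subrr.
have ne2 x y : x - w1 != 0 -> (x +i* y : C) != w1 +i* w2.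
  by apply: contra => /eqP[-> _]; rewrite subrr.
have cg : econt g (w1 - e) (w1 + e) (w2 - e) (w2 + e).
  split=> t tb; split; apply: derivable_ccont; apply: derivable_pole;
    [apply: ne1|apply: ne1|apply: ne2|apply: ne2];
    by rewrite addrAC subrr add0r ?oppr_eq0 gt_eqF.
have B (s t : R) : 0 < s -> `|t| <= s -> (2 * s)^-1 <= s / (t ^+ 2 + s ^+ 2).
  move=> s0 ts; have t2 : t ^+ 2 <= s ^+ 2 by rewrite -(real_normK (num_real t)) lerXn2r ?nnegrE
    ?(ltW s0).
  rewrite ler_pdivlMr ?ltr_wpDl ?sqr_ge0 ?exprn_gt0// mulrC ler_pdivrMr ?mulr_gt0//.
  by rewrite mulrCA -expr2 mulrDl mul1r lerD2r.
have nb (c t : R) : c - e <= t <= c + e -> `|t - c| <= e.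
  by rewrite ler_distl.
have ege (m : R) : (2 * e)^-1 * (m + e - (m - e)) = 1.
  by field; rewrite gt_eqF.
have ab c : c - e <= c + e by rewrite lerD2l; lra.
have iE (z : C) : complex.Re (- 'i * z) = complex.Im z.
  by case: z => x y; rewrite /=; ring.
have iE' (z : C) : complex.Re ('i * z) = - complex.Im z.
  by case: z => x y; rewrite /=; ring.
have e2 : (e^+2 = (- e)^+2) by rewrite sqrrN.
have h1 : 1 <= complex.Re (cint (fun x => - 'i * g (x +i* (w2 - e))) (w1 - e) (w1 + e)).
  rewrite -(ege w1); apply: cint_Re_ge => //; first exact: lcontZ (econt_bot cg).
  move=> t /nb tb; rewrite iE /g /= (_ : w2 - e - w2 = - e); last by ring.
  by rewrite mulNr opprK sqrrN B.
have h2 : 1 <= complex.Re (cint (fun x => 'i * g (x +i* (w2 + e))) (w1 - e) (w1 + e)).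
  rewrite -(ege w1); apply: cint_Re_ge => //; first exact: lcontZ (econt_top cg).
  move=> t /nb tb; rewrite iE' /g /= (_ : w2 + e - w2 = e); last by ring.
  by rewrite opprK B.
have h3 : 1 <= complex.Re (cint (fun y => g ((w1 + e) +i* y)) (w2 - e) (w2 + e)).
  rewrite -(ege w2); apply: cint_Re_ge => //; first exact: (econt_right cg).
  move=> t /nb tb; rewrite /g /= (_ : w1 + e - w1 = e); last by ring.
  by rewrite addrC B.
have h4 : 1 <= complex.Re (cint (fun y => (- 1) * g ((w1 - e) +i* y)) (w2 - e) (w2 + e)).
  rewrite -(ege w2); apply: cint_Re_ge => //; first exact: lcontZ (econt_left cg).
  move=> t /nb tb; rewrite mulN1r /g /= (_ : w1 - e - w1 = - e); last by ring.
  by rewrite mulNr opprK sqrrN addrC B.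
rewrite (cintZ _ (econt_bot cg)) iE in h1; rewrite (cintZ _ (econt_top cg)) iE' in h2.
rewrite (cintZ _ (econt_left cg)) mulN1r in h4.
apply: le_trans (norm_Im_le _); apply: le_trans (ler_norm _); rewrite /rint -/g.
move: h1 h2 h3 h4; move: (cint _ _ _) (cint _ _ _) (cint _ _ _) (cint _ _ _).
clear; move=> [a a'] [b b'] [c c'] [d d'] /=; lra.
Qed.

End pole.

(** * Derivative bound at a zero *)

Section pole_estimate.
Variable R : realType.
Local Notation C := (R[i]^o).
Implicit Types (q f g : C -> C) (x y : R).

Definition square q (a1 a2 s : R) := rint q (a1 - s) (a1 + s) (a2 - s) (a2 + s).

Lemma ler_dist_itv (c s x : R) : (c - s <= x <= c + s) = (`|x - c| <= s).
Proof. by rewrite ler_distl. Qed.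

Lemma ltr_dist_itv (c s x : R) : (c - s < x < c + s) = (`|x - c| < s).
Proof. by rewrite ltr_distl. Qed.

Lemma square_two_holes q (a1 a2 rho s S e : R) : 0 < s -> 0 < e ->
  s <= rho - e -> rho + e <= S -> 
  (forall x y, `|x - a1| <= S -> `|y - a2| <= S -> ~~ ((`|x - a1| < s) && (`|y - a2| < s)) ->
     (x +i* y : C) != (a1 + rho) +i* a2 -> derivable q (x +i* y) 1) ->
  square q a1 a2 S = square q a1 a2 s + square q (a1 + rho) a2 e.
Proof.
move=> s0 e0 sr rS dq; rewrite /square.
(* The vertical line through the left side of the small square separates the two holes, leaving one
   for [rint_hollow] in each half. *)
pose m := a1 + rho - e.
rewrite (@rint_splitx _ q _ m) /m; [|lra|lra|]; last first.
  have N x y : (`|x - a1| == S) || (`|y - a2| == S) -> `|x - a1| <= S -> `|y - a2| <= S ->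
      ccont q (x +i* y).
    move=> h xb yb; apply: derivable_ccont; apply: dq => //.
      by rewrite negb_and -!leNgt; case/orP: h => /eqP ->; apply/orP; [left|right]; lra.
    apply/eqP => -[xE yE]; move: h; rewrite xE yE subrr normr0 addrAC subrr add0r ger0_norm; last
      by lra.
    by case/orP => /eqP; lra.
  have SS : `|S| = S by rewrite ger0_norm; lra.
  have e1 c : `|c - S - c| = S by rewrite addrAC subrr add0r normrN.
  have e2 c : `|c + S - c| = S by rewrite addrAC subrr add0r.
  split=> t; rewrite ler_dist_itv => tb; split; apply: N;
    by rewrite ?e1 ?e2 ?eqxx ?orbT.
congr (_ + _).
  apply: rint_hollow; [lra..|move=> x y /andP[x1 x2]; rewrite ler_dist_itv ltr_dist_itv => yb].
  rewrite ltr_dist_itv => h; apply: dq => //.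
    by rewrite -ler_dist_itv x1/=; lra.
  by apply/eqP => -[xE _]; lra.
apply: rint_hollow; [lra..|move=> x y /andP[x1 x2]; rewrite ler_dist_itv ltr_dist_itv => yb].
rewrite ltr_dist_itv => h; apply: dq => //.
- by rewrite -ler_dist_itv x2 andbT; lra.
- rewrite negb_and -leNgt; apply/orP; left; rewrite (le_trans _ (ler_norm _))//; lra.
- apply/eqP => -[xE yE]; move: h.
  by rewrite xE yE !subrr normr0 !e0.
Qed.

(** With [F = f (w + v)], the difference equals [F / v + rho (F - d v) / v ^ 2]. The bound on the
    second term carries [1 / e], which the length of the small contour compensates later. *)
Lemma pole_remainder f (a w d v : C) (eta e rho : R) : f w = 0 -> w - a = rho%:C ->
  0 <= rho -> 0 <= eta -> 0 < e -> e <= normc v ->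
  normc (f (w + v) - f w - d * v) <= eta * normc v ->
  normc ((w + v - a) * f (w + v) / (w + v - w) ^+ 2 + (- (rho%:C * d)) * (w + v - w)^-1) <=
  normc d + eta + rho * eta / e.
Proof.
move=> fw wa rho0 eta0 e0 ev; rewrite fw subr0 => fv.
have v0 : v != 0 by rewrite -normc_gt0 (lt_le_trans e0).
have nv : 0 < normc v by rewrite normc_gt0.
have -> : w + v - a = v + rho%:C by rewrite -wa (addrC w v) addrA.
have -> : w + v - w = v by rewrite (addrC w v) addrK.
set F := f _ in fv *.
have -> : (v + rho%:C) * F / v ^+ 2 + - (rho%:C * d) / v =
  (v * F + rho%:C * (F - d * v)) / v ^+ 2 by field.
rewrite normcM normcV ler_pdivrMr; last by rewrite normc_gt0 expf_neq0.
rewrite (le_trans (le_normcD _ _))// !normcM normc_real ger0_norm//.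
have FF : normc F <= (normc d + eta) * normc v.
  have -> : F = (F - d * v) + d * v by rewrite subrK.
  by rewrite (le_trans (le_normcD _ _))// normcM addrC mulrDl lerD2l.
have h1 : normc v * normc F <= (normc d + eta) * (normc v * normc v).
  by rewrite mulrC mulrA ler_wpM2r// ltW.
have h2 : rho * normc (F - d * v) <= rho * eta / e * (normc v * normc v).
  rewrite (le_trans (ler_wpM2l rho0 fv))//.
  have -> : rho * eta / e * (normc v * normc v) = rho * (eta * normc v) * (normc v / e) by ring.
  by rewrite ler_peMr ?mulr_ge0 ?(ltW nv)// ler_pdivlMr// mul1r.
by rewrite (le_trans (lerD h1 h2))// -mulrDl.
Qed.

(* A simple pole at [w] with residue [(w - a) * f' w]; the factor [z - a] makes the contribution
   of the contour around [a] small. *)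
Definition pole_quotient f (a w : C) := fun z : C => (z - a) * f z / (z - w) ^+ 2.

(** The difference of the two contour integrals is the integral over a small square around [w],
    where the quotient is [rho * f' w / (z - w)] up to a remainder. The first-order expansion of [f]
    at [w] makes that remainder contribute at most [tau], for every [tau > 0]. *)
Lemma pole_estimate f (a1 a2 rho s S : R) : 0 < s -> s < rho -> rho < S ->
  let a := a1 +i* a2 in let w := (a1 + rho) +i* a2 in
  (forall x y, `|x - a1| <= S -> `|y - a2| <= S -> ~~ ((`|x - a1| < s) && (`|y - a2| < s)) ->
     derivable f (x +i* y) 1) -> f w = 0 ->
  4 * rho * normc ('D_1 f w) <= normc (square (pole_quotient f a w) a1 a2 S) +
    normc (square (pole_quotient f a w) a1 a2 s).
Proof.
move=> s0 sr rS a w df fw; set q := pole_quotient f a w.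
apply/ler_addgt0Pl => tau tau0.
set d := 'D_1 f w.
have rho0 : 0 < rho by rewrite (lt_trans s0).
have dw : is_cderiv f w d.
  apply: derivable_is_cderiv; apply: df.
  - by rewrite addrAC subrr add0r ger0_norm ltW.
  - by rewrite subrr normr0; lra.
  - rewrite negb_and -leNgt addrAC subrr add0r; apply/orP; left.
    by rewrite ger0_norm ltW.
(* The choice of [eta] and the last bound on [e] below account for [tau / 2] each; [e <= dl / 3]
   keeps the contour, where [normc v <= 2 * e], inside the range of the expansion. *)
pose eta := tau / (32 * rho).
have eta0 : 0 < eta by rewrite divr_gt0// mulr_gt0.
have [dl dl0 Hdl] := dw _ eta0.
have k0 : 0 < normc d + eta by rewrite ltr_wpDl ?normc_ge0.
pose e := Num.min (Num.min ((rho - s) / 2) ((S - rho) / 2)) (Num.min (dl / 3) (tau / (32 * (normc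
  d + eta)))).
have e0 : 0 < e.
  by rewrite !lt_min !divr_gt0 ?subr_gt0 ?mulr_gt0.
have [e1 e2 e3 e4] : [/\ e <= (rho - s) / 2, e <= (S - rho) / 2, e <= dl / 3 &
    e <= tau / (32 * (normc d + eta))].
  by split; rewrite !ge_min lexx ?orbT.
have dq x y : `|x - a1| <= S -> `|y - a2| <= S -> ~~ ((`|x - a1| < s) && (`|y - a2| < s)) ->
     (x +i* y : C) != w -> derivable q (x +i* y) 1.
  by move=> h1 h2 h3 h4; apply: derivable_frac => //; exact: df.
have E : square q a1 a2 S = square q a1 a2 s + square q (a1 + rho) a2 e.
  by apply: square_two_holes dq => //; clear -e1 e2 e0 sr rS; lra.
pose g z : C := (z - w)^-1.
pose r z := q z + (- (rho%:C * d)) * g z.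
have wx (x y : R) : x - (a1 + rho) != 0 -> (x +i* y : C) != w.
  by apply: contra => /eqP[-> _]; rewrite subrr.
have wy (x y : R) : y - a2 != 0 -> (x +i* y : C) != w.
  by apply: contra => /eqP[_ ->]; rewrite subrr.
pose P (z : C) := exists2 v : C, z = w + v & e <= normc v <= 2 * e /\ 
   [/\ `|complex.Re z - a1| <= S, `|complex.Im z - a2| <= S &
   ~~ ((`|complex.Re z - a1| < s) && (`|complex.Im z - a2| < s))].
have edgeP : edges P (a1 + rho - e) (a1 + rho + e) (a2 - e) (a2 + e).
  have aux (x y : R) : `|x - (a1 + rho)| <= e -> `|y - a2| <= e ->
      (`|x - (a1 + rho)| == e) || (`|y - a2| == e) -> P (x +i* y).
    move=> xb yb xye; exists ((x - (a1 + rho)) +i* (y - a2)).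
      by apply/eqP; rewrite eq_complex /= !subrKC !eqxx.
    split.
      apply/andP; split; last first.
        by rewrite (le_trans (normc_le_ReIm _))//= mulr2n mulrDl mul1r lerD.
      case/orP: xye => /eqP <-; [exact: (norm_Re_le (_ +i* _))|exact: (norm_Im_le (_ +i* _))].
    move: xb yb; clear -e1 e2 e0 sr rS s0; rewrite !ler_norml => /andP[x1 x2] /andP[y1 y2] /=.
    split; [apply/andP; split; lra|apply/andP; split; lra|].
    by rewrite negb_and -leNgt; apply/orP; left; rewrite (le_trans _ (ler_norm _))//; lra.
  have ee : `|e| = e by rewrite ger0_norm// ltW.
  have m1 c : `|c - e - c| = e by rewrite addrAC subrr add0r normrN.
  have m2 c : `|c + e - c| = e by rewrite addrAC subrr add0r.
  split=> t; rewrite ler_dist_itv => tb; split; apply: aux => //; by rewrite ?m1 ?m2 ?eqxx ?orbT.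
have Pw z : P z -> z != w.
  move=> [v -> [/andP[ev _] _]]; rewrite -subr_eq0 addrAC subrr add0r.
  by rewrite -normc_gt0 (lt_le_trans e0).
have edges_imp (Q : C -> Prop) : (forall z, P z -> Q z) -> edges Q (a1 + rho - e) (a1 + rho + e)
  (a2 - e) (a2 + e).
  by move=> PQ; case: edgeP => p1 p2; split=> t tb; split; apply: PQ; [apply: (p1 _ tb).1|apply:
    (p1 _ tb).2|apply: (p2 _ tb).1|apply: (p2 _ tb).2].
have cq z : P z -> ccont q z.
  move=> Pz; have zw := Pw _ Pz; case: Pz => v zE [_ [h1 h2 h3]].
  by apply: derivable_ccont; case: z {zE} h1 h2 h3 zw => x y; exact: dq.
have cg z : P z -> ccont g z.
  by move=> /Pw zw; apply: derivable_ccont; exact: derivable_pole.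
have cgk k z : P z -> ccont (fun u => k * g u) z.
  move=> Pz; have := cg _ Pz; move=> {}cg ep ep0.
  have c0 : 0 < 1 + normc k by rewrite ltr_pwDl ?normc_ge0.
  have [dd dd0 H] := cg (ep / (1 + normc k)) ltac:(by rewrite divr_gt0).
  exists dd => // v /H; rewrite ltr_pdivlMr// -mulrBr normcM.
  by apply: le_lt_trans; rewrite mulrC ler_wpM2l ?normc_ge0// lerDr.
have Er : square r (a1 + rho) a2 e = square q (a1 + rho) a2 e - (rho%:C * d) * square g (a1 +
  rho) a2 e.
  rewrite /square rintD ?rintZ ?mulNr//; apply: edges_imp => z Pz; [exact: cg|exact: cq|exact:
    cgk].
have rM : normc (square r (a1 + rho) a2 e) <= 4 * (normc d + eta + rho * eta / e) * (4 * e).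
  apply: (le_trans (rint_le _ _ _ (M := normc d + eta + rho * eta / e) _)).
  - by rewrite lerD2l; lra.
  - by rewrite lerD2l; lra.
  - by apply: edges_imp => z Pz; apply: ccontD; [exact: cq|exact: cgk].
  - apply: edges_imp => z [v -> [/andP[ev ve] _]]; apply: pole_remainder => //; try exact: ltW.
      by apply/eqP; rewrite eq_complex /= addrAC !subrr add0r !eqxx.
    apply: Hdl; clear -ve e3 dl0 e0; lra.
  rewrite le_eqVlt; apply/orP; left; apply/eqP; ring.
have M2 : 4 * (normc d + eta + rho * eta / e) * (4 * e) <= tau.
  have -> : 4 * (normc d + eta + rho * eta / e) * (4 * e) = 16 * (e * (normc d + eta)) + 16 *
    (rho * eta).
    by field; rewrite gt_eqF.
  have -> : rho * eta = tau / 32 by rewrite /eta; field; rewrite gt_eqF.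
  have : e * (normc d + eta) <= tau / 32.
    by rewrite -ler_pdivlMr// -mulrA -invfM.
  clear -tau0; move: (e * _) => x; lra.
have pg := rint_pole_ge (a1 + rho) a2 e0.
rewrite -/w -/(square g (a1 + rho) a2 e) in pg.
have h1 : 4 * rho * normc d <= normc ((rho%:C * d) * square g (a1 + rho) a2 e).
  rewrite !normcM normc_real ger0_norm ?(ltW rho0)//.
  have -> : 4 * rho * normc d = rho * normc d * 4 by ring.
  by rewrite ler_wpM2l ?mulr_ge0 ?normc_ge0 ?(ltW rho0).
have h2 : (rho%:C * d) * square g (a1 + rho) a2 e = square q (a1 + rho) a2 e - square r (a1 +
  rho) a2 e.
  by rewrite Er subKr.
have h3 : square q (a1 + rho) a2 e = square q a1 a2 S - square q a1 a2 s.
  by rewrite E addrAC subrr add0r.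
have h4 := le_normcD (square q (a1 + rho) a2 e) (- square r (a1 + rho) a2 e).
have h5 := le_normcD (square q a1 a2 S) (- square q a1 a2 s).
rewrite -h2 normcN in h4; rewrite -h3 normcN in h5.
rewrite (le_trans h1)// (le_trans h4)// addrC lerD// (le_trans rM)//.
Qed.

End pole_estimate.

(** * Lines along which the integral of the modulus is bounded *)

Section good_lines.
Variable R : realType.
Local Notation C := (R[i]^o).
Local Notation mu := (@lebesgue_measure R).
Local Notation area := (@lebesgue_measure R \x @lebesgue_measure R)%E.
Implicit Types (q f g : C -> C) (x y : R).

Lemma small_value (H : R -> \bar R) (al be M : R) : al < be -> 0 < M ->
  measurable_fun setT H -> (forall x, 0 <= H x)%E -> (\int[mu]_x H x <= M%:E)%E ->
  exists2 x, al <= x <= be & (H x <= (2 * M / (be - al))%:E)%E.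
Proof.
move=> ab M0 mH H0 HM; apply: contrapT => nx.
have K x : `[al, be]%classic x -> ((2 * M / (be - al))%:E <= H x)%E.
  rewrite /= in_itv /= => xab; rewrite leNgt; apply/negP => /ltW Hx; apply: nx.
  by exists x.
have : (\int[mu]_(x in `[al, be]) (cst (2 * M / (be - al))%:E x) <= M%:E)%E.
  apply: le_trans HM; apply: (@le_trans _ _ (\int[mu]_(x in `[al, be]) H x)%E).
    apply: ge0_le_integral => //.
    - by move=> x _; rewrite lee_fin divr_ge0 ?subr_ge0 ?mulr_ge0 ?ltW.
    - exact: measurable_funS mH.
  exact: ge0_subset_integral.
rewrite integral_cst//= lebesgue_measure_itv /= lte_fin ab -EFinD -EFinM lee_fin.
by rewrite divfK ?gt_eqF ?subr_gt0// => h; lra.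
Qed.

Variables (O : set C) (oO : open O) (f : C -> C) (hf : holomorphic_on O f).
Let pO := @of_pair R @^-1` O.

(** Extended by 0 to the plane, so that Tonelli's theorem applies on whole lines. *)
Definition abs_box (B : set (R * R)) : R * R -> \bar R :=
  (fun p => (normc (f (of_pair p)))%:E) \_ (pO `&` B).

Lemma measurable_normc_f : measurable_fun pO (fun p => normc (f (of_pair p))).
Proof.
apply: measurable_ccont => //; first by move=> z /hf/derivable_ccont.
exact: normc_lipschitz.
Qed.

Lemma measurable_abs_box B : measurable B -> measurable_fun setT (abs_box B).
Proof.
move=> mB.
have mOB := measurableI _ _ (measurable_preimage oO) mB.
apply/(measurable_restrictT _ mOB).
apply/measurable_EFinP; apply: measurable_funS measurable_normc_f.
  exact: measurable_preimage.
exact: subIsetl.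
Qed.

Lemma abs_box_ge0 B p : (0 <= abs_box B p)%E.
Proof. by rewrite /abs_box patchE; case: ifP => // _; rewrite lee_fin normc_ge0. Qed.

(** Cauchy-Schwarz in the form [t <= s * t ^+ 2 + 1 / (4 * s)]: integrated over [B], each of the two
    terms contributes at most [s]. *)
Lemma mass_box B (s : R) : 0 < s -> measurable B -> (area B <= (4 * s ^+ 2)%:E)%E ->
  (\int[area]_(p in pO) (normc (f (of_pair p)) ^+ 2)%:E <= 1)%E ->
  (\int[area]_p abs_box B p <= (2 * s)%:E)%E.
Proof.
move=> s0 mB aB i1; rewrite /abs_box -integral_mkcond.
have mO : measurable pO by exact: measurable_preimage.
have mOB := measurableI _ _ mO mB.
have m1 := measurable_normc_f.
have m2 : measurable_fun pO (fun p => (normc (f (of_pair p)) ^+ 2)%:E).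
  by apply/measurable_EFinP; exact: measurable_funX.
have m2' : measurable_fun (pO `&` B) (fun p => (normc (f (of_pair p)) ^+ 2)%:E).
  by apply: measurable_funS m2.
apply: (@le_trans _ _ (\int[area]_(p in pO `&` B)
   (s%:E * (normc (f (of_pair p)) ^+ 2)%:E + cst (4 * s)^-1%:E p))%E).
  apply: ge0_le_integral => //.
  - by move=> p _; rewrite lee_fin normc_ge0.
  - by apply/measurable_EFinP; apply: measurable_funS m1.
  - apply: emeasurable_funD => //.
    by apply: measurable_funeM.
  - move=> p _ /=; rewrite -EFinM -EFinD lee_fin; set t := normc _.
    have -> : s * t ^+ 2 + (4 * s)^-1 = t + (2 * s * t - 1) ^+ 2 / (4 * s).
      by field; rewrite gt_eqF.
    by rewrite lerDl divr_ge0 ?sqr_ge0 ?mulr_ge0 ?ltW.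
rewrite ge0_integralD//; last 3 first.
- by move=> p _; rewrite -EFinM lee_fin mulr_ge0 ?sqr_ge0 ?ltW.
- exact: measurable_funeM.
- by move=> p _; rewrite lee_fin invr_ge0 mulr_ge0 ?ltW.
rewrite ge0_integralZl_EFin//; last 2 first.
- by move=> p _; rewrite lee_fin sqr_ge0.
- exact: ltW.
rewrite integral_cst//.
have -> : (2 * s)%:E = (s%:E * 1 + (4 * s)^-1%:E * (4 * s ^+ 2)%:E)%E.
  by rewrite mule1 -EFinM -EFinD; congr EFin; field; rewrite gt_eqF.
apply: leeD; apply: lee_wpmul2l; rewrite ?lee_fin ?invr_ge0 ?mulr_ge0 ?(ltW s0)//.
- apply: le_trans i1; apply: ge0_subset_integral => //.
  by move=> p _; rewrite lee_fin sqr_ge0.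
- apply: le_trans aB; apply: le_measure; rewrite ?inE//; exact: subIsetr.
Qed.

Lemma good_column B (M al be : R) : 0 < M -> al < be -> measurable B ->
  (\int[area]_p abs_box B p <= M%:E)%E ->
  exists2 x, al <= x <= be & (\int[mu]_y abs_box B (x, y) <= (2 * M / (be - al))%:E)%E.
Proof.
move=> M0 ab mB; rewrite fubini_tonelli1; [|exact: measurable_abs_box|exact: abs_box_ge0].
move=> h; have [||x xab hx] := small_value ab M0 _ _ h.
- by apply: measurable_fun_fubini_tonelli_F; [exact: measurable_abs_box|exact: abs_box_ge0].
- by move=> x; apply: integral_ge0 => *; exact: abs_box_ge0.
- by exists x.
Qed.

Lemma good_row B (M al be : R) : 0 < M -> al < be -> measurable B ->
  (\int[area]_p abs_box B p <= M%:E)%E ->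
  exists2 y, al <= y <= be & (\int[mu]_x abs_box B (x, y) <= (2 * M / (be - al))%:E)%E.
Proof.
move=> M0 ab mB; rewrite fubini_tonelli2; [|exact: measurable_abs_box|exact: abs_box_ge0].
move=> h; have [||x xab hx] := small_value ab M0 _ _ h.
- by apply: measurable_fun_fubini_tonelli_G; [exact: measurable_abs_box|exact: abs_box_ge0].
- by move=> x; apply: integral_ge0 => *; exact: abs_box_ge0.
- by exists x.
Qed.

Lemma line_integral_le (B : set (R * R)) (L : R -> R * R) (a b c : R) :
  lcont (fun t => f (of_pair (L t))) a b -> measurable_fun setT L -> measurable B ->
  (forall t, a <= t <= b -> O (of_pair (L t)) /\ B (L t)) ->
  (\int[mu]_t abs_box B (L t) <= c%:E)%E ->
  \int[mu]_(t in `[a, b]) normc (f (of_pair (L t))) <= c.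
Proof.
move=> cf mL mB LB ic; rewrite -lee_fin.
have ii := lcont_normc cf.
rewrite /Rintegral fineK; last exact: integrable_fin_num.
apply: le_trans ic; apply: (@le_trans _ _ (\int[mu]_(t in `[a, b]) abs_box B (L t))%E).
  rewrite le_eqVlt; apply/orP; left; apply/eqP; apply: eq_integral => t.
  rewrite inE /= in_itv /= => /LB [h1 h2].
  by rewrite /abs_box patchE mem_set.
apply: ge0_subset_integral => //.
  by apply: measurableT_comp => //; exact: measurable_abs_box.
by move=> t _; exact: abs_box_ge0.
Qed.

Lemma rint_le_mass q (x0 x1 y0 y1 K c : R) : 0 <= K -> x0 <= x1 -> y0 <= y1 ->
  econt q x0 x1 y0 y1 -> econt f x0 x1 y0 y1 ->
  edges (fun z => normc (q z) <= K * normc (f z)) x0 x1 y0 y1 ->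
  \int[mu]_(x in `[x0, x1]) normc (f (x +i* y0)) <= c ->
  \int[mu]_(x in `[x0, x1]) normc (f (x +i* y1)) <= c ->
  \int[mu]_(y in `[y0, y1]) normc (f (x0 +i* y)) <= c ->
  \int[mu]_(y in `[y0, y1]) normc (f (x1 +i* y)) <= c ->
  normc (rint q x0 x1 y0 y1) <= 8 * K * c.
Proof.
move=> K0 xx yy cq cf [qx qy] i1 i2 i3 i4.
have H (F G : R -> C) (a b : R) : lcont F a b -> lcont G a b ->
    (forall t, a <= t <= b -> normc (F t) <= K * normc (G t)) ->
    \int[mu]_(t in `[a, b]) normc (G t) <= c -> normc (cint F a b) <= 2 * K * c.
  move=> lF lG FG ic; rewrite (le_trans (normc_cint lF))// -mulrA ler_wpM2l//.
  apply: (@le_trans _ _ (K * \int[mu]_(t in `[a, b]) normc (G t))); last by rewrite ler_wpM2l.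
  rewrite -RintegralZl//; last exact: lcont_normc.
  apply: le_Rintegral => //.
  - exact: lcont_normc.
  - have -> : EFin \o (fun t => K * normc (G t)) = (fun t => K%:E * (EFin \o (fun t => normc (G
    t))) t)%E.
      by apply/funext => t /=; rewrite EFinM.
    by apply: integrableZl => //; exact: lcont_normc.
have := H _ _ _ _ (econt_bot cq) (econt_bot cf) (fun t tb => (qx t tb).1) i1.
have := H _ _ _ _ (econt_top cq) (econt_top cf) (fun t tb => (qx t tb).2) i2.
have := H _ _ _ _ (econt_left cq) (econt_left cf) (fun t tb => (qy t tb).1) i3.
have := H _ _ _ _ (econt_right cq) (econt_right cf) (fun t tb => (qy t tb).2) i4.
rewrite /rint; move: (cint _ _ _) (cint _ _ _) (cint _ _ _) (cint _ _ _) => a b d e.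
move=> H1 H2 H3 H4.
have h1 := le_normcD (a - b) ('i * (e - d)).
have h2 := le_normcD e (- d); have h3 := le_normcD a (- b).
rewrite normcM normc_i mul1r in h1; rewrite normcN in h2; rewrite normcN in h3.
have -> : 8 * K * c = 4 * (2 * K * c) by ring.
move: (2 * K * c) H1 H2 H3 H4 h1 h2 h3.
move: (normc a) (normc b) (normc d) (normc e) (normc (e - d)) (normc (a - b)).
move: (normc _) => n1 n2 n3 n4 n5 n6 n7 k; clear=> *. lra.
Qed.

End good_lines.

Section derivative_bound.
Variable R : realType.
Local Notation C := (R[i]^o).
Local Notation mu := (@lebesgue_measure R).
Local Notation area := (@lebesgue_measure R \x @lebesgue_measure R)%E.
Implicit Types (x y : R).

Definition in_frame (a1 a2 s S x y : R) :=
  [/\ `|x - a1| <= S, `|y - a2| <= S & ~~ ((`|x - a1| < s) && (`|y - a2| < s))].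

Lemma rectangle_edges (a1 a2 s S x0 x1 y0 y1 : R) (P : C -> Prop) : 0 < s ->
  a1 - S <= x0 <= a1 - s -> a1 + s <= x1 <= a1 + S ->
  a2 - S <= y0 <= a2 - s -> a2 + s <= y1 <= a2 + S ->
  (forall x y, in_frame a1 a2 s S x y -> P (x +i* y)) -> edges P x0 x1 y0 y1.
Proof.
move=> s0 /andP[h1 h2] /andP[h3 h4] /andP[h5 h6] /andP[h7 h8] HP.
have xS t : x0 <= t <= x1 -> `|t - a1| <= S.
  by move=> /andP[t1 t2]; rewrite ler_norml; apply/andP; split; lra.
have yS t : y0 <= t <= y1 -> `|t - a2| <= S.
  by move=> /andP[t1 t2]; rewrite ler_norml; apply/andP; split; lra.
have n0 (c t : R) : t <= c - s -> (`|t - c| < s) = false.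
  by move=> tc; rewrite ltNge; apply/negbF; rewrite ler_normr; apply/orP; right; lra.
have n1 (c t : R) : c + s <= t -> (`|t - c| < s) = false.
  by move=> tc; rewrite ltNge; apply/negbF; rewrite ler_normr; apply/orP; left; lra.
have xx : x0 <= x1 by lra.
have yy : y0 <= y1 by lra.
split=> t tb; split; apply: HP; split; rewrite ?xS ?yS ?lexx ?xx ?yy ?(n0 _ y0) ?(n1 _ y1) ?(n0 _
  x0) ?(n1 _ x1) ?andbF//.
Qed.

Section bound.
Variables (O : set C) (oO : open O) (f : C -> C) (hf : holomorphic_on O f).
Hypothesis f1 : (\int[area]_(p in @of_pair R @^-1` O) (normc (f (of_pair p)) ^+ 2)%:E <= 1)%E.

(** The integral of [|f|] over the box of half-side [2 * s] is at most [4 * s], and each side can be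
    moved over an interval of length [s]; some position has line integral at most
    [2 * (4 * s) / s = 8]. This does not depend on the scale. *)
Lemma good_rectangle (a1 a2 s : R) : 0 < s ->
  (forall x y, in_frame a1 a2 s (2 * s) x y -> O (x +i* y)) ->
  exists x0 x1 y0 y1, [/\ a1 - 2 * s <= x0 <= a1 - s, a1 + s <= x1 <= a1 + 2 * s,
    a2 - 2 * s <= y0 <= a2 - s, a2 + s <= y1 <= a2 + 2 * s &
   [/\ \int[mu]_(x in `[x0, x1]) normc (f (x +i* y0)) <= 8,
  \int[mu]_(x in `[x0, x1]) normc (f (x +i* y1)) <= 8,
  \int[mu]_(y in `[y0, y1]) normc (f (x0 +i* y)) <= 8 &
  \int[mu]_(y in `[y0, y1]) normc (f (x1 +i* y)) <= 8]].
Proof.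
move=> s0 fr.
pose B : set (R * R) := `[a1 - 2 * s, a1 + 2 * s] `*` `[a2 - 2 * s, a2 + 2 * s].
have mB : measurable B by apply: measurableX; exact: measurable_itv.
have lt4 c : c - 2 * s < c + 2 * s by lra.
have aB : (area B <= (4 * (2 * s) ^+ 2)%:E)%E.
  rewrite product_measure1E; [|exact: measurable_itv..].
  rewrite /= !lebesgue_measure_itv /= !lte_fin !lt4.
  by rewrite -!EFinD -EFinM lee_fin le_eqVlt; apply/orP; left; apply/eqP; ring.
have s20 : 0 < 2 * s by lra.
have mass := mass_box oO hf s20 mB aB f1.
have M0 : 0 < 2 * (2 * s) by lra.
have e8 : 2 * (2 * (2 * s)) / s = 8 by field; rewrite gt_eqF.
have l1 c : c - 2 * s < c - s by lra.
have l2 c : c + s < c + 2 * s by lra.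
have d1 c : c - s - (c - 2 * s) = s by ring.
have d2 c : c + 2 * s - (c + s) = s by ring.
have [x0 hx0 ix0] := good_column oO hf M0 (l1 a1) mB mass.
have [x1 hx1 ix1] := good_column oO hf M0 (l2 a1) mB mass.
have [y0 hy0 iy0] := good_row oO hf M0 (l1 a2) mB mass.
have [y1 hy1 iy1] := good_row oO hf M0 (l2 a2) mB mass.
rewrite d1 e8 in ix0; rewrite d1 e8 in iy0; rewrite d2 e8 in ix1; rewrite d2 e8 in iy1.
exists x0, x1, y0, y1; split=> //.
have [ct1 ct2] : econt f x0 x1 y0 y1.
  apply: (rectangle_edges s0 hx0 hx1 hy0 hy1) => x y /fr /hf; exact: derivable_ccont.
have [eO1 eO2] : edges (fun z => O z /\ B (complex.Re z, complex.Im z)) x0 x1 y0 y1.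
  apply: (rectangle_edges s0 hx0 hx1 hy0 hy1) => x y fxy; split; first exact: fr.
  by case: fxy => h1 h2 _; split; rewrite /= in_itv /= ler_dist_itv.
have mp1 (c : R) : measurable_fun setT (fun t : R => (t, c)).
  exact: measurable_pair2.
have mp2 (c : R) : measurable_fun setT (fun t : R => (c, t)).
  exact: measurable_pair1.
have ctt : econt f x0 x1 y0 y1 by split.
split.
- apply: (line_integral_le oO hf (L := pair^~ y0) (econt_bot ctt) (mp1 y0) mB _ iy0).
  by move=> t /eO1[].
- apply: (line_integral_le oO hf (L := pair^~ y1) (econt_top ctt) (mp1 y1) mB _ iy1).
  by move=> t /eO1[].
- apply: (line_integral_le oO hf (L := pair x0) (econt_left ctt) (mp2 x0) mB _ ix0).
  by move=> t /eO2[].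
- apply: (line_integral_le oO hf (L := pair x1) (econt_right ctt) (mp2 x1) mB _ ix1).
  by move=> t /eO2[].
Qed.

Lemma pole_quotient_le (a w z : C) (A m : R) : normc (z - a) <= A -> 0 < m ->
  m <= normc (z - w) -> normc (pole_quotient f a w z) <= A / m ^+ 2 * normc (f z).
Proof.
move=> zA m0 mz; rewrite /pole_quotient !normcM normcV expr2 normcM mulrAC.
rewrite ler_wpM2r ?normc_ge0// ler_pM ?normc_ge0 ?invr_ge0 ?mulr_ge0 ?normc_ge0//.
have z0 : 0 < normc (z - w) by exact: lt_le_trans mz.
by rewrite expr2 lef_pV2 ?posrE ?mulr_gt0// ler_pM// ltW.
Qed.

(** On the inner frame [|z - a| <= 4 h] and [|z - w| >= 3/4 rho]; on the outer one [|z - a| <= r]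
    and [|z - w| >= r / 8]. So the quotient is at most [8 h / rho ^ 2], respectively [64 / r], times
    [|f|]. The factor [8 * 8] of [rint_le_mass] and the division by [4 * rho] in [pole_estimate]
    give the constants. *)
Lemma deriv_bound (a1 a2 h r rho : R) : 0 < h -> 8 * h <= rho -> 8 * rho <= r ->
  (forall x y, in_frame a1 a2 h (r / 2) x y -> O (x +i* y)) ->
  f ((a1 + rho) +i* a2) = 0 ->
  normc ('D_1 f ((a1 + rho) +i* a2)) <= 128 * h / rho ^+ 3 + 1024 / (r * rho).
Proof.
move=> h0 hrho rhor fr fw.
set w : C := (a1 + rho) +i* a2 in fw *; pose a : C := a1 +i* a2.
have rho0 : 0 < rho by lra.
have r0 : 0 < r by lra.
have frO s S x y : h <= s -> S <= r / 2 -> in_frame a1 a2 s S x y -> O (x +i* y).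
  move=> hs Sr [h1 h2 h3]; apply: fr; split; [exact: le_trans Sr|exact: le_trans Sr|].
  by apply: contra h3 => /andP[h4 h5]; rewrite (lt_le_trans h4)// (lt_le_trans h5).
pose q := pole_quotient f a w.
have qd s S x y : h <= s -> S <= r / 2 -> (S < rho) || (rho < s) -> in_frame a1 a2 s S x y ->
    derivable q (x +i* y) 1 /\ derivable f (x +i* y) 1.
  move=> hs Sr sS fxy; have Oxy := frO _ _ _ _ hs Sr fxy; split; last exact: hf.
  apply: derivable_frac; last exact: hf.
  apply/eqP => -[xE yE]; case: fxy; rewrite xE yE subrr normr0 addrAC subrr add0r ger0_norm ?(ltW
    rho0)//.
  case/orP: sS => [h1 h2 _ _|]; first by have := lt_le_trans h1 h2; rewrite ltxx.
  by move=> -> _ _; rewrite (lt_le_trans h0 hs).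
have inner : normc (square q a1 a2 (2 * h)) <= 512 * h / rho ^+ 2.
  have fri x y : in_frame a1 a2 h (2 * h) x y -> O (x +i* y) by apply: (frO h (2 * h)) => //; lra.
  have [x0 [x1 [y0 [y1 [hx0 hx1 hy0 hy1 [i1 i2 i3 i4]]]]]] := good_rectangle h0 fri.
  have qdi x y : in_frame a1 a2 h (2 * h) x y -> derivable q (x +i* y) 1 /\ derivable f (x +i* y)
    1.
    by apply: qd; [|lra|apply/orP; left; lra].
  have E : square q a1 a2 (2 * h) = rint q x0 x1 y0 y1.
    apply: rint_hollow; [clear -hx0 hx1 hy0 hy1 h0; lra..|].
    move=> x y; rewrite !ler_dist_itv => xb yb nxy; apply: (qdi _ _ _).1; split=> //.
    apply: contra nxy; rewrite -!ltr_dist_itv => /andP[/andP[k1 k2] /andP[k3 k4]].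
    by clear -hx0 hx1 hy0 hy1 h0 k1 k2 k3 k4; apply/andP; split; apply/andP; split; lra.
  rewrite E; apply: (le_trans (rint_le_mass (K := 8 * h / rho ^+ 2) (c := 8) _ _ _ _ _ _ i1 i2 i3
    i4)).
  - by rewrite divr_ge0 ?sqr_ge0; lra.
  - clear -hx0 hx1 hy0 hy1 h0; lra.
  - clear -hx0 hx1 hy0 hy1 h0; lra.
  - by apply: (rectangle_edges h0 hx0 hx1 hy0 hy1) => x y /qdi[/derivable_ccont].
  - by apply: (rectangle_edges h0 hx0 hx1 hy0 hy1) => x y /qdi[_ /derivable_ccont].
  - apply: (rectangle_edges h0 hx0 hx1 hy0 hy1) => x y [h1 h2 _].
    have na : normc ((x +i* y : C) - a) <= 4 * h.
      by rewrite (le_trans (normc_le_ReIm _))//=; lra.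
    have nw : 3 / 4 * rho <= normc ((x +i* y : C) - w).
      apply: le_trans (norm_Re_le _); rewrite /=.
      move: h1; rewrite ler_norml => /andP[h3 h4].
      rewrite ler_normr; apply/orP; right; lra.
    rewrite (le_trans (pole_quotient_le na _ nw)) ?mulr_gt0//.
    rewrite ler_wpM2r ?normc_ge0//.
    have -> : 4 * h / (3 / 4 * rho) ^+ 2 = 64 / 9 * (h / rho ^+ 2) by field; rewrite gt_eqF.
    have -> : 8 * h / rho ^+ 2 = 8 * (h / rho ^+ 2) by rewrite mulrA.
    rewrite ler_wpM2r ?divr_ge0 ?sqr_ge0 ?(ltW h0)//.
    lra.
  - rewrite le_eqVlt; apply/orP; left; apply/eqP; ring.
have outer : normc (square q a1 a2 (r / 4)) <= 4096 / r.
  have r4 : 0 < r / 4 by rewrite divr_gt0.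
  have r42 : 2 * (r / 4) = r / 2 by field.
  have fri x y : in_frame a1 a2 (r / 4) (2 * (r / 4)) x y -> O (x +i* y) by apply: (frO (r / 4)
    (2 * (r / 4))) => //; lra.
  have [x0 [x1 [y0 [y1 [hx0 hx1 hy0 hy1 [i1 i2 i3 i4]]]]]] := good_rectangle r4 fri.
  have qdi x y : in_frame a1 a2 (r / 4) (2 * (r / 4)) x y -> derivable q (x +i* y) 1 /\ derivable
    f (x +i* y) 1.
    by apply: qd; [lra|lra|apply/orP; right; lra].
  have E : square q a1 a2 (r / 4) = rint q x0 x1 y0 y1.
    apply/esym; apply: rint_hollow; [clear -hx0 hx1 hy0 hy1 r4; lra..|].
    move=> x y xb yb; rewrite !ltr_dist_itv => nxy; apply: (qdi _ _ _).1; split=> //.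
      rewrite -ler_dist_itv; case/andP: xb => k1 k2; clear -hx0 hx1 hy0 hy1 r4 k1 k2; apply/andP;
        split; lra.
    rewrite -ler_dist_itv; case/andP: yb => k1 k2; clear -hx0 hx1 hy0 hy1 r4 k1 k2; apply/andP;
      split; lra.
  rewrite E; apply: (le_trans (rint_le_mass (K := 64 / r) (c := 8) _ _ _ _ _ _ i1 i2 i3 i4)).
  - by rewrite divr_ge0// ltW.
  - clear -hx0 hx1 hy0 hy1 r4; lra.
  - clear -hx0 hx1 hy0 hy1 r4; lra.
  - by apply: (rectangle_edges r4 hx0 hx1 hy0 hy1) => x y /qdi[/derivable_ccont].
  - by apply: (rectangle_edges r4 hx0 hx1 hy0 hy1) => x y /qdi[_ /derivable_ccont].
  - apply: (rectangle_edges r4 hx0 hx1 hy0 hy1) => x y [h1 h2 h3].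
    have na : normc ((x +i* y : C) - a) <= r.
      by rewrite (le_trans (normc_le_ReIm _))//=; lra.
    have nw : r / 8 <= normc ((x +i* y : C) - w).
      move: h3; rewrite negb_and -!leNgt => /orP[h3|h3].
        apply: le_trans (norm_Re_le _); rewrite /=.
        have := lerB_dist (x - a1) rho; rewrite opprD addrA (ger0_norm (ltW rho0)).
        by apply: le_trans; lra.
      apply: le_trans (norm_Im_le _); rewrite /=; lra.
    rewrite (le_trans (pole_quotient_le na _ nw)) ?divr_gt0//.
    rewrite ler_wpM2r ?normc_ge0//.
    have -> : r / (r / 8) ^+ 2 = 64 / r by field; rewrite gt_eqF.
    by [].
  - rewrite le_eqVlt; apply/orP; left; apply/eqP; field; rewrite gt_eqF//.
have h2 : 0 < 2 * h by rewrite mulr_gt0.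
have hr2 : 2 * h < rho by clear -h0 hrho; lra.
have rr4 : rho < r / 4 by clear -rho0 rhor; lra.
have pe : 4 * rho * normc ('D_1 f w) <= 4096 / r + 512 * h / rho ^+ 2.
  apply: le_trans (lerD outer inner); apply: (pole_estimate h2 hr2 rr4 _ fw) => x y k1 k2 k3.
  apply: hf; apply: (frO (2 * h) (r / 4)); [by rewrite mulr2n mulrDl mul1r lerDl ltW| |by split].
  by rewrite ler_pM2l// lef_pV2 ?posrE// ler_nat.
have r4 : 0 < 4 * rho by rewrite mulr_gt0.
rewrite -(ler_pM2l r4) (le_trans pe)// le_eqVlt; apply/orP; left; apply/eqP; field.
by rewrite !gt_eqF.
Qed.

End bound.

End derivative_bound.

(** * Energies of dyadic potentials *)

Section area_integral.
Variable R : realType.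
Local Notation C := (R[i]^o).
Local Notation mu := (@lebesgue_measure R).
Local Notation area := (@lebesgue_measure R \x @lebesgue_measure R)%E.
Implicit Types (g : R * R -> R) (p q : C) (z : R * R).

Definition nnm g := measurable_fun setT g /\ forall z, 0 <= g z.

Definition aint g : \bar R := (\int[area]_z (g z)%:E)%E.

Lemma nnmD g g' : nnm g -> nnm g' -> nnm (fun z => g z + g' z).
Proof. by move=> [m1 h1] [m2 h2]; split=> [|z]; [exact: measurable_funD|exact: addr_ge0]. Qed.

Lemma nnmM g g' : nnm g -> nnm g' -> nnm (fun z => g z * g' z).
Proof. by move=> [m1 h1] [m2 h2]; split=> [|z]; [exact: measurable_funM|exact: mulr_ge0]. Qed.

Lemma nnm_cst (c : R) : 0 <= c -> nnm (fun=> c).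
Proof. by move=> c0; split. Qed.

Lemma nnmZ c g : 0 <= c -> nnm g -> nnm (fun z => c * g z).
Proof. by move=> /nnm_cst; exact: nnmM. Qed.

Lemma nnm_sum (N : nat) (g : nat -> R * R -> R) : (forall k, nnm (g k)) ->
  nnm (fun z => \sum_(k < N) g k z).
Proof.
move=> mg; elim: N => [|N IH].
  by under eq_fun do rewrite big_ord0; exact: nnm_cst.
by under eq_fun do rewrite big_ord_recr /=; exact: nnmD.
Qed.

Lemma aintD g g' : nnm g -> nnm g' -> aint (fun z => g z + g' z) = (aint g + aint g')%E.
Proof.
move=> [m1 h1] [m2 h2]; rewrite /aint; under eq_integral do rewrite EFinD.
by apply: ge0_integralD => //; try (by move=> z _; rewrite lee_fin); exact/measurable_EFinP.
Qed.

Lemma aintZ c g : 0 <= c -> nnm g -> aint (fun z => c * g z) = (c%:E * aint g)%E.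
Proof.
move=> c0 [m1 h1]; rewrite /aint; under eq_integral do rewrite EFinM.
by apply: ge0_integralZl_EFin => //; try (by move=> z _; rewrite lee_fin); exact/measurable_EFinP.
Qed.

Lemma aint_le g g' : nnm g -> nnm g' -> (forall z, g z <= g' z) -> (aint g <= aint g')%E.
Proof.
move=> [m1 h1] [m2 h2] gg; apply: ge0_le_integral => //.
- by move=> z _; rewrite lee_fin.
- exact/measurable_EFinP.
- exact/measurable_EFinP.
- by move=> z _; rewrite lee_fin.
Qed.

Lemma aint0 : aint (fun=> 0) = 0%E.
Proof. by rewrite /aint integral0. Qed.

Lemma aint_sum_le (N : nat) (g : nat -> R * R -> R) (c : nat -> R) :
  (forall k, nnm (g k)) -> (forall k, (k < N)%N -> (aint (g k) <= (c k)%:E)%E) ->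
  (aint (fun z => \sum_(k < N) g k z)%R <= (\sum_(k < N) c k)%:E)%E.
Proof.
move=> mg; elim: N => [|N IH] gc.
  by under eq_fun do rewrite big_ord0; rewrite aint0 big_ord0.
under eq_fun do rewrite big_ord_recr /=.
rewrite aintD//; last exact: nnm_sum.
by rewrite big_ord_recr /= EFinD leeD ?gc ?IH// => k kN; rewrite gc// ltnW.
Qed.

Definition box (s : R) p : set (R * R) :=
  `[complex.Re p - s, complex.Re p + s] `*` `[complex.Im p - s, complex.Im p + s].

Lemma boxE s p z : box s p z = (`|z.1 - complex.Re p| <= s /\ `|z.2 - complex.Im p| <= s).
Proof. by rewrite /box /= !in_itv /= !ler_dist_itv. Qed.

Definition box_weight (c s : R) p z : R := c * \1_(box s p) z.

Lemma nnm_box_weight c s p : 0 <= c -> nnm (box_weight c s p).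
Proof.
move=> c0; split=> [|z]; last by rewrite mulr_ge0.
apply: measurable_funM => //; apply: measurable_indic.
by apply: measurableX; exact: measurable_itv.
Qed.

Lemma aint_box_weight c s p : 0 <= c -> 0 < s ->
  aint (box_weight c s p) = (c * (4 * s ^+ 2))%:E.
Proof.
move=> c0 s0.
have mB : measurable (box s p) by apply: measurableX; exact: measurable_itv.
rewrite aintZ//.
rewrite /aint integral_indic// setIT EFinM; congr (_ * _)%E.
transitivity ((@lebesgue_measure R \x @lebesgue_measure R)%E (`[complex.Re p - s, complex.Re p +
  s]%classic `*` `[complex.Im p - s, complex.Im p + s]%classic)); first by [].
rewrite product_measure1E; [|exact: measurable_itv..].
have lt4 t : t - s < t + s by lra.
rewrite /= !lebesgue_measure_itv /= !lte_fin !lt4.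
by rewrite -!EFinD -EFinM; congr EFin; ring.
Qed.

End area_integral.

Section kernel.
Variable R : realType.
Local Notation C := (R[i]^o).
Variable Rd : R.
Hypothesis Rd0 : 0 < Rd.
Implicit Types (g : R * R -> R) (p q : C) (z : R * R) (k l N K : nat).

Definition shell k p z : R := box_weight (2 ^+ k.+1 / Rd) (Rd / 2 ^+ k) p z.

(** A step-function majorant of [1 / |z - p|] between the scales [Rd / 2 ^ N] and [Rd]. The shells
    are full boxes rather than annuli, which costs only a constant since their weights grow
    geometrically. *)
Definition ker N p z : R := \sum_(k < N) shell k p z.

Let w0 k : 0 <= 2 ^+ k.+1 / Rd.
Proof. by rewrite divr_ge0// ltW. Qed.

Lemma nnm_shell k p : nnm (shell k p).
Proof. exact: nnm_box_weight. Qed.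

Lemma nnm_ker N p : nnm (ker N p).
Proof. exact: (@nnm_sum R N (fun k => shell k p) (fun k => nnm_shell k p)). Qed.

(** This is 2 to the power [- |k - l|]. *)
Definition dyadic_ratio k l : R := if (l <= k)%N then 2 ^+ l / 2 ^+ k else 2 ^+ k / 2 ^+ l.

Lemma dyadic_ratioC k l : dyadic_ratio k l = dyadic_ratio l k.
Proof. by rewrite /dyadic_ratio; case: ltngtP => // ->. Qed.

Lemma dyadic_ratio_ge0 k l : 0 <= dyadic_ratio k l.
Proof. by rewrite /dyadic_ratio; case: ifP => _; rewrite divr_ge0. Qed.

Lemma shell_le k p z : shell k p z <= 2 ^+ k.+1 / Rd.
Proof. by rewrite ler_piMr// indicE; case: (_ \in _). Qed.

(** The wider shell is bounded by its weight and the narrower one is integrated. The result depends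
    on [|k - l|] only, not on the scale: this is why energies grow like the number of shells. *)
Lemma aint_shell2 k l p q :
  (aint (fun z => shell k p z * shell l q z)%R <= (16 * dyadic_ratio k l)%:E)%E.
Proof.
wlog lk : k l p q / (l <= k)%N.
  move=> H; have [lk|/ltnW kl] := leqP l k; first exact: H.
  rewrite dyadic_ratioC; under eq_fun do rewrite mulrC; exact: H.
apply: (@le_trans _ _ (aint (fun z => 2 ^+ l.+1 / Rd * shell k p z))).
  apply: aint_le => [||z].
  - by apply: nnmM; exact: nnm_shell.
  - by apply: nnmZ => //; exact: nnm_shell.
  - by rewrite mulrC ler_wpM2r ?shell_le//; case: (nnm_shell k p).
rewrite aintZ//; last exact: nnm_shell.
rewrite aint_box_weight ?divr_gt0 ?exprn_gt0// -EFinM lee_fin le_eqVlt; apply/orP; left;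
  apply/eqP.
rewrite /dyadic_ratio lk !exprS.
have p2 n : (2 ^+ n : R) != 0 by rewrite expf_neq0// pnatr_eq0.
move: (2 ^+ k) (2 ^+ l) (p2 k) (p2 l) => a b a0 b0; field.
by rewrite ?b0 ?a0 gt_eqF.
Qed.

Lemma sum_dyadic_ratio k N : \sum_(l < N) dyadic_ratio k l <= 3.
Proof.
have p2 n : 0 < 2 ^+ n :> R by rewrite exprn_gt0.
have H1 n : (n <= k.+1)%N -> \sum_(l < n) dyadic_ratio k l <= 2 ^+ n / 2 ^+ k.
  elim: n => [|n IH] nk; first by rewrite big_ord0 divr_ge0.
  rewrite big_ord_recr /= /dyadic_ratio (_ : (n <= k)%N)// exprS.
  have := IH (ltnW nk); rewrite /dyadic_ratio mulrAC; lra.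
have H2 n : (k < n)%N -> \sum_(l < n) dyadic_ratio k l <= 3 - 2 ^+ k.+1 / 2 ^+ n.
  elim: n => // n IH; rewrite ltnS leq_eqVlt => /orP[/eqP <-|kn].
    rewrite (le_trans (H1 _ _))// exprS mulfK ?gt_eqF// divff ?gt_eqF// ?mulr_gt0//; lra.
  rewrite big_ord_recr /= {2}/dyadic_ratio leqNgt kn /=.
  rewrite (le_trans (lerD (IH kn) (lexx _)))// !exprS.
  by rewrite le_eqVlt; apply/orP; left; apply/eqP; field; rewrite gt_eqF.
have [Nk|kN] := leqP N k.+1.
  rewrite (le_trans (H1 _ Nk))// ler_pdivrMr// (@le_trans _ _ (2 ^+ k.+1))//.
    by rewrite ler_weXn2l// ler1n.
  by rewrite exprS ler_wpM2r ?(ltW (p2 k))//; lra.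
rewrite (le_trans (H2 _ (ltnW kN)))// gerBl divr_ge0//.
Qed.

(* Only pairs of shells in which one index is below [K] contribute. *)
Lemma ker_pair N K p q :
  (forall k l z, (K <= k < N)%N -> (K <= l < N)%N -> shell k p z * shell l q z = 0) ->
  (aint (fun z => ker N p z * ker N q z)%R <= (96 * K%:R)%:E)%E.
Proof.
move=> far.
(* The first factor counts how many of the two indices are below [K]. Split into its two summands,
   it gives two sums that agree by symmetry, each at most [K * (16 * 3)]. *)
pose t k l : R := ((k < K)%N + (l < K)%N)%:R * (16 * dyadic_ratio k l).
have tt k l : (k < N)%N -> (l < N)%N -> (aint (fun z => shell k p z * shell l q z)%R <= (t k
  l)%:E)%E.
  move=> kN lN; have [kK|kK] := ltnP k K; last have [lK|lK] := ltnP l K.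
  - rewrite (le_trans (aint_shell2 _ _ _ _))// lee_fin /t kK.
    by rewrite ler_peMl ?mulr_ge0 ?dyadic_ratio_ge0// ler1n.
  - rewrite (le_trans (aint_shell2 _ _ _ _))// lee_fin /t lK addn1.
    by rewrite ler_peMl ?mulr_ge0 ?dyadic_ratio_ge0// ler1n.
  - under eq_fun do rewrite far ?kK ?lK//.
    by rewrite aint0 /t !ltnNge kK lK /= mul0r.
have -> : (fun z => ker N p z * ker N q z) =
  fun z => \sum_(k < N) (fun k z => \sum_(l < N) (fun l z => shell k p z * shell l q z) l z) k z.
  apply/funext => z; rewrite /ker mulr_suml; apply: eq_bigr => k _.
  by rewrite mulr_sumr.
have m2 k l : nnm (fun z => shell k p z * shell l q z) by apply: nnmM; exact: nnm_shell.
apply: (@le_trans _ _ (\sum_(k < N) \sum_(l < N) t k l)%:E).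
  apply: (@aint_sum_le R N (fun k z => \sum_(l < N) shell k p z * shell l q z)
    (fun k => \sum_(l < N) t k l)) => [k|k kN].
    exact: (@nnm_sum R N (fun l z => shell k p z * shell l q z) (m2 k)).
  by apply: (@aint_sum_le R N (fun l z => shell k p z * shell l q z) (t k)) => [l|l lN];
    [exact: m2|exact: tt].
rewrite lee_fin.
have S k : \sum_(l < N) 16 * dyadic_ratio k l <= 48.
  by rewrite -mulr_sumr; have := sum_dyadic_ratio k N; lra.
have cK : \sum_(k < N) ((k < K)%N : nat)%:R <= K%:R :> R.
  rewrite -natr_sum ler_nat; set S1 := (\sum_(k < N) _)%N.
  suff -> : S1 = minn N K by rewrite geq_minr.
  rewrite /S1 {far tt m2 S S1}; elim: N => [|n IH]; first by rewrite big_ord0 min0n.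
  rewrite big_ord_recr /= IH; case: (ltnP n K) => nK.
    by rewrite (minn_idPl nK) addn1.
  by rewrite (minn_idPr (leqW nK)) addn0.
have SS : \sum_(k < N) \sum_(l < N) ((k < K)%N : nat)%:R * (16 * dyadic_ratio k l) <= 48 * K%:R.
  under eq_bigr do rewrite -mulr_sumr.
  rewrite mulrC (le_trans _ (ler_wpM2r _ cK))// mulr_suml; apply: ler_sum => k _.
  by rewrite ler_wpM2l.
have -> : \sum_(k < N) \sum_(l < N) t k l =
  \sum_(k < N) \sum_(l < N) ((k < K)%N : nat)%:R * (16 * dyadic_ratio k l) +
  \sum_(k < N) \sum_(l < N) ((k < K)%N : nat)%:R * (16 * dyadic_ratio k l).
  rewrite [X in _ = _ + X]exchange_big /= -big_split /=; apply: eq_bigr => k _.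
  rewrite -big_split /=; apply: eq_bigr => l _.
  by rewrite /t natrD mulrDl (dyadic_ratioC l).
lra.
Qed.

(** If both boxes contained [z], each coordinate of [p - q] would be at most twice the half-side
    [Rd / 2 ^ K]; adding the coordinates gives the 4. *)
Lemma shell_far K k l p q z : 4 * Rd / 2 ^+ K < normc (p - q) ->
  (K <= k)%N -> (K <= l)%N -> shell k p z * shell l q z = 0.
Proof.
move=> far Kk Kl; rewrite /shell /box_weight !indicE.
have dec n : (K <= n)%N -> Rd / 2 ^+ n <= Rd / 2 ^+ K.
  by move=> Kn; rewrite ler_pM2l// lef_pV2 ?posrE ?exprn_gt0// ler_weXn2l// ler1n.
have [pz|] := boolP (z \in _); last by rewrite mulr0 mul0r.
have [qz|] := boolP (z \in _); last by rewrite !mulr0.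
move: pz qz; rewrite !inE !boxE => -[p1 p2] [q1 q2].
have := lt_le_trans far (normc_le_ReIm _).
have := dec _ Kk; have := dec _ Kl; rewrite -mulrA.
move: (Rd / 2 ^+ K) (Rd / 2 ^+ k) (Rd / 2 ^+ l) p1 p2 q1 q2 => a b c.
case: p q {far} => [x y] [x' y'] /=; rewrite !ler_norml.
move=> /andP[? ?] /andP[? ?] /andP[? ?] /andP[? ?] ? ?.
have [h1|h1] := lerP 0 (x - x'); have [h2|h2] := lerP 0 (y - y').
- by rewrite (ger0_norm h1) (ger0_norm h2); lra.
- by rewrite (ger0_norm h1) (ltr0_norm h2); lra.
- by rewrite (ltr0_norm h1) (ger0_norm h2); lra.
- by rewrite (ltr0_norm h1) (ltr0_norm h2); lra.
Qed.

(** Let [m] be the distance in the maximum norm. The last shell containing [z] has index [k] with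
    [Rd / 2 ^ k.+1 < m], hence weight at least [1 / m]. The 2 in the last hypothesis pays for
    [normc <= 2 * m]. *)
Lemma ker_ge N p z : `|z.1 - complex.Re p| <= Rd -> `|z.2 - complex.Im p| <= Rd ->
  2 * Rd / 2 ^+ N < normc (of_pair z - p) -> (normc (of_pair z - p))^-1 <= ker N p z.
Proof.
move=> h1 h2 h3.
have p2 n : 0 < 2 ^+ n :> R by rewrite exprn_gt0.
pose m := Num.max `|z.1 - complex.Re p| `|z.2 - complex.Im p|.
have m0 : 0 <= m by rewrite le_max normr_ge0.
have mn : m <= normc (of_pair z - p).
  have := norm_Re_le (of_pair z - p); have := norm_Im_le (of_pair z - p).
  by case: p h1 h2 h3 @m m0 => x y /= *; rewrite ge_max; apply/andP.
have nm : normc (of_pair z - p) <= 2 * m.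
  rewrite (le_trans (normc_le_ReIm _))// mulr2n mulrDl mul1r.
  by case: p h1 h2 h3 @m m0 mn => x y /= *; rewrite lerD// le_max lexx ?orbT.
have mR : m <= Rd by rewrite ge_max h1.
have mN : Rd / 2 ^+ N < m by move: h3 nm; rewrite -mulrA; lra.
have m00 : 0 < m by rewrite (lt_trans _ mN)// divr_gt0.
apply: (@le_trans _ _ m^-1); first by rewrite lef_pV2// posrE (lt_le_trans m00 mn).
elim: N mN {h3} => [|N IH] mN; first by move: mN; rewrite expr0 divr1 ltNge mR.
rewrite /ker big_ord_recr /= -/(ker N p z).
have [mN'|mN'] := ltP (Rd / 2 ^+ N) m.
  by rewrite (le_trans (IH mN'))// lerDl; case: (nnm_shell N p).
apply: ler_wpDl; first by case: (nnm_ker N p).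
rewrite /shell /box_weight indicE mem_set ?mulr1.
  by rewrite -[leRHS]invrK lef_pV2 ?posrE ?invr_gt0 ?divr_gt0 ?exprn_gt0// invf_div ltW.
by rewrite boxE; split; rewrite (le_trans _ mN')// le_max lexx ?orbT.
Qed.

End kernel.

(** * Binary trees in a closed set and the energy of their leaves *)

Section tree.
Variable R : realType.
Local Notation C := (R[i]^o).
Variable b : nat -> C -> C.
Implicit Types (n i N : nat) (a p q : C).

(* Mean over the [2 ^ n] leaves of the binary tree in which a node [a] of level [i]
   has the children [a] and [b i a]. *)
Fixpoint tavg (F : fieldType) n i a (g : C -> F) : F :=
  if n is m.+1 then (tavg m i.+1 a g + tavg m i.+1 (b i a) g) / 2 else g a.

Fixpoint leafs n i a (P : C -> Prop) : Prop :=
  if n is m.+1 then leafs m i.+1 a P /\ leafs m i.+1 (b i a) P else P a.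

Lemma leafs_imp n i a (P Q : C -> Prop) : (forall p, P p -> Q p) ->
  leafs n i a P -> leafs n i a Q.
Proof.
by move=> PQ; elim: n i a => [|n IH] i a /=; [exact: PQ|move=> [/IH ? /IH ?]].
Qed.

Lemma tavgD (F : fieldType) n i a (g g' : C -> F) :
  tavg n i a (fun p => g p + g' p) = tavg n i a g + tavg n i a g'.
Proof.
elim: n i a => [|n IH] i a //=.
by rewrite !IH -mulrDl; congr (_ / _); rewrite addrACA.
Qed.

Lemma tavgZ (F : fieldType) n i a (c : F) (g : C -> F) :
  tavg n i a (fun p => c * g p) = c * tavg n i a g.
Proof. by elim: n i a => [|n IH] i a //=; rewrite !IH -mulrDr mulrA. Qed.

Lemma tavg_le n i a (g g' : C -> R) : leafs n i a (fun p => g p <= g' p) ->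
  tavg n i a g <= tavg n i a g'.
Proof.
elim: n i a => [|n IH] i a //= [/IH h1 /IH h2].
by rewrite ler_wpM2r ?invr_ge0// lerD.
Qed.

Lemma tavg_cst n i a (c : R) : tavg n i a (fun=> c) = c.
Proof. by elim: n i a => [|n IH] i a //=; rewrite !IH; field. Qed.

Lemma normc_half : normc ((2 : C)^-1) = 2^-1.
Proof.
have -> : (2 : C) = (2 : R)%:C by rewrite rmorph_nat.
by rewrite normcV normc_real ger0_norm.
Qed.

Lemma normc_tavg n i a (g : C -> C) : normc (tavg n i a g) <= tavg n i a (fun p => normc (g p)).
Proof.
elim: n i a => [|n IH] i a //=; rewrite normcM normc_half ler_wpM2r ?invr_ge0//.
by rewrite (le_trans (le_normcD _ _))// lerD.
Qed.

Lemma Re_tavg n i a (g : C -> C) :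
  complex.Re (tavg n i a g) = tavg n i a (fun p => complex.Re (g p)).
Proof.
elim: n i a => [|n IH] i a //=; rewrite -!IH.
have -> : (2 : C)^-1 = (2^-1)%:C by rewrite fmorphV rmorph_nat.
move: (tavg _ _ _ _) (tavg _ _ _ _) => [x y] [x' y'] /=; ring.
Qed.

Lemma nnm_tavg n i a (phi : C -> R * R -> R) : (forall p, nnm (phi p)) ->
  nnm (fun z => tavg n i a (phi^~ z)).
Proof.
move=> mphi; elim: n i a => [|n IH] i a /=; first exact: mphi.
under eq_fun do rewrite mulrC.
by apply: nnmZ; rewrite ?invr_ge0//; apply: nnmD.
Qed.

Lemma aint_tavg_le n i a (phi : C -> R * R -> R) (v : R * R -> R) (M : R) :
  (forall p, nnm (phi p)) -> nnm v ->
  leafs n i a (fun p => (aint (fun z => phi p z * v z)%R <= M%:E)%E) ->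
  (aint (fun z => tavg n i a (phi^~ z) * v z)%R <= M%:E)%E.
Proof.
move=> mphi mv; elim: n i a => [|n IH] i a //= [/IH h1 /IH h2].
have -> : (fun z => (tavg n i.+1 a (phi^~ z) + tavg n i.+1 (b i a) (phi^~ z)) / 2 * v z) =
  (fun z => 2^-1 * (tavg n i.+1 a (phi^~ z) * v z + tavg n i.+1 (b i a) (phi^~ z) * v z)).
  by apply/funext => z; ring.
have m1 c : nnm (fun z => tavg n i.+1 c (phi^~ z) * v z).
  by apply: nnmM => //; exact: nnm_tavg.
rewrite aintZ ?invr_ge0//; last exact: nnmD.
rewrite aintD//.
have -> : M%:E = (2^-1%:E * (M%:E + M%:E))%E.
  by rewrite -EFinD -EFinM; congr EFin; field.
by rewrite lee_wpmul2l ?lee_fin ?invr_ge0// leeD.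
Qed.

Variables (E : set C) (t : nat -> R).
Hypothesis t0 : forall i, 0 < t i.
Hypothesis t5 : forall i, 5 * t i.+1 <= t i.
Hypothesis bP : forall i a, E a -> E (b i a) /\ 5 * t i.+1 <= normc (b i a - a) <= t i.

(** The steps down the tree are at most [t i], [t i / 5], and so on; [5 / 4] is the sum of the
    geometric series. *)
Lemma leafs_near n i a : E a -> leafs n i a (fun p => E p /\ normc (p - a) <= 5 / 4 * t i).
Proof.
elim: n i a => [|n IH] i a Ea /=.
  by rewrite subrr normc0 mulr_ge0// ltW.
have [Eb /andP[_ bt]] := bP i Ea; have ti := t5 i; have ti0 := t0 i.
split; [apply: leafs_imp (IH i.+1 a Ea)|apply: leafs_imp (IH i.+1 _ Eb)] => p [Ep pa]; split=> //.
  have := t0 i.+1; move: (t i) (t i.+1) (normc _) ti ti0 pa => x y u *; lra.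
have := normc_le_tri p a (b i a).
move: (t i) (t i.+1) (normc _) (normc _) (normc _) ti ti0 pa bt => x y u v w *; lra.
Qed.

(** The two roots are at least [5 * t i.+1] apart and each subtree has radius at most
    [5/4 * t i.+1], which leaves [5 - 5/2]. The factor 1/5 in the scale function of the theorem
    provides this room. *)
Lemma leafs_separated n i a : E a ->
  leafs n i.+1 a (fun p => leafs n i.+1 (b i a) (fun q => 5 / 2 * t i.+1 <= normc (p - q))).
Proof.
move=> Ea; have [Eb /andP[bt _]] := bP i Ea.
apply: leafs_imp (leafs_near n i.+1 Ea) => p [_ pa].
apply: leafs_imp (leafs_near n i.+1 Eb) => q [_ qb].
have h1 := normc_le_tri (b i a) a q; have h2 := normc_le_tri q a p.
rewrite (normcB q p) in h2; rewrite (normcB (b i a) q) in h1.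
by clear -h1 h2 pa qb bt; lra.
Qed.

Variable Rd : R.
Hypothesis Rd0 : 0 < Rd.

Definition pot N n i a (z : R * R) : R := tavg n i a (fun p => ker Rd N p z).

Lemma nnm_pot N n i a : nnm (pot N n i a).
Proof. by apply: (@nnm_tavg n i a (ker Rd N)) => p; exact: nnm_ker. Qed.

(** [K] bounds the number of dyadic scales between the separation of the two subtrees and [Rd]: the
    mutual energy is logarithmic. *)
Lemma pot_cross N n i a (K : nat) : E a -> 2 * Rd <= t i.+1 * 2 ^+ K ->
  (aint (fun z => pot N n i.+1 a z * pot N n i.+1 (b i a) z)%R <= (96 * K%:R)%:E)%E.
Proof.
move=> Ea hK; have mk p : nnm (ker Rd N p) by exact: nnm_ker.
apply: aint_tavg_le => //; first exact: nnm_pot.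
apply: leafs_imp (leafs_separated n i Ea) => p hp.
under eq_fun do rewrite mulrC.
apply: aint_tavg_le => //.
apply: leafs_imp hp => q hpq.
apply: ker_pair => // k l z /andP[Kk _] /andP[Kl _]; rewrite mulrC.
apply: (shell_far Rd0 (K := K)) => //; apply: lt_le_trans hpq.
rewrite ltr_pdivrMr ?exprn_gt0//.
have : 0 < t i.+1 * 2 ^+ K by rewrite mulr_gt0 ?exprn_gt0.
rewrite -(mulrA (5 / 2)); move: (t i.+1 * _) hK => x hK x0.
move: hK; move: Rd => r hK; lra.
Qed.

Variables (kappa : nat -> nat) (D Q : R).
Hypotheses (D0 : 0 <= D) (Q0 : 0 < Q) (Q2 : Q < 2).
Hypothesis kappa_t : forall i, 2 * Rd <= t i.+1 * 2 ^+ kappa i.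
Hypothesis kappa_le : forall i, (kappa i)%:R <= D * Q ^+ i.

(* Averaging two subtrees halves the energy, while passing to the next level may multiply the
   bound by [Q]: hence the condition [Q < 2]. *)
Lemma energy_le N n i a : E a -> N%:R <= D * Q ^+ (n + i) ->
  (aint (fun z => pot N n i a z ^+ 2)%R <= (192 * D / (2 - Q) * Q ^+ i)%:E)%E.
Proof.
have q2 : 0 < 2 - Q by rewrite subr_gt0.
elim: n i a => [|n IH] i a Ea hN.
  (* A single leaf: for [K = N] the disjointness condition of [ker_pair] is void, and the truncation
     at [N] keeps the energy of a point mass finite. *)
  apply: le_trans (_ : (96 * N%:R)%:E <= _)%E.
    under eq_fun do rewrite expr2.
    by apply: ker_pair => // k l z /andP[k1 /(leq_ltn_trans k1)]; rewrite ltnn.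
  rewrite lee_fin -mulrA -mulrA; apply: (@le_trans _ _ (96 * (D * Q ^+ i))); first by rewrite
    ler_wpM2l.
  have -> : 192 * (D * ((2 - Q)^-1 * Q ^+ i)) = 192 / (2 - Q) * (D * Q ^+ i).
    by field; rewrite gt_eqF.
  rewrite ler_wpM2r ?mulr_ge0 ?exprn_ge0 ?(ltW Q0)//.
  by rewrite ler_pdivlMr//; have := Q0; move: Q => z; lra.
have [Eb _] := bP i Ea.
have h1 := IH i.+1 a Ea ltac:(by rewrite addnS -addSn).
have h2 := IH i.+1 _ Eb ltac:(by rewrite addnS -addSn).
have h3 := pot_cross N n Ea (kappa_t i).
have -> : (fun z => pot N n.+1 i a z ^+ 2) =
  (fun z => 4^-1 * ((pot N n i.+1 a z ^+ 2 + pot N n i.+1 (b i a) z ^+ 2) +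
     2 * (pot N n i.+1 a z * pot N n i.+1 (b i a) z))).
  by apply/funext => z; rewrite /pot /=; field.
have m1 c : nnm (fun z => pot N n i.+1 c z ^+ 2).
  by under eq_fun do rewrite expr2; apply: nnmM; exact: nnm_pot.
have m2 : nnm (fun z => pot N n i.+1 a z * pot N n i.+1 (b i a) z).
  by apply: nnmM; exact: nnm_pot.
rewrite aintZ ?invr_ge0//; last by apply: nnmD; [exact: nnmD|exact: nnmZ].
rewrite aintD; [|exact: nnmD|exact: nnmZ].
rewrite aintD// aintZ//.
have h4 : (2%:E * aint (fun z => pot N n i.+1 a z * pot N n i.+1 (b i a) z)%R <=
    2%:E * (96 * (kappa i)%:R)%:E)%E by rewrite lee_wpmul2l.
apply: le_trans (lee_wpmul2l _ (leeD (leeD h1 h2) h4)) _; first by rewrite lee_fin invr_ge0.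
rewrite -(EFinM 2) -!EFinD -EFinM lee_fin exprS.
have Qi : 0 <= Q ^+ i by rewrite exprn_ge0// ltW.
have hk := kappa_le i.
(* [192 * D / (2 - Q)] is the fixed point of [X -> Q / 2 * X + 96 * D]; the recursion adds only
   [48 * D], while the 96 serves the case of a single leaf. *)
have -> : 192 * D / (2 - Q) * Q ^+ i = 192 * D / (2 - Q) * (Q / 2 * Q ^+ i) + 96 * (D * Q ^+ i).
  by field; rewrite gt_eqF.
have DQ : 0 <= D * Q ^+ i by rewrite mulr_ge0.
have -> : forall x y, 4^-1 * (192 * D / (2 - Q) * (Q * y) + 192 * D / (2 - Q) * (Q * y) + 2 * (96
  * x)) =
   192 * D / (2 - Q) * (Q / 2 * y) + 48 * x :> R by move=> *; field; rewrite gt_eqF.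
rewrite lerD2l; move: hk DQ; move: (D * _) (_%:R) => x y *; lra.
Qed.

End tree.

(** * Cauchy transforms *)

Section cauchy_transform.
Variable R : realType.
Local Notation C := (R[i]^o).
Implicit Types (n i : nat) (a p q z v : C).

Lemma geometric_small (A e : R) : 0 < e -> exists n, A / 5 ^+ n <= e.
Proof.
move=> e0; exists (Num.bound (`|A| / e)).
have h := archi_boundP (divr_ge0 (normr_ge0 A) (ltW e0)).
rewrite ler_pdivrMr ?exprn_gt0// mulrC -ler_pdivrMr// ltW//.
rewrite (le_lt_trans (ler_wpM2r _ (ler_norm A))) ?invr_ge0 ?(ltW e0)//.
by rewrite (lt_trans h)// -natrX ltr_nat ltn_expl.
Qed.

Lemma le_geometric (x M A : R) : (forall n, x <= M + A / 5 ^+ n) -> x <= M.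
Proof.
move=> H; apply/ler_addgt0Pl => e /(geometric_small A)[n hn].
by rewrite (le_trans (H n))// addrC lerD2r.
Qed.

Lemma geometric_limit (x : nat -> R) (A : R) : 0 <= A ->
  (forall n, `|x n.+1 - x n| <= A / 5 ^+ n) ->
  exists l, forall n, `|l - x n| <= 2 * A / 5 ^+ n.
Proof.
move=> A0 xA.
have S n : A / 5 ^+ n.+1 = 5^-1 * (A / 5 ^+ n) by rewrite exprS invfM mulrCA.
have P n : 0 <= A / 5 ^+ n by rewrite divr_ge0.
have [|||l Hl] := @nested_intervals R (fun n => x n - 2 * (A / 5 ^+ n)) (fun n => x n + 2 * (A /
  5 ^+ n)).
- move=> n; rewrite S; have := xA n; have := P n; rewrite ler_norml.
  by move: (A / _) => u u0 /andP[? ?]; lra.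
- move=> n; rewrite S; have := xA n; have := P n; rewrite ler_norml.
  by move: (A / _) => u u0 /andP[? ?]; lra.
- by move=> n; have := P n; move: (A / _) => u ?; lra.
exists l => n; have := Hl n; rewrite -mulrA; move: (A / _) => u /andP[? ?].
by rewrite ler_distl; apply/andP; split; lra.
Qed.

Variable b : nat -> C -> C.

(** One more level replaces the value of [g] at each leaf [p] by its mean over [p] and
    [b (n + i) p]. *)
Lemma tavg_step n i a (g : C -> C) (M : R) :
  leafs b n i a (fun p => normc (g (b (n + i) p) - g p) <= M) ->
  normc (tavg b n.+1 i a g - tavg b n i a g) <= M.
Proof.
elim: n i a => [|n IH] i a.
  rewrite /= add0n => h.
  have -> : (g a + g (b i a)) / 2 - g a = 2^-1 * (g (b i a) - g a) by field.
  rewrite normcM normc_half; have := normc_ge0 (g (b i a) - g a).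
  by move: (normc _) h => x *; lra.
rewrite -[tavg b n.+2 i a g]/((tavg b n.+1 i.+1 a g + tavg b n.+1 i.+1 (b i a) g) / 2).
rewrite -[tavg b n.+1 i a g]/((tavg b n i.+1 a g + tavg b n i.+1 (b i a) g) / 2).
move=> [h1 h2]; rewrite addSn -addnS in h1 h2.
have {h1} := IH i.+1 a h1; have {h2} := IH i.+1 (b i a) h2.
move: (tavg b n.+1 i.+1 a g) (tavg b n.+1 i.+1 (b i a) g) (tavg b n i.+1 a g) (tavg b n i.+1 (b i
  a) g) => x y x' y' h1 h2.
have -> : (x + y) / 2 - (x' + y') / 2 = 2^-1 * ((x - x') + (y - y')) by field.
rewrite normcM normc_half; have := le_normcD (x - x') (y - y').
by move: (normc _) (normc _) (normc _) h1 h2 => u v w *; lra.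
Qed.

(** Here [l] plays the role of the integral of [g] against the uniform measure on the Cantor set
    below [a]. The explicit rate makes sums and inequalities pass to the limit by elementary
    estimates. *)
Definition tconv a (g : C -> C) (l : C) := exists A : R, forall n,
  normc (l - tavg b n 0 a g) <= A / 5 ^+ n.

Lemma tconvD a g g' l l' : tconv a g l -> tconv a g' l' ->
  tconv a (fun p => g p + g' p) (l + l').
Proof.
move=> [A HA] [B HB]; exists (A + B) => n.
by rewrite tavgD opprD addrACA (le_trans (le_normcD _ _))// mulrDl lerD.
Qed.

Lemma tconvZ a g l (c : C) : tconv a g l -> tconv a (fun p => c * g p) (c * l).
Proof.
move=> [A HA]; exists (normc c * A) => n.
by rewrite tavgZ -mulrBr normcM -mulrA ler_wpM2l// normc_ge0.
Qed.

Lemma tconv_le a g l (M : R) : tconv a g l ->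
  (forall n, leafs b n 0 a (fun p => normc (g p) <= M)) -> normc l <= M.
Proof.
move=> [A HA] gM; apply: (@le_geometric _ _ A) => n.
have h1 : normc (tavg b n 0 a g) <= M.
  rewrite (le_trans (normc_tavg _ _ _ _ _))// -[leRHS](tavg_cst b n 0 a).
  exact: tavg_le.
have := le_normcD (l - tavg b n 0 a g) (tavg b n 0 a g); rewrite subrK.
by move=> /le_trans; apply; rewrite addrC lerD.
Qed.

Lemma tconv_Re_ge a g l (m : R) : tconv a g l ->
  (forall n, leafs b n 0 a (fun p => m <= complex.Re (g p))) -> m <= complex.Re l.
Proof.
move=> [A HA] gm; apply: (@le_geometric _ _ A) => n.
have h1 : m <= complex.Re (tavg b n 0 a g).
  by rewrite Re_tavg -[leLHS](tavg_cst b n 0 a); exact: tavg_le.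
have := le_trans (norm_Re_le _) (HA n); rewrite ler_norml => /andP[h2 _].
have E : complex.Re (l - tavg b n 0 a g) = complex.Re l - complex.Re (tavg b n 0 a g).
  by case: (l) (tavg b n 0 a g) => [? ?] [? ?].
rewrite E in h2; move: (complex.Re _) (complex.Re _) (A / _) h1 h2 => u w x *; lra.
Qed.

Variables (E : set C) (t : nat -> R).
Hypothesis t0 : forall i, 0 < t i.
Hypothesis t5 : forall i, 5 * t i.+1 <= t i.
Hypothesis bP : forall i a, E a -> E (b i a) /\ 5 * t i.+1 <= normc (b i a - a) <= t i.

Lemma t_geometric n i : t (n + i) <= t i / 5 ^+ n.
Proof.
elim: n => [|n IH]; first by rewrite expr0 divr1.
have := t5 (n + i); rewrite addSn exprS invfM mulrCA.
by move: (t _) (t _) (t i / _) IH => x y u *; lra.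
Qed.

Lemma tconv_ex a g (L : R) : E a -> 0 <= L ->
  (forall p q, E p -> E q -> normc (g p - g q) <= L * normc (p - q)) ->
  exists l, tconv a g l.
Proof.
move=> Ea L0 gL.
have st n : normc (tavg b n.+1 0 a g - tavg b n 0 a g) <= L * t 0 / 5 ^+ n.
  apply: tavg_step; apply: leafs_imp (leafs_near t0 t5 bP n 0 Ea) => p [Ep _].
  have [Eb /andP[_ bt]] := bP (n + 0) Ep.
  rewrite (le_trans (gL _ _ Eb Ep))// -mulrA ler_wpM2l// (le_trans bt)//.
  exact: t_geometric.
have Lt : 0 <= L * t 0 by rewrite mulr_ge0// ltW.
have DE (x y : C) : complex.Re (x - y) = complex.Re x - complex.Re y /\
   complex.Im (x - y) = complex.Im x - complex.Im y by case: x y => [? ?] [? ?].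
have [x Hx] := @geometric_limit (fun n => complex.Re (tavg b n 0 a g)) _ Lt
  ltac:(by move=> n; rewrite -(DE _ _).1 (le_trans (norm_Re_le _))).
have [y Hy] := @geometric_limit (fun n => complex.Im (tavg b n 0 a g)) _ Lt
  ltac:(by move=> n; rewrite -(DE _ _).2 (le_trans (norm_Im_le _))).
exists (x +i* y), (2 * (L * t 0) + 2 * (L * t 0)) => n.
by rewrite (le_trans (normc_le_ReIm _))// mulrDl lerD// ?(DE _ _).1 ?(DE _ _).2.
Qed.

Definition far_from z (m : R) := forall p, E p -> m <= normc (z - p).

Lemma inv_lipschitz z m p q : 0 < m -> far_from z m -> E p -> E q ->
  normc ((z - p)^-1 - (z - q)^-1) <= (m ^+ 2)^-1 * normc (p - q).
Proof.
move=> m0 fz Ep Eq; have hp := fz _ Ep; have hq := fz _ Eq.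
have np := lt_le_trans m0 hp; have nq := lt_le_trans m0 hq.
have p0 : z - p != 0 by rewrite -normc_gt0.
have q0 : z - q != 0 by rewrite -normc_gt0.
have -> : (z - p)^-1 - (z - q)^-1 = ((z - p) * (z - q))^-1 * (p - q).
  by field; rewrite q0.
rewrite normcM normcV normcM ler_wpM2r ?normc_ge0//.
by rewrite lef_pV2 ?posrE ?mulr_gt0 ?exprn_gt0// expr2 ler_pM// ltW.
Qed.

Lemma inv_le z m p : 0 < m -> far_from z m -> E p -> normc (z - p)^-1 <= m^-1.
Proof.
move=> m0 fz /fz hp; rewrite normcV lef_pV2 ?posrE// (lt_le_trans m0)//.
Qed.

(** The value is 0 by default where the averages have no such limit; [cauchy_trP] excludes this at
    positive distance from [E]. *)
Definition cauchy_tr a z : C := xget 0 [set l | tconv a (fun p => (z - p)^-1) l].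

Lemma cauchy_trP a z m : E a -> 0 < m -> far_from z m ->
  tconv a (fun p => (z - p)^-1) (cauchy_tr a z).
Proof.
move=> Ea m0 fz; have [l Hl] := @tconv_ex a (fun p => (z - p)^-1) (m ^+ 2)^-1 Ea
  ltac:(by rewrite invr_ge0 sqr_ge0) (fun p q => @inv_lipschitz z m p q m0 fz).
by rewrite /cauchy_tr; case: xgetP => [y _ //|/(_ l)].
Qed.

(** The derivative is minus the limit of the averages of [(z - p) ^ -2]. For each leaf the error is
    exactly [v ^ 2 / ((z - p) ^ 2 * (z + v - p))], at most [2 / m ^ 3 * |v| ^ 2] as soon as
    [|v| <= m / 2], and this uniform bound survives the limit. *)
Lemma is_cderiv_cauchy_tr a z m : E a -> 0 < m -> far_from z m ->
  exists d, is_cderiv (cauchy_tr a) z d.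
Proof.
move=> Ea m0 fz.
have [G HG] : exists l, tconv a (fun p => (z - p)^-1 * (z - p)^-1) l.
  apply: (@tconv_ex _ _ (2 * m^-1 * (m ^+ 2)^-1)) => //.
    by rewrite !mulr_ge0// invr_ge0 ?sqr_ge0// ltW.
  move=> p q Ep Eq.
  have -> : (z - p)^-1 * (z - p)^-1 - (z - q)^-1 * (z - q)^-1 =
    ((z - p)^-1 + (z - q)^-1) * ((z - p)^-1 - (z - q)^-1) by ring.
  rewrite normcM -(mulrA (2 / m)) ler_pM ?normc_ge0//; last exact: inv_lipschitz.
  rewrite (le_trans (le_normcD _ _))// mulr2n mulrDl mul1r lerD//; exact: inv_le.
exists (- G) => e e0.
have m3 : 0 < m ^+ 3 by rewrite exprn_gt0.
exists (Num.min (m / 2) (e * m ^+ 3 / 2)); first by rewrite lt_min !divr_gt0// mulr_gt0.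
move=> v; rewrite lt_min => /andP[vm ve].
have fzv : far_from (z + v) (m / 2).
  move=> p Ep; have := fz _ Ep; have := le_normcD (z + v - p) (- v).
  rewrite normcN (_ : z + v - p - v = z - p); last by ring.
  by move: (normc _) (normc _) (normc _) vm => x y w *; lra.
have m2 : 0 < m / 2 by rewrite divr_gt0.
have c1 := cauchy_trP Ea m2 fzv; have c0 := cauchy_trP Ea m0 fz.
have := tconvD (tconvD c1 (tconvZ (-1) c0)) (tconvZ v HG).
rewrite mulN1r mulNr opprK (mulrC v G) => /tconv_le H.
rewrite (H (e * normc v))// => n.
apply: leafs_imp (leafs_near t0 t5 bP n 0 Ea) => p [Ep _].
have hp := fz _ Ep; have hvp := fzv _ Ep.
have np := lt_le_trans m0 hp; have nvp := lt_le_trans m2 hvp.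
have p0 : z - p != 0 by rewrite -normc_gt0.
have vp0 : z + v - p != 0 by rewrite -normc_gt0.
have -> : (z + v - p)^-1 + -1 * (z - p)^-1 + v * ((z - p)^-1 * (z - p)^-1) =
   (v * ((z - p)^-1 * (z - p)^-1 * (z + v - p)^-1)) * v by field; rewrite vp0.
rewrite normcM ler_wpM2r ?normc_ge0// !normcM.
have i1 := inv_le m0 fz Ep; have i2 := inv_le m2 fzv Ep.
have h : normc (z - p)^-1 * normc (z - p)^-1 * normc (z + v - p)^-1 <= m^-1 * m^-1 * (m / 2)^-1.
  by rewrite ler_pM ?mulr_ge0 ?normc_ge0// ler_pM ?normc_ge0.
rewrite (le_trans (ler_wpM2l (normc_ge0 v) h))//.
have -> : m^-1 * m^-1 * (m / 2)^-1 = 2 / m ^+ 3 by field; rewrite gt_eqF.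
by rewrite mulrA ler_pdivrMr// -ler_pdivlMr// ltW.
Qed.

End cauchy_transform.

(** * Fatou's lemma for eventual majorants *)

Section fatou.
Variable R : realType.
Local Notation area := (@lebesgue_measure R \x @lebesgue_measure R)%E.

Lemma limn_einfE (u : (\bar R)^nat) : limn_einf u = ereal_sup (range (einfs u)).
Proof. by rewrite limn_einf_lim; apply: cvg_lim => //; exact: cvg_einfs_sup. Qed.

Lemma limn_einf_le (u : (\bar R)^nat) (B : \bar R) : (forall n, u n <= B)%E ->
  (limn_einf u <= B)%E.
Proof.
move=> uB; rewrite limn_einfE; apply: ge_ereal_sup => _ [n _ <-].
by apply: le_trans (uB n); apply: ereal_inf_lbound; exists n => /=.
Qed.

Lemma limn_einf_ge (u : (\bar R)^nat) (c : \bar R) N : (forall n, (N <= n)%N -> c <= u n)%E ->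
  (c <= limn_einf u)%E.
Proof.
move=> cu; rewrite limn_einfE; apply: (@le_trans _ _ (einfs u N)).
  by apply: le_ereal_inf_tmp => _ [n /= Nn <-]; exact: cu.
by apply: ereal_sup_ubound; exists N.
Qed.

(** The last hypothesis states that [f] is at most the lower limit of [g]; this one-sided form fits
    potentials that majorize the transform without converging to it. *)
Lemma fatou_le (D : set (R * R)) (f : R * R -> R) (g : nat -> R * R -> R) (B : \bar R) :
  measurable D -> measurable_fun D f -> (forall z, D z -> 0 <= f z) ->
  (forall n, nnm (g n)) -> (forall n, aint (g n) <= B)%E ->
  (forall z, D z -> forall e : R, 0 < e -> exists N, forall n, (N <= n)%N -> f z <= g n z + e) ->
  (\int[area]_(z in D) (f z)%:E <= B)%E.
Proof.
move=> mD mf f0 mg gB fg.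
have mgE n : measurable_fun D (fun z => (g n z)%:E).
  by apply/measurable_EFinP; apply: measurable_funS (mg n).1.
apply: (@le_trans _ _ (\int[area]_(z in D) limn_einf (fun n => (g n z)%:E))%E).
  apply: ge0_le_integral => //.
  - exact/measurable_EFinP.
  - rewrite /limn_einf; apply: measurableT_comp => //.
    apply: measurable_fun_limn_esup => n; apply: measurableT_comp => //; exact: mgE.
  - move=> z Dz; apply/lee_addgt0Pr => e e0; have [N HN] := fg z Dz e e0.
    rewrite -leeBlDr//; apply: (@limn_einf_ge _ _ N) => n /HN h.
    by rewrite -EFinB lee_fin lerBlDr.
have g0 n z : D z -> (0 <= (g n z)%:E)%E by rewrite lee_fin; case: (mg n).
apply: (le_trans (@fatou _ _ _ area D mD (fun n z => (g n z)%:E) mgE g0)).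
apply: limn_einf_le => n; apply: le_trans (gB n); apply: ge0_subset_integral => //.
- by apply/measurable_EFinP; case: (mg n).
- by move=> z _; rewrite lee_fin; case: (mg n).
Qed.

End fatou.

(** * Square integrability of the difference of two Cauchy transforms *)

Section dipole.
Variable R : realType.
Local Notation C := (R[i]^o).
Local Notation area := (@lebesgue_measure R \x @lebesgue_measure R)%E.
Variables (b : nat -> C -> C) (E : set C) (t : nat -> R).
Hypothesis t0 : forall i, 0 < t i.
Hypothesis t5 : forall i, 5 * t i.+1 <= t i.
Hypothesis bP : forall i a, E a -> E (b i a) /\ 5 * t i.+1 <= normc (b i a - a) <= t i.
Variables (Rr D Q : R) (kappa : nat -> nat).
Hypotheses (tR : 5 * t 0 <= Rr) (D0 : 0 <= D) (Q0 : 0 < Q) (Q2 : Q < 2).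
Hypothesis kappa_t : forall i, 2 * (4 * Rr) <= t i.+1 * 2 ^+ kappa i.
Hypothesis kappa_le : forall i, (kappa i)%:R <= D * Q ^+ i.
Variables (O : set C) (oO : open O).
Hypothesis farO : forall z, O z -> exists2 m, 0 < m & far_from E z m.
Variables (a a' : C).
Hypotheses (Ea : E a) (Ea' : E a') (aa' : normc (a' - a) <= Rr).

Local Notation cauchy := (cauchy_tr b).

Let Rr0 : 0 < Rr.
Proof. by rewrite (lt_le_trans _ tR)// mulr_gt0. Qed.

Lemma geometric_eventually (A e : R) : 0 < e ->
  exists N, forall n, (N <= n)%N -> A / 5 ^+ n <= e.
Proof.
move=> /(geometric_small `|A|)[N HN]; exists N => n Nn.
rewrite (le_trans _ HN)// (@le_trans _ _ (`|A| / 5 ^+ n))//.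
  by rewrite ler_wpM2r ?invr_ge0 ?exprn_ge0// ler_norm.
by rewrite ler_wpM2l// lef_pV2 ?posrE ?exprn_gt0// ler_weXn2l// ler1n.
Qed.

(** In each coordinate [z] is within [2 Rr + Rr + Rr / 4] of every leaf, hence the radius [4 * Rr]
    of the kernel. At depth [n] it has [kappa n] shells, which reach down to the scale [t n.+1],
    eventually smaller than the distance of [z] from [E]. *)
Lemma cauchy_le_pot c (z : R * R) : E c -> normc (c - a) <= Rr -> O (of_pair z) ->
  `|z.1 - complex.Re a| <= 2 * Rr -> `|z.2 - complex.Im a| <= 2 * Rr ->
  forall e : R, 0 < e -> exists N, forall n, (N <= n)%N ->
    normc (cauchy c (of_pair z)) ^+ 2 <= pot b (4 * Rr) (kappa n) n 0 c z ^+ 2 + e.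
Proof.
move=> Ec ca /farO[m m0 fz] z1 z2 e e0.
have [A HA] := cauchy_trP t0 t5 bP Ec m0 fz.
set x := normc (cauchy c (of_pair z)).
have x0 : 0 <= x by exact: normc_ge0.
have k0 : 0 < 2 * x + 1 by move: (x) x0 => y ?; lra.
(* If [u < x <= u + dl], then [x ^ 2 - u ^ 2 <= 2 * x * dl <= e]. *)
pose dl := e / (2 * x + 1).
have dl0 : 0 < dl by rewrite divr_gt0.
have [N1 HN1] := geometric_eventually A dl0.
have m2 : 0 < m / 2 by rewrite divr_gt0.
have [N2 HN2] := geometric_eventually (t 0) m2.
exists (maxn N1 N2) => n; rewrite geq_max => /andP[/HN1 h1 h2].
set u := pot _ _ _ _ _ _ _.
have R40 : 0 < 4 * Rr by rewrite mulr_gt0.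
have u0 : 0 <= u := (nnm_pot b R40 (kappa n) n 0 c).2 z.
have tm : t n.+1 <= m / 2.
  by have := t_geometric t5 n.+1 0; rewrite addn0 => /le_trans; apply; rewrite HN2// (leq_trans
    h2).
have xu : x <= u + dl.
  have : normc (tavg b n 0 c (fun p => (of_pair z - p)^-1)) <= u.
    rewrite (le_trans (normc_tavg _ _ _ _ _))//; apply: tavg_le.
    apply: leafs_imp (leafs_near t0 t5 bP n 0 Ec) => p [Ep pc].
    rewrite normcV; apply: ker_ge => //.
    - have := norm_Re_le (p - c); have := norm_Re_le (c - a).
      move: ca pc z1 tR Rr0; case: (p) (c) (a) => [x1 y1] [x2 y2] [x3 y3] /=.
      move: (t 0) (normc _) (normc _) => w n1 n2; rewrite !ler_norml.
      move=> ? ? /andP[? ?] ? ? /andP[? ?] /andP[? ?]; apply/andP; split; lra.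
    - have := norm_Im_le (p - c); have := norm_Im_le (c - a).
      move: ca pc z2 tR Rr0; case: (p) (c) (a) => [x1 y1] [x2 y2] [x3 y3] /=.
      move: (t 0) (normc _) (normc _) => w n1 n2; rewrite !ler_norml.
      move=> ? ? /andP[? ?] ? ? /andP[? ?] /andP[? ?]; apply/andP; split; lra.
    - have := fz _ Ep; apply: lt_le_trans; rewrite (@le_lt_trans _ _ (m / 2))//.
        by rewrite (le_trans _ tm)// ler_pdivrMr ?exprn_gt0.
      by rewrite ltr_pdivrMr// mulr2n mulrDr mulr1 ltrDl.
  have := le_normcD (cauchy c (of_pair z) - tavg b n 0 c (fun p => (of_pair z - p)^-1))
    (tavg b n 0 c (fun p => (of_pair z - p)^-1)); rewrite subrK -/x.
  by move=> h3 h4; rewrite (le_trans h3)// addrC lerD// (le_trans (HA n)).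
have xd : 2 * x * dl <= e.
  rewrite /dl mulrA ler_pdivrMr// mulrC ler_pM2l//.
  by rewrite lerDl.
have [xu'|ux] := leP x u.
  by rewrite (@le_trans _ _ (u ^+ 2)) ?lerDl ?(ltW e0)// lerXn2r.
have : (x - u) * (x + u) <= dl * (2 * x).
  by rewrite ler_pM ?subr_ge0 ?(ltW ux)// ?addr_ge0//; move: (x) (u) (dl) ux xu => *; lra.
by rewrite -subr_sqr => h; rewrite -lerBlDl (le_trans h)// mulrC.
Qed.

(* Subtracting the transform rooted at [a'] gives quadratic decay at infinity, so that the norm
   does not involve the diameter of [O]. *)
Definition dipole z : C := cauchy a z - cauchy a' z.

Lemma is_cderiv_sub (f g : C -> C) z d d' : is_cderiv f z d -> is_cderiv g z d' ->
  is_cderiv (fun u => f u - g u) z (d - d').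
Proof.
move=> df dg e e0; have e2 : 0 < e / 2 by rewrite divr_gt0.
have [r r0 H] := df _ e2; have [r' r'0 K] := dg _ e2.
exists (Num.min r r'); first by rewrite lt_min r0.
move=> v; rewrite lt_min => /andP[/H h /K k].
have -> : f (z + v) - g (z + v) - (f z - g z) - (d - d') * v =
  (f (z + v) - f z - d * v) + - (g (z + v) - g z - d' * v) by ring.
rewrite (le_trans (le_normcD _ _))// normcN [e]splitr mulrDl lerD//.
Qed.

Lemma holomorphic_dipole : holomorphic_on O dipole.
Proof.
move=> z /farO[m m0 fz].
have [d hd] := is_cderiv_cauchy_tr t0 t5 bP Ea m0 fz.
have [d' hd'] := is_cderiv_cauchy_tr t0 t5 bP Ea' m0 fz.
exact: is_cderiv_derivable (is_cderiv_sub hd hd').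
Qed.

Let pO := @of_pair R @^-1` O.

Lemma holomorphic_cauchy c : E c -> holomorphic_on O (cauchy c).
Proof.
move=> Ec z /farO[m m0 fz].
by have [d /is_cderiv_derivable] := is_cderiv_cauchy_tr t0 t5 bP Ec m0 fz.
Qed.

Lemma measurable_box (s : R) (p : C) : measurable (box s p).
Proof. by apply: measurableX; exact: measurable_itv. Qed.

(** At depth [n] with [kappa n] shells, [kappa_le] is exactly the hypothesis of [energy_le] at the
    root. Its bound is the same for all [n], as Fatou's lemma requires. *)
Lemma cauchy_inner c : E c -> normc (c - a) <= Rr ->
  (\int[area]_(z in pO `&` box (2 * Rr) a) (normc (cauchy c (of_pair z)) ^+ 2)%:E <=
   (192 * D / (2 - Q))%:E)%E.
Proof.
move=> Ec ca.
have R40 : 0 < 4 * Rr by rewrite mulr_gt0.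
have mO := measurable_preimage oO.
have mOB := measurableI _ _ mO (measurable_box (2 * Rr) a).
apply: (@fatou_le R _ _ (fun n z => pot b (4 * Rr) (kappa n) n 0 c z ^+ 2)) => //.
- apply: measurable_funX; apply: measurable_funS (measurable_normc_f oO (holomorphic_cauchy Ec))
  => //.
- by move=> z _; rewrite sqr_ge0.
- by move=> n; under eq_fun do rewrite expr2; apply: nnmM; exact: nnm_pot.
- move=> n; have := @energy_le R b E t t0 t5 bP _ R40 kappa D Q D0 Q0 Q2 kappa_t kappa_le (kappa
  n) n 0 c Ec.
  by rewrite addn0 expr0 mulr1; apply.
- move=> z [Oz]; rewrite boxE => -[z1 z2]; exact: cauchy_le_pot.
Qed.

(** All leaves [p] satisfy [|p - a| <= 5/4 Rr], so [|z - p| >= (1 - 5/8) |z - a|]; the constant is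
    [(5/4) / (3/8)]. *)
Lemma cauchy_outer c (z : C) : E c -> normc (c - a) <= Rr -> O z -> 2 * Rr <= normc (z - a) ->
  normc (cauchy c z - (z - a)^-1) <= 10 / 3 * Rr / normc (z - a) ^+ 2.
Proof.
move=> Ec ca /farO[m m0 fz] za.
have c1 := cauchy_trP t0 t5 bP Ec m0 fz.
have c2 : tconv b c (fun=> - (z - a)^-1) (- (z - a)^-1).
  exists 0 => n; rewrite mul0r.
  suff -> : tavg b n 0 c (fun=> - (z - a)^-1) = - (z - a)^-1 by rewrite subrr normc0.
  by elim: n (0%N) (c) => [|n IH] i d //=; rewrite !IH; field; rewrite -normc_gt0 (lt_le_trans _
    za)// mulr_gt0.
have x0 : 0 < normc (z - a) by rewrite (lt_le_trans _ za)// mulr_gt0.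
apply: (tconv_le (tconvD c1 c2)) => n.
apply: leafs_imp (leafs_near t0 t5 bP n 0 Ec) => p [Ep pc].
have pa : normc (p - a) <= 5 / 4 * Rr.
  have := normc_le_tri p a c; move: pc ca tR.
  by move: (t 0) (normc _) (normc _) (normc _) => u v w x *; lra.
have zp : 3 / 8 * normc (z - a) <= normc (z - p).
  have := normc_le_tri z a p; move: pa za.
  by move: (normc _) (normc _) (normc _) => v w x *; lra.
have p0 : 0 < normc (z - p) by rewrite (lt_le_trans _ zp)// mulr_gt0.
have -> : (z - p)^-1 - (z - a)^-1 = (p - a) * ((z - p)^-1 * (z - a)^-1).
  by field; rewrite -!normc_gt0 x0.
rewrite !normcM !normcV.
have -> : 10 / 3 * Rr / normc (z - a) ^+ 2 = (5 / 4 * Rr) * ((3 / 8 * normc (z - a))^-1 * (normc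
  (z - a))^-1).
  by field; rewrite gt_eqF.
rewrite ler_pM ?normc_ge0 ?mulr_ge0 ?invr_ge0 ?normc_ge0//.
rewrite ler_wpM2r ?invr_ge0 ?normc_ge0// lef_pV2 ?posrE//.
by rewrite mulr_gt0.
Qed.

End dipole.

Section tail.
Variable R : realType.
Local Notation C := (R[i]^o).
Variable Rr : R.
Hypothesis Rr0 : 0 < Rr.

(** A step majorant of [64 Rr ^ 2 / m ^ 4], with [m] the distance from [a] in the maximum norm, for
    [m > 2 Rr]. The k-th weight is its value at [m = 2 Rr * 2 ^ k], and the k-th box reaches to
    twice that distance. *)
Definition tail N (a : C) (z : R * R) : R :=
  \sum_(k < N) box_weight (4 / (16 ^+ k * Rr ^+ 2)) (4 * 2 ^+ k * Rr) a z.

Let w0 k : 0 <= 4 / (16 ^+ k * Rr ^+ 2).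
Proof. by apply: divr_ge0 => //; apply: mulr_ge0; [exact: exprn_ge0|exact: sqr_ge0]. Qed.

Lemma nnm_tail N a : nnm (tail N a).
Proof.
exact: (@nnm_sum R N (fun k => box_weight (4 / (16 ^+ k * Rr ^+ 2)) (4 * 2 ^+ k * Rr) a)
  (fun k => nnm_box_weight _ _ (w0 k))).
Qed.

(** The k-th term integrates to [256 / 4 ^ k], and the full series sums to [1024 / 3 < 342],
    whatever [N] and [Rr]. *)
Lemma aint_tail N a : (aint (tail N a) <= 342%:E)%E.
Proof.
apply: (@le_trans _ _ (\sum_(k < N) 256 / 4 ^+ k)%:E).
  apply: (@aint_sum_le R N (fun k => box_weight (4 / (16 ^+ k * Rr ^+ 2)) (4 * 2 ^+ k * Rr) a)
    (fun k => 256 / 4 ^+ k)) => k; first exact: nnm_box_weight.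
  move=> _; rewrite aint_box_weight ?mulr_gt0 ?exprn_gt0// lee_fin.
  rewrite le_eqVlt; apply/orP; left; apply/eqP.
  have -> : (16 : R) = 2 ^+ 4 by rewrite -natrX.
  have -> : (4 : R) ^+ k = 2 ^+ k ^+ 2.
    by rewrite exprAC; congr (_ ^+ k); rewrite -natrX.
  rewrite exprAC; have : (2 ^+ k : R) != 0 by rewrite expf_neq0// pnatr_eq0.
  by move: (2 ^+ k) => x x0; field; rewrite x0 gt_eqF.
rewrite lee_fin.
have -> : \sum_(k < N) 256 / 4 ^+ k = 1024 / 3 - 1024 / 3 / 4 ^+ N :> R.
  elim: N => [|N IH]; first by rewrite big_ord0; field.
  rewrite big_ord_recr /= IH exprS; field.
  by rewrite expf_neq0// pnatr_eq0.
have : 0 <= (4 ^+ N)^-1 :> R by rewrite invr_ge0 exprn_ge0.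
by move: (4 ^+ N)^-1 => x x0; lra.
Qed.

Lemma tail_ge N a z (y : R) (m := Num.max `|z.1 - complex.Re a| `|z.2 - complex.Im a|) :
  2 * Rr < m -> m <= 2 * Rr * 2 ^+ N -> y <= 64 * Rr ^+ 2 / m ^+ 4 -> y <= tail N a z.
Proof.
move=> Rm + ym; elim: N => [|N IH] mN; first by move: mN; rewrite expr0 mulr1 leNgt Rm.
rewrite /tail big_ord_recr /= -/(tail N a z).
have [/IH h|h] := leP m (2 * Rr * 2 ^+ N).
  by rewrite (le_trans h)// lerDl; case: (nnm_box_weight (4 * 2 ^+ N * Rr) a (w0 N)).
apply: ler_wpDl; first by case: (nnm_tail N a).
have zb : box (4 * 2 ^+ N * Rr) a z.
  have -> : 4 * 2 ^+ N * Rr = 2 * Rr * 2 ^+ N.+1 by rewrite exprS; ring.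
  by rewrite boxE; split; rewrite (le_trans _ mN)// le_max lexx ?orbT.
rewrite /box_weight indicE mem_set// mulr1 (le_trans ym)//.
have p2 : 0 < 2 ^+ N :> R by rewrite exprn_gt0.
have x0 : 0 < 2 * Rr * 2 ^+ N by rewrite !mulr_gt0.
apply: (@le_trans _ _ (64 * Rr ^+ 2 / (2 * Rr * 2 ^+ N) ^+ 4)).
  have m0 := lt_trans x0 h.
  apply: ler_wpM2l; first by apply: mulr_ge0 => //; exact: sqr_ge0.
  rewrite lef_pV2 ?posrE ?exprn_gt0//.
  by rewrite lerXn2r ?nnegrE ?(ltW x0) ?(ltW h) ?(ltW m0).
rewrite le_eqVlt; apply/orP; left; apply/eqP.
have -> : (16 : R) = 2 ^+ 4 by rewrite -natrX.
rewrite (exprAC _ 4); move: (2 ^+ N) p2 => x xx; field.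
by rewrite !gt_eqF.
Qed.

End tail.

Section dipole_L2.
Variable R : realType.
Local Notation C := (R[i]^o).
Local Notation area := (@lebesgue_measure R \x @lebesgue_measure R)%E.
Variables (b : nat -> C -> C) (E : set C) (t : nat -> R).
Hypothesis t0 : forall i, 0 < t i.
Hypothesis t5 : forall i, 5 * t i.+1 <= t i.
Hypothesis bP : forall i a, E a -> E (b i a) /\ 5 * t i.+1 <= normc (b i a - a) <= t i.
Variables (Rr D Q : R) (kappa : nat -> nat).
Hypotheses (tR : 5 * t 0 <= Rr) (D0 : 0 <= D) (Q0 : 0 < Q) (Q2 : Q < 2).
Hypothesis kappa_t : forall i, 2 * (4 * Rr) <= t i.+1 * 2 ^+ kappa i.
Hypothesis kappa_le : forall i, (kappa i)%:R <= D * Q ^+ i.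
Variables (O : set C) (oO : open O).
Hypothesis farO : forall z, O z -> exists2 m, 0 < m & far_from E z m.
Variables (a a' : C) (M : R).
Hypotheses (Ea : E a) (Ea' : E a') (aa' : normc (a' - a) <= Rr).
Hypothesis OM : forall z, O z -> normc (z - a) <= M.

Let pO := @of_pair R @^-1` O.

Let Rr0 : 0 < Rr.
Proof. by rewrite (lt_le_trans _ tR)// mulr_gt0. Qed.

Let aa : normc (a - a) <= Rr.
Proof. by rewrite subrr normc0 ltW. Qed.

Lemma dipole_outer (z : C) : O z -> 2 * Rr <= normc (z - a) ->
  normc (dipole b a a' z) <= 20 / 3 * Rr / normc (z - a) ^+ 2.
Proof.
move=> Oz za.
have h1 := cauchy_outer t0 t5 bP tR farO Ea aa Oz za.
have h2 := cauchy_outer t0 t5 bP tR farO Ea' aa' Oz za.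
have -> : dipole b a a' z = (cauchy_tr b a z - (z - a)^-1) + - (cauchy_tr b a' z - (z - a)^-1).
  by rewrite /dipole; ring.
rewrite (le_trans (le_normcD _ _))// normcN (le_trans (lerD h1 h2))//.
rewrite -!mulrA -!mulrDl le_eqVlt; apply/orP; left; apply/eqP.
by congr (_ * _); field.
Qed.

(** Inside the box of half-side [2 * Rr] the two energies are simply added, at the price of
    [|x - y| ^ 2 <= 2 (|x| ^ 2 + |y| ^ 2)]; outside, the cancellation of the two transforms leaves
    an integrable fourth power. *)
Lemma dipole_L2 :
  (\int[area]_(p in pO) (normc (dipole b a a' (of_pair p)) ^+ 2)%:E <=
   (4 * (192 * D / (2 - Q)) + 342)%:E)%E.
Proof.
have mO : measurable pO by exact: measurable_preimage.
pose I := box (2 * Rr) a.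
have mI : measurable I by exact: measurable_box.
have mOI := measurableI _ _ mO mI.
have mOJ := measurableI _ _ mO (measurableC mI).
have hD := holomorphic_dipole t0 t5 bP farO Ea Ea'.
have mD := measurable_normc_f oO hD.
have mD2 : measurable_fun pO (fun p => (normc (dipole b a a' (of_pair p)) ^+ 2)%:E).
  by apply/measurable_EFinP; exact: measurable_funX.
have mC c : E c -> measurable_fun (pO `&` I) (fun p => (normc (cauchy_tr b c (of_pair p)) ^+
  2)%:E).
  move=> Ec; apply/measurable_EFinP; apply: measurable_funX.
  apply: measurable_funS (measurable_normc_f oO (holomorphic_cauchy t0 t5 bP farO Ec)) => //.
have UE : pO = (pO `&` I) `|` (pO `&` ~` I) by rewrite -setIUr setUv setIT.
rewrite UE ge0_integral_setU//; last 3 first.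
- by rewrite -UE.
- by move=> z _; rewrite lee_fin sqr_ge0.
- by apply/disj_setPS => z [[_ Iz] [_ nIz]].
rewrite EFinD; apply: leeD.
  apply: (@le_trans _ _ (\int[area]_(z in pO `&` I) (2%:E * ((normc (cauchy_tr b a (of_pair z))
    ^+ 2)%:E +
     (normc (cauchy_tr b a' (of_pair z)) ^+ 2)%:E)))%E).
    apply: ge0_le_integral => //.
    - by move=> z _; rewrite lee_fin sqr_ge0.
    - by apply: measurable_funS mD2 => //.
    - by apply: measurable_funeM; apply: emeasurable_funD; exact: mC.
    - move=> z _; rewrite -EFinD -EFinM lee_fin /dipole.
      have := le_normcD (cauchy_tr b a (of_pair z)) (- cauchy_tr b a' (of_pair z)).
      rewrite normcN; have := normc_ge0 (cauchy_tr b a (of_pair z) - cauchy_tr b a' (of_pair z)).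
      move: (normc _) (normc _) (normc _) => w v u u0 uvw.
      have h1 : u ^+ 2 <= (v + w) ^+ 2 by rewrite lerXn2r ?nnegrE ?u0 ?(le_trans u0 uvw).
      have h2 := sqr_ge0 (v - w).
      move: h1 h2; rewrite sqrrD sqrrB; move: (u ^+ 2) (v ^+ 2) (w ^+ 2) (v * w) => *; lra.
  rewrite ge0_integralZl_EFin//; last 2 first.
  - by move=> z _; rewrite -EFinD lee_fin addr_ge0 ?sqr_ge0.
  - by apply: emeasurable_funD; exact: mC.
  rewrite ge0_integralD//; last 4 first.
  - by move=> z _; rewrite lee_fin sqr_ge0.
  - exact: mC.
  - by move=> z _; rewrite lee_fin sqr_ge0.
  - exact: mC.
  have h1 := cauchy_inner t0 t5 bP tR D0 Q0 Q2 kappa_t kappa_le oO farO Ea aa.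
  have h2 := cauchy_inner t0 t5 bP tR D0 Q0 Q2 kappa_t kappa_le oO farO Ea' aa'.
  apply: (le_trans (lee_wpmul2l _ (leeD h1 h2))); first by rewrite lee_fin.
  rewrite -EFinD -EFinM lee_fin; move: (192 * D / _) => x; lra.
(* Finitely many boxes of [tail] cover the bounded set [O], and the bound of [aint_tail] is uniform
   in their number. *)
have [N HN] : exists N, M <= 2 * Rr * 2 ^+ N.
  have r2 : 0 < 2 * Rr by rewrite mulr_gt0.
  have h := archi_boundP (divr_ge0 (normr_ge0 M) (ltW r2)).
  exists (Num.bound (`|M| / (2 * Rr))).
  rewrite mulrC -ler_pdivrMr// ltW// (le_lt_trans (ler_wpM2r _ (ler_norm M))) ?invr_ge0 ?(ltW
    r2)//.
  by rewrite (lt_trans h)// -natrX ltr_nat ltn_expl.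
apply: le_trans (aint_tail Rr0 N a).
apply: (@le_trans _ _ (\int[area]_(z in pO `&` ~` I) (tail Rr N a z)%:E)%E).
  have [mt t00] := nnm_tail Rr N a.
  apply: ge0_le_integral => //.
  - by move=> z _; rewrite lee_fin sqr_ge0.
  - by apply: measurable_funS mD2 => //.
  - by apply/measurable_EFinP; apply: measurable_funS mt.
  - move=> z [Oz nI]; rewrite lee_fin.
    set m := Num.max `|z.1 - complex.Re a| `|z.2 - complex.Im a|.
    have Rm : 2 * Rr < m.
      rewrite ltNge; apply/negP; rewrite ge_max => /andP[h1 h2]; apply: nI.
      by rewrite /I boxE.
    have mz : m <= normc (of_pair z - a).
      have := norm_Re_le (of_pair z - a); have := norm_Im_le (of_pair z - a).
      by rewrite /m; case: (a) => x y /= *; rewrite ge_max; apply/andP.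
    have m0 : 0 < m by rewrite (lt_trans _ Rm)// mulr_gt0.
    apply: tail_ge => //.
      by rewrite (le_trans mz)// (le_trans (OM Oz)).
    have h := dipole_outer Oz (le_trans (ltW Rm) mz).
    have {}h : normc (dipole b a a' (of_pair z)) <= 8 * Rr / m ^+ 2.
      rewrite (le_trans h)// ler_pM ?invr_ge0 ?sqr_ge0 ?mulr_ge0 ?(ltW Rr0)//.
        by rewrite ler_wpM2r ?(ltW Rr0)//; lra.
      rewrite lef_pV2 ?posrE ?exprn_gt0//; last by rewrite (lt_le_trans m0).
      by rewrite lerXn2r ?nnegrE ?(ltW m0)// (le_trans (ltW m0)).
    have -> : 64 * Rr ^+ 2 / m ^+ 4 = (8 * Rr / m ^+ 2) ^+ 2 by field; rewrite gt_eqF.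
    by rewrite lerXn2r ?nnegrE ?normc_ge0 ?divr_ge0 ?sqr_ge0 ?mulr_ge0 ?(ltW Rr0).
apply: ge0_subset_integral => //.
  by apply/measurable_EFinP; case: (nnm_tail Rr N a).
by move=> z _; rewrite lee_fin; case: (nnm_tail Rr N a).
Qed.

End dipole_L2.

(** * Testing the Bergman metric *)

Section bergman_bound.
Variable R : realType.
Local Notation C := (R[i]^o).
Local Notation area := (@lebesgue_measure R \x @lebesgue_measure R)%E.
Variables (O : set C) (oO : open O).
Implicit Types (f g k : C -> C).

Let pO := @of_pair R @^-1` O.

Lemma bergman_spaceI f (B : R) : holomorphic_on O f ->
  (\int[area]_(p in pO) (normc (f (of_pair p)) ^+ 2)%:E <= B%:E)%E -> bergman_space O f.
Proof.
move=> hf fB; split=> //; apply/integrableP; split.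
  by apply/measurable_EFinP; apply: measurable_funX; exact: (measurable_normc_f oO hf).
under eq_integral do rewrite /= ger0_norm ?sqr_ge0//.
by apply: le_lt_trans fB _; rewrite ltry.
Qed.

Definition re_inner f g (p : R * R) : R := complex.Re (f (of_pair p) * conjc (g (of_pair p))).

Lemma re_innerE f g p : re_inner f g p =
  complex.Re (f (of_pair p)) * complex.Re (g (of_pair p)) +
  complex.Im (f (of_pair p)) * complex.Im (g (of_pair p)).
Proof. by rewrite /re_inner; case: (f _) (g _) => [x y] [x' y'] /=; ring. Qed.

Lemma integrable_re_inner f g : bergman_space O f -> bergman_space O g ->
  area.-integrable pO (EFin \o re_inner f g).
Proof.
move=> [hf fi] [hg gi].
have mO : measurable pO by exact: measurable_preimage.
have fgi : area.-integrable pO (fun p => (normc (f (of_pair p)) ^+ 2)%:E + (normc (g (of_pair p))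
  ^+ 2)%:E)%E.
  exact: integrableD.
apply: le_integrable fgi => //.
  apply/measurable_EFinP.
  have -> : re_inner f g = fun p => complex.Re (f (of_pair p)) * complex.Re (g (of_pair p)) +
    complex.Im (f (of_pair p)) * complex.Im (g (of_pair p)).
    by apply/funext => p; rewrite re_innerE.
  have H (u : C -> C) : holomorphic_on O u -> measurable_fun pO (fun p => complex.Re (u (of_pair
    p))) /\
      measurable_fun pO (fun p => complex.Im (u (of_pair p))).
    move=> hu; have cu z : O z -> ccont u z by move=> /hu/derivable_ccont.
    by split; apply: measurable_ccont => //; [exact: Re_lipschitz|exact: Im_lipschitz].
  have [f1 f2] := H f hf; have [g1 g2] := H g hg.
  by apply: measurable_funD; exact: measurable_funM.
move=> p _; rewrite /= lee_fin [leRHS]ger0_norm ?addr_ge0 ?sqr_ge0//.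
rewrite re_innerE !normc_sqr; move: (complex.Re _) (complex.Im _) (complex.Re _) (complex.Im _)
  => a b c d.
have h1 := sqr_ge0 (a - c); have h2 := sqr_ge0 (b - d).
have h3 := sqr_ge0 (a + c); have h4 := sqr_ge0 (b + d).
have h5 := sqr_ge0 a; have h6 := sqr_ge0 b; have h7 := sqr_ge0 c; have h8 := sqr_ge0 d.
rewrite sqrrB in h1; rewrite sqrrB in h2; rewrite sqrrD in h3; rewrite sqrrD in h4.
rewrite ler_norml; move: (a ^+ 2) (b ^+ 2) (c ^+ 2) (d ^+ 2) h1 h2 h3 h4 h5 h6 h7 h8.
by rewrite ![c * a]mulrC ![d * b]mulrC; move: (a * c) (b * d) => x y *; apply/andP; split; lra.
Qed.

Lemma re_inner_self f p : re_inner f f p = normc (f (of_pair p)) ^+ 2.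
Proof. by rewrite re_innerE normc_sqr !expr2. Qed.

(** Since [k w] is the squared norm of [k], this is Cauchy-Schwarz for [f w = <f, k>]. It is used as
    [Re <f, k> <= |f|^2 / (2 s) + s |k|^2 / 2] with [s = B / c], where the first term is at most
    [c / 2]. *)
Lemma bergman_diag_ge k f w (B c : R) : reproducing O w k -> bergman_space O f -> 0 < c -> 0 < B
  ->
  c <= complex.Re (f w) ->
  (\int[area]_(p in pO) (normc (f (of_pair p)) ^+ 2)%:E <= B%:E)%E ->
  c ^+ 2 / B <= complex.Re (k w).
Proof.
move=> [kA rk] fA c0 B0 cf fB.
have mO : measurable pO by exact: measurable_preimage.
have kk := rk k kA; have fk := rk f fA.
set K := complex.Re (k w).
have KE : K = \int[area]_(p in pO) re_inner k k p by rewrite /K kk.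
have fE : complex.Re (f w) = \int[area]_(p in pO) re_inner f k p by rewrite fk.
have iff := integrable_re_inner fA fA.
have ikk := integrable_re_inner kA kA.
have ifk := integrable_re_inner fA kA.
have fB' : \int[area]_(p in pO) re_inner f f p <= B.
  rewrite -lee_fin /Rintegral fineK; last exact: integrable_fin_num.
  apply: le_trans fB; rewrite le_eqVlt; apply/orP; left; apply/eqP.
  by apply: eq_integral => p _; rewrite re_inner_self.
have iZ x u : area.-integrable pO (EFin \o u) -> area.-integrable pO (EFin \o (fun p => x * u p)).
  move=> iu; have -> : EFin \o (fun p => x * u p) = (fun p => x%:E * (EFin \o u) p)%E.
    by apply/funext => p /=; rewrite EFinM.
  by apply: integrableZl.
have s0 : 0 < B / c by rewrite divr_gt0.
have : \int[area]_(p in pO) re_inner f k p <=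
  \int[area]_(p in pO) ((2 * (B / c))^-1 * re_inner f f p + (B / c / 2) * re_inner k k p).
  apply: le_Rintegral => //.
    apply: (@integrableD _ _ _ area pO mO (EFin \o _) (EFin \o _)); exact: iZ.
  move=> p _; rewrite !re_innerE; move: (complex.Re _) (complex.Im _) (complex.Re _) (complex.Im
    _) => x' y' x y.
  move: s0; move: (B / c) => s s0.
  rewrite -subr_ge0.
  have -> : (2 * s)^-1 * (x * x + y * y) + s / 2 * (x' * x' + y' * y') - (x * x' + y * y') =
    ((x - s * x') ^+ 2 + (y - s * y') ^+ 2) / (2 * s) by field; rewrite gt_eqF.
  by rewrite divr_ge0 ?addr_ge0 ?sqr_ge0// mulr_ge0// ltW.
rewrite RintegralD//; [|exact: iZ|exact: iZ].
rewrite !RintegralZl// -fE -KE => h.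
have h2 : (2 * (B / c))^-1 * (\int[area]_(p in pO) re_inner f f p) <= c / 2.
  apply: (@le_trans _ _ ((2 * (B / c))^-1 * B)).
    by rewrite ler_wpM2l// invr_ge0 mulr_ge0// ltW.
  by rewrite le_eqVlt; apply/orP; left; apply/eqP; field; rewrite !gt_eqF.
have h3 : c / 2 <= B / c / 2 * K.
  by move: (_ * Rintegral _ _ _) h h2 => u h h2; move: (B / c / 2 * K) h => v h; lra.
rewrite ler_pdivrMr//.
have -> : c ^+ 2 = (c / 2) * (2 * c) by field.
have -> : K * B = (B / c / 2 * K) * (2 * c) by field; rewrite gt_eqF.
by rewrite ler_wpM2r// mulr_ge0// ltW.
Qed.

Lemma bergman_metric_le f w (B c M : R) : bergman_space O f -> 0 < c -> 0 < B -> 0 <= M ->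
  c <= complex.Re (f w) ->
  (\int[area]_(p in pO) (normc (f (of_pair p)) ^+ 2)%:E <= B%:E)%E ->
  (forall g, bergman_space O g -> g w = 0 -> L2norm O g = 1 -> normc (derive1 g w) <= M) ->
  bergman_metric O w <= Num.sqrt (M ^+ 2 * (B / c ^+ 2)).
Proof.
move=> fA c0 B0 M0 cf fB gM; rewrite /bergman_metric ler_wsqrtr//.
have K1M : bergman_K1 O w <= M ^+ 2.
  rewrite /bergman_K1; set S := [set _ | _ in _].
  (* Without competitors the supremum has the default value 0. *)
  have [->|/set0P S0] := eqVneq S set0; first by rewrite sup0 sqr_ge0.
  apply: ge_sup => // _ [g [gA gw g1] <-].
  by rewrite lerXn2r ?nnegrE ?normc_ge0//; exact: gM.
have [[k rk]|nk] := pselect (exists k, reproducing O w k).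
  have rg : reproducing O w (get [set k : C -> C | reproducing O w k]).
    by apply: (@getPex _ [set k : C -> C | reproducing O w k]); exists k.
  have h := bergman_diag_ge rg fA c0 B0 cf fB.
  rewrite /bergman_diag /bergman_kernel; move: h; set K := complex.Re _ => h.
  have cB : 0 < c ^+ 2 / B by rewrite divr_gt0// exprn_gt0.
  have K0 : 0 < K by rewrite (lt_le_trans cB).
  apply: (@le_trans _ _ (M ^+ 2 / K)); first by rewrite ler_wpM2r// invr_ge0 ltW.
  rewrite ler_wpM2l ?sqr_ge0// -[leRHS]invrK lef_pV2 ?posrE ?invr_gt0 ?divr_gt0 ?exprn_gt0//.
  by rewrite invf_div.
(* Without a reproducing kernel, [get] returns the default value [0], and [_ / 0 = 0]. *)
have -> : bergman_diag O w = 0.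
  rewrite /bergman_diag /bergman_kernel getPN//= => k rk.
  by apply: nk; exists k.
by rewrite invr0 mulr0 mulr_ge0 ?sqr_ge0// divr_ge0 ?sqr_ge0// ltW.
Qed.

End bergman_bound.

(** * The annulus inside the domain *)

Section annulus.
Variable R : realType.
Local Notation C := (R[i]^o).
Variables (O : set C) (domO : domain O).

Let oO : open O. Proof. by case: domO. Qed.

Lemma boundary_far (z : C) : O z -> exists2 m : R, 0 < m & far_from (boundary O) z m.
Proof.
move=> /(open_normc oO)[e e0 H]; exists e => // p bp.
rewrite leNgt; apply/negP => pz; apply: (boundary_notin oO bp).
by apply: H; rewrite normcB.
Qed.

(** The parameters at which the segment lies in [O] form a set that is open and, because [closure O]
    adds only boundary points, also closed in [[0, 1]]. *)
Lemma segment_boundary (x0 y0 dx dy : R) :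
  (forall s, 0 <= s <= 1 -> ~ boundary O ((x0 + s * dx) +i* (y0 + s * dy))) ->
  O (x0 +i* y0) -> O ((x0 + dx) +i* (y0 + dy)).
Proof.
move=> nb O0; pose g s : C := (x0 + s * dx) +i* (y0 + s * dy).
have cg : continuous g.
  move=> s A /normc_nbhs[e e0 sA].
  have k0 : 0 < `|dx| + `|dy| + 1 by rewrite ltr_wpDl ?addr_ge0.
  apply/nbhs_ballP; exists (e / (`|dx| + `|dy| + 1)); first by rewrite /= divr_gt0.
  move=> u; rewrite /ball /= ltr_pdivlMr// => su; apply: sA.
  apply: le_lt_trans (normc_le_ReIm _) _; rewrite /g /=.
  have -> : x0 + u * dx - (x0 + s * dx) = - ((s - u) * dx) by ring.
  have -> : y0 + u * dy - (y0 + s * dy) = - ((s - u) * dy) by ring.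
  rewrite !normrN !normrM -mulrDr; apply: le_lt_trans su.
  by rewrite ler_wpM2l// lerDl.
have := @segment_connected R 0 1 (`[0, 1]%classic `&` g @^-1` O).
have -> : ((x0 + dx) +i* (y0 + dy) : C) = g 1 by rewrite /g !mul1r.
move=> H; suff E : `[0, 1]%classic `&` g @^-1` O = `[0, 1]%classic.
  have : `[0, 1]%classic (1 : R) by rewrite /= in_itv /= lexx ler01.
  by rewrite -E => -[].
apply: H.
- by exists 0; split; [rewrite /= in_itv /= lexx ler01|rewrite /g /= !mul0r !addr0].
- exists (g @^-1` O) => //; move: cg => /continuousP; exact.
- exists (g @^-1` closure O).
    by move: cg => /continuous_closedP; apply; exact: closed_closure.
  apply/seteqP; split=> s [s01 /= gs]; split=> //; first exact: subset_closure.
  apply: contrapT => nO; move: s01; rewrite /= in_itv /= => /nb; apply.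
  by split=> // /interior_subset.
Qed.

Lemma convex_bound (lo hi x x' s : R) : lo <= x <= hi -> lo <= x' <= hi -> 0 <= s <= 1 ->
  lo <= x + s * (x' - x) <= hi.
Proof.
move=> /andP[a1 a2] /andP[b1 b2] /andP[s0 s1].
have s1' : 0 <= 1 - s by rewrite subr_ge0.
apply/andP; split; rewrite -subr_ge0.
  have -> : x + s * (x' - x) - lo = (1 - s) * (x - lo) + s * (x' - lo) by ring.
  by rewrite addr_ge0 ?mulr_ge0 ?subr_ge0.
have -> : hi - (x + s * (x' - x)) = (1 - s) * (hi - x) + s * (hi - x') by ring.
by rewrite addr_ge0 ?mulr_ge0 ?subr_ge0.
Qed.

Lemma rectangle_boundary (x0 x1 y0 y1 x y x' y' : R) :
  (forall u v, x0 <= u <= x1 -> y0 <= v <= y1 -> ~ boundary O (u +i* v)) ->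
  x0 <= x <= x1 -> y0 <= y <= y1 -> x0 <= x' <= x1 -> y0 <= y' <= y1 ->
  O (x +i* y) -> O (x' +i* y').
Proof.
move=> nb xb yb xb' yb' Oxy.
have := @segment_boundary x y (x' - x) (y' - y); rewrite !subrKC; apply=> // s s01.
by apply: nb; exact: convex_bound.
Qed.

(** The frame is a cycle of four closed rectangles, neighbours sharing a corner; every point is
    compared with the upper right corner by walking around it. *)
Lemma frame_boundary (a1 a2 h S : R) : 0 < h -> h <= S ->
  (forall x y, in_frame a1 a2 h S x y -> ~ boundary O (x +i* y)) ->
  forall x y x' y', in_frame a1 a2 h S x y -> in_frame a1 a2 h S x' y' ->
  O (x +i* y) -> O (x' +i* y').
Proof.
move=> h0 hS nb.
have n0 (c t : R) : t <= c - h -> (`|t - c| < h) = false.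
  by move=> tc; rewrite ltNge; apply/negbF; rewrite ler_normr; apply/orP; right; lra.
have n1 (c t : R) : c + h <= t -> (`|t - c| < h) = false.
  by move=> tc; rewrite ltNge; apply/negbF; rewrite ler_normr; apply/orP; left; lra.
have nS (c t : R) : c - S <= t <= c + S -> `|t - c| <= S by rewrite ler_dist_itv.
have rr u v : a1 + h <= u <= a1 + S -> a2 - S <= v <= a2 + S -> ~ boundary O (u +i* v).
  move=> /andP[u1 u2] vb; apply: nb; split; [by apply: nS; lra|exact: nS|by rewrite n1].
have rl u v : a1 - S <= u <= a1 - h -> a2 - S <= v <= a2 + S -> ~ boundary O (u +i* v).
  move=> /andP[u1 u2] vb; apply: nb; split; [by apply: nS; lra|exact: nS|by rewrite n0].
have rt u v : a1 - S <= u <= a1 + S -> a2 + h <= v <= a2 + S -> ~ boundary O (u +i* v).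
  move=> ub /andP[v1 v2]; apply: nb; split; [exact: nS|by apply: nS; lra|by rewrite (n1 a2)
    ?andbF].
have rb u v : a1 - S <= u <= a1 + S -> a2 - S <= v <= a2 - h -> ~ boundary O (u +i* v).
  move=> ub /andP[v1 v2]; apply: nb; split; [exact: nS|by apply: nS; lra|by rewrite (n0 a2)
    ?andbF].
have b1 c : c + h <= c + S <= c + S by rewrite lexx lerD2l hS.
have b2 c : c - S <= c - S <= c - h by rewrite lexx lerD2l lerN2 hS.
have b3 c : c - S <= c + S <= c + S by rewrite lexx andbT; lra.
have b4 c : c - S <= c - S <= c + S by rewrite lexx /=; lra.
pose NE := O ((a1 + S) +i* (a2 + S)); pose NW := O ((a1 - S) +i* (a2 + S)).
pose SE := O ((a1 + S) +i* (a2 - S)); pose SW := O ((a1 - S) +i* (a2 - S)).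
have e1 : NE -> NW by exact: (rectangle_boundary rt).
have e1' : NW -> NE by exact: (rectangle_boundary rt).
have e2 : NW -> SW by exact: (rectangle_boundary rl).
have e2' : SW -> NW by exact: (rectangle_boundary rl).
have e4 : SW -> SE by exact: (rectangle_boundary rb).
have e4' : SE -> SW by exact: (rectangle_boundary rb).
have key x y : in_frame a1 a2 h S x y -> (O (x +i* y) -> NE) /\ (NE -> O (x +i* y)).
  move=> [h1 h2 h3]; rewrite -!ler_dist_itv in h1 h2.
  have : [\/ a1 + h <= x, x <= a1 - h, a2 + h <= y | y <= a2 - h].
    move: h3; rewrite negb_and -!leNgt => /orP[]; rewrite ler_normr => /orP[] k.
    - by apply: Or41; lra.
    - by apply: Or42; lra.
    - by apply: Or43; lra.
    - by apply: Or44; lra.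
  have [x1 x2] := andP h1; have [y1 y2] := andP h2.
  case=> k.
  - by split; apply: (rectangle_boundary rr) => //; rewrite k.
  - split=> H; [apply: e1'; move: H|move: H => /e1]; apply: (rectangle_boundary rl) => //;
    rewrite k andbT//.
  - by split; apply: (rectangle_boundary rt) => //; rewrite k.
  - split=> H; [apply: e1'; apply: e2'; apply: e4'; move: H|move: H => /e1/e2/e4];
      apply: (rectangle_boundary rb) => //; rewrite k andbT//.
by move=> x y x' y' /key[k1 _] /key[_ k2] /k1/k2.
Qed.

(** A frame without boundary points lies in [O] or is disjoint from it. In the second case the
    connected set [O], which has points near [a], is confined to the hole of half-side [h]; this is
    impossible when [h] is small compared with a disc contained in [O]. *)
Lemma annulus_in : exists2 s0 : R, 0 < s0 & forall (a : C) (h S : R), boundary O a ->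
  0 < h -> h <= S -> h < s0 ->
  (forall x y, in_frame (complex.Re a) (complex.Im a) h S x y -> ~ boundary O (x +i* y)) ->
  forall x y, in_frame (complex.Re a) (complex.Im a) h S x y -> O (x +i* y).
Proof.
have [[z0 Oz0] _ cO] := domO.
have [e e0 He] := open_normc oO Oz0.
exists (e / 4); first by rewrite divr_gt0.
move=> a h S ba h0 hS he nb x y fxy; apply: contrapT => nO.
have fr u v : in_frame (complex.Re a) (complex.Im a) h S u v -> ~ O (u +i* v).
  by move=> fuv Ouv; apply: nO; exact: (frame_boundary h0 hS nb fuv fxy).
have : O `&` [set z | `|complex.Re z - complex.Re a| < h /\ `|complex.Im z - complex.Im a| < h] =
  O.
  apply: cO.
  - have [z Oz za] := boundary_near ba h0; exists z; split=> //.
    have := norm_Re_le (z - a); have := norm_Im_le (z - a).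
    by move: za; case: (z) (a) => [u v] [u' v'] /= ? ? ?; split; lra.
  - exists [set z | `|complex.Re z - complex.Re a| < h /\ `|complex.Im z - complex.Im a| < h] =>
    //.
    apply: normc_open => z [z1 z2].
    exists (Num.min (h - `|complex.Re z - complex.Re a|) (h - `|complex.Im z - complex.Im a|)).
      by rewrite lt_min !subr_gt0 z1.
    move=> u; rewrite lt_min => /andP[u1 u2].
    have := norm_Re_le (u - z); have := norm_Im_le (u - z).
    have := ler_distD (complex.Re z) (complex.Re u) (complex.Re a).
    have := ler_distD (complex.Im z) (complex.Im u) (complex.Im a).
    move: z1 z2 u1 u2; case: (u) (z) (a) => [v1 v2] [w1 w2] [a1 a2] /=.
    by move: (normc _) => n *; split; lra.
  (* Since [O] misses the frame, the open square of half-side [h] and the closed one of half-side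
     [S] have the same trace on [O]. *)
  - exists (~` [set z | S < `|complex.Re z - complex.Re a| \/ S < `|complex.Im z - complex.Im
    a|]).
      apply: open_closedC; apply: normc_open => z Hz.
      have [t t0 tz] : exists2 t : R, 0 < t &
          S + t <= `|complex.Re z - complex.Re a| \/ S + t <= `|complex.Im z - complex.Im a|.
        case: Hz => hz; [exists (`|complex.Re z - complex.Re a| - S)|exists (`|complex.Im z -
          complex.Im a| - S)];
          rewrite ?subr_gt0//; [left|right]; by rewrite subrKC.
      exists t => // u uz.
      have := norm_Re_le (u - z); have := norm_Im_le (u - z).
      have := ler_distD (complex.Re u) (complex.Re z) (complex.Re a).
      have := ler_distD (complex.Im u) (complex.Im z) (complex.Im a).
      rewrite (distrC (complex.Re z) (complex.Re u)) (distrC (complex.Im z) (complex.Im u)).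
      move: uz tz; case: (u) (z) (a) => [u1 u2] [z1 z2] [a1 a2] /=.
      by move: (normc _) => n nt [?|?] *; [left|right]; lra.
    apply/seteqP; split=> z [Oz].
      by move=> [z1 z2]; split=> // -[]; lra.
    move=> /not_orP[]; move=> /negP; rewrite -leNgt => z1 /negP; rewrite -leNgt => z2; split=> //.
    have nf : ~ in_frame (complex.Re a) (complex.Im a) h S (complex.Re z) (complex.Im z).
      by move=> /fr; apply; case: (z) Oz.
    apply/andP; apply: contrapT => /negP k; apply: nf; split=> //.
move=> OE.
have inb z : O z -> `|complex.Re z - complex.Re a| < h.
  by rewrite -OE => -[_ []].
have h1 := inb z0 Oz0.
(* Two points of [O] with real parts [e / 2] apart do not fit into a square of side
   [2 * h < e / 2]. *)
have Oz1 : O (z0 + (e / 2)%:C).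
  apply: He; rewrite addrAC subrr add0r normc_real ger0_norm ?divr_ge0 ?(ltW e0)//.
  by rewrite ltr_pdivrMr// mulr2n mulrDr mulr1 ltrDl.
have := inb _ Oz1; case: (z0) h1 => u v /=.
rewrite !ltr_norml => /andP[? ?] /andP[? ?]; lra.
Qed.

End annulus.

(** * Scales *)

Section scales.
Variable R : realType.
Variables (th : R -> R) (r Q : R).
Hypotheses (r0 : 0 < r) (Q1 : 3 / 2 <= Q) (Q2 : Q < 2).
Hypothesis th_scale : forall s, 0 < s <= r -> 0 < th s /\ 5 * th s <= s.
Hypothesis th_ratio : forall s, 0 < s <= r -> ln (th s / th (th s)) <= Q * ln (s / th s).

Definition scale i := iter i th r.

Local Notation L := (ln (r / th r)).

Lemma scale_bd i : 0 < scale i <= r.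
Proof.
elim: i => [|i IH]; first by rewrite /scale /= r0 lexx.
have [h1 h2] := th_scale IH; case/andP: IH => h3 h4.
rewrite /scale /= -/(scale i) h1 /= (le_trans _ h4)//.
by move: (scale i) (th _) h1 h2 => x y *; lra.
Qed.

Lemma ln_scale_ratio i : ln (scale i / scale i.+1) <= L * Q ^+ i.
Proof.
elim: i => [|i IH]; first by rewrite expr0 mulr1.
have := th_ratio (scale_bd i); rewrite -[th (th _)]/(scale i.+2) -[th _]/(scale i.+1).
move=> /le_trans; apply; rewrite exprS mulrCA ler_wpM2l//.
by apply: le_trans Q1.
Qed.

Lemma ln_ratio_ge0 : 0 <= L.
Proof.
have rr : 0 < r <= r by rewrite r0 lexx.
have [h1 h2] := th_scale rr.
apply: ln_ge0; rewrite ler_pdivlMr// mul1r.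
by move: (th r) h1 h2 => x *; lra.
Qed.

(** In logarithms: [ln (r / scale i)] is at most [L (1 + Q + ... + Q ^ (i - 1)) = L (Q ^ i - 1) / (Q
    - 1)], and [1 / (Q - 1) <= 2] as [Q >= 3/2]. *)
Lemma scale_expR i : r <= scale i * expR (2 * L * (Q ^+ i - 1)).
Proof.
elim: i => [|i IH]; first by rewrite expr0 subrr mulr0 expR0 mulr1.
apply: (le_trans IH); have /andP[s0 _] := scale_bd i; have /andP[s1 _] := scale_bd i.+1.
have -> : scale i = scale i.+1 * expR (ln (scale i / scale i.+1)).
  by rewrite lnK ?posrE ?divr_gt0// mulrC divfK// gt_eqF.
rewrite -mulrA -expRD ler_pM2l// ler_expR.
have h1 := ln_scale_ratio i; have h2 := ln_ratio_ge0.
apply: (le_trans (lerD h1 (lexx _))).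
have qi : 0 <= Q ^+ i by rewrite exprn_ge0// (le_trans _ Q1).
have h3 : 0 <= L * Q ^+ i * (2 * Q - 3).
  by rewrite !mulr_ge0// subr_ge0; move: Q Q1 => x *; lra.
rewrite -subr_ge0 exprS.
have -> : 2 * L * (Q * Q ^+ i - 1) - (L * Q ^+ i + 2 * L * (Q ^+ i - 1)) = L * Q ^+ i * (2 * Q -
  3) by ring.
by [].
Qed.

Lemma exp2_ge (x : R) (n : nat) : 2 * x <= n%:R -> expR x <= 2 ^+ n.
Proof.
move=> xn; have h : expR 2^-1 <= 2 :> R.
  rewrite -[leLHS]invrK -expRN -[leRHS]invrK lef_pV2 ?posrE ?expR_gt0 ?invr_gt0//.
  by apply: le_trans (expR_ge1Dx _); lra.
have : expR x <= expR (n%:R * 2^-1) by rewrite ler_expR ler_pdivlMr// mulrC.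
move=> /le_trans; apply; rewrite mulrC expRM_natr lerXn2r ?nnegrE ?expR_ge0//.
Qed.

(** In the exponent [x i], the 7 absorbs the factor 8, [L] the passage from [Rr] to [r], and the
    rest that from [r] to [scale i.+2]. The bound on [kappa i] follows from [kappa i <= 1 + 2 * x i]
    and [Q ^ 2 <= 4]. The shift by 2 occurs because the trees start at [scale 1]. *)
Lemma kappa_exists (Rr : R) : 0 < Rr -> Rr <= r * expR L -> exists kappa : nat -> nat, forall i,
  2 * (4 * Rr) <= scale i.+2 * 2 ^+ kappa i /\ (kappa i)%:R <= (15 + 16 * L) * Q ^+ i.
Proof.
move=> Rr0 RrL.
pose x i := 7 + L + 2 * L * (Q ^+ i.+2 - 1).
have L0 := ln_ratio_ge0.
have Qi i : 1 <= Q ^+ i by rewrite exprn_ege1// (le_trans _ Q1)//; lra.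
have x0 i : 0 <= x i.
  by rewrite !addr_ge0// !mulr_ge0// subr_ge0.
exists (fun i => (Num.truncn (2 * x i)).+1) => i.
have /andP[n1 n2] := truncn_itv (mulr_ge0 (ler0n R 2) (x0 i)).
have /andP[s0 _] := scale_bd i.+2.
split.
  apply: (@le_trans _ _ (scale i.+2 * expR (x i))); last first.
    by rewrite ler_wpM2l ?(ltW s0)// exp2_ge// ltW.
  rewrite /x (expRD (7 + L)) (expRD 7 L).
  have h8 : 8 <= expR 7 :> R by apply: le_trans (expR_ge1Dx _); lra.
  have h := scale_expR i.+2.
  move: h s0; move: (expR (2 * L * _)) (scale _) (expR_ge0 (2 * L * (Q ^+ i.+2 - 1))) => ex s h
    s0 ex0.
  have h1 : Rr <= expR L * (ex * s).
    rewrite (le_trans RrL)// [leRHS]mulrC ler_wpM2r ?expR_ge0//.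
    by rewrite mulrC.
  have -> : s * (expR 7 * expR L * ex) = expR 7 * (expR L * (ex * s)) by ring.
  have -> : 2 * (4 * Rr) = 8 * Rr by ring.
  by rewrite ler_pM// ltW.
rewrite -natr1; move: n1; move: (_%:R) => n n1.
have h1 := Qi i; have -> : (15 + 16 * L) * Q ^+ i = 15 * Q ^+ i + 16 * (L * Q ^+ i) by ring.
have h2 : L * Q ^+ i.+2 <= 4 * (L * Q ^+ i).
  have -> : L * Q ^+ i.+2 = (Q * Q) * (L * Q ^+ i) by rewrite !exprS; ring.
  rewrite ler_wpM2r ?mulr_ge0 ?(le_trans _ h1)//.
  have q0 : 0 <= Q by rewrite (le_trans _ Q1).
  have -> : 4 = 2 * 2 :> R by rewrite -natrM.
  by rewrite ler_pM// ltW.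
move: n1; rewrite /x.
have -> : 2 * (7 + L + 2 * L * (Q ^+ i.+2 - 1)) = 14 - 2 * L + 4 * (L * Q ^+ i.+2) by ring.
move: h1 h2; move: (L * Q ^+ i) (L * Q ^+ i.+2) (Q ^+ i) => y z u.
by move: (L) L0 => l *; lra.
Qed.

End scales.

(** * The estimate at one point *)

Section one_scale.
Variable R : realType.
Local Notation C := (R[i]^o).
Local Notation area := (@lebesgue_measure R \x @lebesgue_measure R)%E.

Lemma Re_inv_ge (u : C) (rho : R) : 0 < rho -> normc (u - rho%:C) <= rho / 32 ->
  (2 * rho)^-1 <= complex.Re u^-1.
Proof.
move=> rho0 ur.
have h1 := le_trans (norm_Re_le _) ur.
have h2 : normc u <= 33 / 32 * rho.
  have := le_normcD (u - rho%:C) rho%:C; rewrite subrK normc_real ger0_norm ?(ltW rho0)//.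
  by move=> /le_trans; apply; move: (normc _) ur => x *; lra.
have h3 : normc u ^+ 2 <= (33 / 32 * rho) ^+ 2.
  by rewrite lerXn2r ?nnegrE ?normc_ge0 ?mulr_ge0 ?(ltW rho0).
move: h1 h3; rewrite normc_sqr; case: u {ur h2} => x y /=.
rewrite ler_norml => /andP[x1 x2] h3.
have x0 : 0 < x by lra.
have N0 : 0 < x ^+ 2 + y ^+ 2 by rewrite ltr_pwDl ?exprn_gt0// sqr_ge0.
rewrite ler_pdivlMr// mulrC ler_pdivrMr ?mulr_gt0// (le_trans h3)//.
apply: (@le_trans _ _ (31 / 32 * rho * (2 * rho))); last first.
  by rewrite ler_wpM2r ?mulr_ge0 ?(ltW rho0)//; lra.
have -> : (33 / 32 * rho) ^+ 2 = 1089 / 1024 * (rho * rho) by field.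
have -> : 31 / 32 * rho * (2 * rho) = 31 / 16 * (rho * rho) by field.
have := mulr_gt0 rho0 rho0; move: (rho * rho) => v v0; lra.
Qed.

(** With [rho ^ 2 = r h], the condition [64 * h <= r] yields both [8 * h <= rho] and [8 * rho <= r],
    and [h / rho ^ 3] becomes [1 / (r * rho)]. *)
Lemma derivative_bound_L2norm (O : set C) (g : C -> C) (a1 a2 h r rho : R) :
  open O -> 0 < h -> 64 * h <= r -> rho = Num.sqrt (r * h) ->
  (forall x y, in_frame a1 a2 h (r / 2) x y -> O (x +i* y)) ->
  bergman_space O g -> g ((a1 + rho) +i* a2) = 0 -> L2norm O g = 1 ->
  normc (derive1 g ((a1 + rho) +i* a2)) <= (128 + 1024) / (r * rho).
Proof.
move=> oO h0 hr rhoE fr gA gw g1.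
have r0 : 0 < r by lra.
have rho2 : rho ^+ 2 = r * h by rewrite rhoE sqr_sqrtr// mulr_ge0// ltW.
have rho0 : 0 < rho by rewrite rhoE sqrtr_gt0 mulr_gt0.
have b1 : 8 * h <= rho.
  rewrite -ler_sqr ?nnegrE ?mulr_ge0 ?(ltW h0) ?(ltW rho0)// rho2.
  have -> : (8 * h) ^+ 2 = 64 * h * h by ring.
  by rewrite ler_wpM2r// ltW.
have b2 : 8 * rho <= r.
  rewrite -ler_sqr ?nnegrE ?mulr_ge0 ?(ltW r0) ?(ltW rho0)//.
  have -> : (8 * rho) ^+ 2 = 64 * rho ^+ 2 by ring.
  have -> : r ^+ 2 = r * r by [].
  by rewrite rho2 mulrCA ler_wpM2l// ltW.
have [hg ig] := gA.
have i1 : (\int[area]_(p in @of_pair R @^-1` O) (normc (g (of_pair p)) ^+ 2)%:E <= 1)%E.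
  have I0 : 0 <= \int[area]_(p in @of_pair R @^-1` O) (normc (g (of_pair p)) ^+ 2).
    by apply: Rintegral_ge0 => p _; exact: sqr_ge0.
  have I1 : \int[area]_(p in @of_pair R @^-1` O) (normc (g (of_pair p)) ^+ 2) = 1.
    by rewrite -(sqr_sqrtr I0) -[X in X ^+ 2]/(L2norm O g) g1 expr1n.
  have mO : measurable (@of_pair R @^-1` O) by exact: measurable_preimage.
  have := lexx (1 : R); rewrite -{1}I1 -lee_fin /Rintegral fineK//.
  exact: integrable_fin_num.
have E : 128 * h / rho ^+ 3 = 128 / (r * rho).
  have -> : h = rho ^+ 2 / r by rewrite rho2 mulrAC divff ?mul1r// gt_eqF.
  by move: (128 : R) => c; field; rewrite !gt_eqF.
have := deriv_bound oO hg i1 h0 b1 b2 fr gw.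
by rewrite derive1E E -mulrDl.
Qed.

Variables (O : set C) (domO : domain O) (M0 : R).
Hypothesis OM0 : forall z, O z -> normc z <= M0.
Let E := boundary O.
Variables (th : R -> R) (r Q : R).
Hypotheses (r0 : 0 < r) (Q1 : 3 / 2 <= Q) (Q2 : Q < 2).
Hypothesis th_scale : forall s, 0 < s <= r -> 0 < th s /\ 5 * th s <= s.
Hypothesis th_ratio : forall s, 0 < s <= r -> ln (th s / th (th s)) <= Q * ln (s / th s).
Hypothesis thE : forall s p, 0 < s <= r -> E p ->
  exists2 q, E q & 5 * th s <= normc (q - p) <= s.
Variables (a a' : C) (h Rr : R).
Hypotheses (Ea : E a) (Ea' : E a') (ra : r <= normc (a' - a)) (aR : normc (a' - a) <= Rr).
Hypothesis Rr_le : Rr <= r * expR (ln (r / th r)).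
Hypotheses (h0 : 0 < h) (hr : 64 * h <= r) (thh : 5 * th r <= h).
Hypothesis frO : forall x y, in_frame (complex.Re a) (complex.Im a) h (r / 2) x y -> O (x +i* y).

Definition point_at : C := (complex.Re a + Num.sqrt (r * h)) +i* complex.Im a.

(** The 16 comes from the lower bound [1 / (4 rho)] for the test function, [128 + 1024] from the
    derivative bound, and the last factor from the norm of the test function, with [15 + 16 L]
    enlarged to [16 (1 + L)]. *)
Definition bound_const : R := 16 * (128 + 1024) ^+ 2 * (4 * (192 * 16 / (2 - Q)) + 342).

Lemma at_scale : [/\ O point_at, 0 <= bdist O point_at <= Num.sqrt (r * h) &
  bergman_metric O point_at * bdist O point_at <=
  Num.sqrt (bound_const * (1 + ln (r / th r)) * (h / r))].
Proof.
have oO : open O by case: domO.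
set rho := Num.sqrt (r * h); set w := point_at; set L := ln (r / th r).
have L0 : 0 <= L by exact: ln_ratio_ge0.
have rho2 : rho ^+ 2 = r * h by rewrite /rho sqr_sqrtr// mulr_ge0// ltW.
have rho0 : 0 < rho by rewrite /rho sqrtr_gt0 mulr_gt0.
have b1 : 8 * h <= rho.
  rewrite -ler_sqr ?nnegrE ?mulr_ge0 ?(ltW h0) ?(ltW rho0)// rho2.
  have -> : (8 * h) ^+ 2 = 64 * h * h by ring.
  by rewrite ler_wpM2r// ltW.
have b2 : 8 * rho <= r.
  rewrite -ler_sqr ?nnegrE ?mulr_ge0 ?(ltW r0) ?(ltW rho0)//.
  have -> : (8 * rho) ^+ 2 = 64 * rho ^+ 2 by ring.
  have -> : r ^+ 2 = r * r by [].
  by rewrite rho2 mulrCA ler_wpM2l// ltW.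
have hh := h0.
have Ow : O w.
  apply: frO; rewrite -/rho; split.
  - by rewrite addrAC subrr add0r ger0_norm ?(ltW rho0)//; move: (rho) b2 rho0 => x *; lra.
  - by rewrite subrr normr0 divr_ge0// ltW.
  - rewrite negb_and -leNgt addrAC subrr add0r; apply/orP; left.
    by rewrite ger0_norm ?(ltW rho0)//; move: (rho) b1 hh => x *; lra.
have wa : w - a = rho%:C.
  by rewrite /w /point_at -/rho; case: (a) => x y; apply/eqP; rewrite eq_complex /= addrAC !subrr
    add0r !eqxx.
have bd : bdist O w <= rho.
  by rewrite (le_trans (bdist_le _ Ea))// wa normc_real ger0_norm// ltW.
have bd0 : 0 <= bdist O w := bdist_ge0 w Ea.
split=> //; first by rewrite bd0.
(* The trees start at the scale [th r], not [r], so that the one rooted at [a] stays in the hole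
   around [a]. *)
pose t i := scale th r i.+1.
have sb i := scale_bd r0 th_scale i.
have t0 i : 0 < t i by have /andP[] := sb i.+1.
have t5 i : 5 * t i.+1 <= t i by have [] := th_scale (sb i.+1).
have /choice[b0 hb0] : forall ip : nat * C, exists q, E ip.2 ->
    E q /\ 5 * t ip.1.+1 <= normc (q - ip.2) <= t ip.1.
  move=> [i p] /=; have [Ep|nE] := pselect (E p); last by exists 0.
  by have [q Eq hq] := thE (sb i.+1) Ep; exists q.
pose b i p := b0 (i, p).
have bP i p : E p -> E (b i p) /\ 5 * t i.+1 <= normc (b i p - p) <= t i := hb0 (i, p).
have rR : r <= Rr by exact: le_trans ra aR.
have Rr0 : 0 < Rr by exact: lt_le_trans rR.
have thr : 0 < r <= r by rewrite r0 lexx.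
have tR : 5 * t 0 <= Rr by rewrite (le_trans _ rR)//; exact: (th_scale thr).2.
have [kappa hk] := kappa_exists r0 Q1 Q2 th_scale th_ratio Rr0 Rr_le.
have D0 : 0 <= 15 + 16 * L by rewrite addr_ge0// mulr_ge0.
have Q0 : 0 < Q by rewrite (lt_le_trans _ Q1)// divr_gt0.
have kt i : 2 * (4 * Rr) <= t i.+1 * 2 ^+ kappa i := (hk i).1.
have kl i : (kappa i)%:R <= (15 + 16 * L) * Q ^+ i := (hk i).2.
have farO z : O z -> exists2 m, 0 < m & far_from E z m by exact: boundary_far.
have OM z : O z -> normc (z - a) <= M0 + normc a.
  by move=> /OM0 zM; rewrite (le_trans (le_normcD _ _))// normcN lerD.
have L2 := dipole_L2 t0 t5 bP tR D0 Q0 Q2 kt kl oO farO Ea Ea' aR OM.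
have hol := holomorphic_dipole t0 t5 bP farO Ea Ea'.
have fA := bergman_spaceI oO hol L2.
set B := 4 * (192 * (15 + 16 * L) / (2 - Q)) + 342 in L2 fA.
have q2 : 0 < 2 - Q by rewrite subr_gt0.
have B0 : 0 < B.
  by rewrite /B ltr_wpDl// !mulr_ge0 ?invr_ge0 ?(ltW q2).
have Bc : B <= (4 * (192 * 16 / (2 - Q)) + 342) * (1 + L).
  have -> : (4 * (192 * 16 / (2 - Q)) + 342) * (1 + L) = 4 * (192 * (16 + 16 * L) / (2 - Q)) +
    342 + 342 * L.
    by field; rewrite gt_eqF.
  apply: ler_wpDr; first by apply: mulr_ge0 => //; exact: ler0n.
  rewrite lerD2r; apply: ler_wpM2l; first exact: ler0n.
  apply: ler_wpM2r; first by rewrite invr_ge0 ltW.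
  apply: ler_wpM2l; first exact: ler0n.
  by rewrite lerD2r; lra.
have [m m0 fw] := farO _ Ow.
(* Hence every leaf [p] of the near tree is within [h / 4 <= rho / 32] of [a], and [w - p] is almost
   the real number [rho]. *)
have th4 : 5 / 4 * t 0 <= h / 4 by move: (t 0) (thh : 5 * t 0 <= h) => x *; lra.
have Fa : (2 * rho)^-1 <= complex.Re (cauchy_tr b a w).
  apply: (tconv_Re_ge (cauchy_trP t0 t5 bP Ea m0 fw)) => n.
  apply: leafs_imp (leafs_near t0 t5 bP n 0 Ea) => p [Ep pa].
  apply: Re_inv_ge => //.
  have -> : w - p - rho%:C = - (p - a) by rewrite -wa; ring.
  rewrite normcN (le_trans pa)// (le_trans th4)//; move: (rho) b1 => x *; lra.
(* Since [|a' - a| >= r >= 8 * rho], the far transform is at most half the lower bound for the near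
   one and cannot cancel it. *)
have Fb : normc (cauchy_tr b a' w) <= (4 * rho)^-1.
  apply: (tconv_le (cauchy_trP t0 t5 bP Ea' m0 fw)) => n.
  apply: leafs_imp (leafs_near t0 t5 bP n 0 Ea') => p [Ep pa].
  have k1 : 4 * rho <= normc (w - p).
    have t1 := normc_le_tri a' a p; have t2 := normc_le_tri p a w.
    have t3 : normc (w - a) = rho by rewrite wa normc_real ger0_norm// ltW.
    have ra' := ra; have thr4 := le_trans pa th4.
    rewrite t3 in t2; rewrite (normcB a' p) in t1; rewrite (normcB w p).
    move: (rho) (normc (p - a)) (normc (p - w)) (normc (p - a')) (normc (a' - a)) b1 b2 t1 t2 ra'
      thr4 => x n1 n2 n3 n4 *; lra.
  rewrite normcV lef_pV2 ?posrE ?mulr_gt0// (lt_le_trans _ k1)// mulr_gt0//.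
have Fw : (4 * rho)^-1 <= complex.Re (dipole b a a' w).
  have -> : complex.Re (dipole b a a' w) = complex.Re (cauchy_tr b a w) - complex.Re (cauchy_tr b
    a' w).
    by rewrite /dipole; case: (cauchy_tr b a w) (cauchy_tr b a' w) => [? ?] [? ?].
  have := le_trans (norm_Re_le _) Fb; move: Fa; rewrite !invfM ler_norml.
  move: (rho^-1) => x Fa /andP[_ h4]; lra.
have c0 : 0 < (4 * rho)^-1 by rewrite invr_gt0 mulr_gt0.
have M0' : 0 <= (128 + 1024) / (r * rho).
  apply: divr_ge0; first by apply: addr_ge0; exact: ler0n.
  by apply: mulr_ge0; exact: ltW.
have met := bergman_metric_le oO fA c0 B0 M0' Fw L2
  (fun g gA gw g1 => derivative_bound_L2norm oO h0 hr erefl frO gA gw g1).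
apply: (@le_trans _ _ (Num.sqrt (((128 + 1024) / (r * rho)) ^+ 2 * (B / (4 * rho)^-1 ^+ 2)) *
  rho)).
  by apply: ler_pM => //; exact: sqrtr_ge0.
rewrite /bound_const; move: M0' => {met}; move: (128 + 1024) => cc M0'.
have sE y : 0 <= y -> Num.sqrt y * rho = Num.sqrt (y * rho ^+ 2).
  by move=> y0; rewrite sqrtrM// sqrtr_sqr ger0_norm// ltW.
rewrite sE; last first.
  by apply: mulr_ge0; [exact: sqr_ge0|apply: divr_ge0; [exact: ltW|exact: sqr_ge0]].
rewrite ler_wsqrtr//.
have -> : (cc / (r * rho)) ^+ 2 * (B / (4 * rho)^-1 ^+ 2) * rho ^+ 2 =
   16 * cc ^+ 2 * (h / r) * B.
  have -> : h = rho ^+ 2 / r by rewrite rho2 mulrAC divff ?mul1r// gt_eqF.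
  by move: (B) => bb; field; rewrite !gt_eqF.
move: Bc; set c := _ + 342 => Bc.
have -> : 16 * cc ^+ 2 * c * (1 + L) * (h / r) = 16 * cc ^+ 2 * (h / r) * (c * (1 + L)) by ring.
apply: ler_wpM2l => //; apply: mulr_ge0; last by apply: divr_ge0; exact: ltW.
by apply: mulr_ge0; [exact: ler0n|exact: sqr_ge0].
Qed.

End one_scale.

(** * From one scale to the sequence of points *)

Section small_scales.
Variable R : realType.
Local Notation C := (R[i]^o).

Lemma bounded_normc (O : set C) : bounded_set O -> exists M : R, forall z, O z -> normc z <= M.
Proof.
move=> [M [_ H]]; exists (complex.Re (M + 1)) => z Oz.
have := H (M + 1) ltac:(by rewrite ltrDl) z Oz.
by rewrite /= normr_normc lecE => /andP[].
Qed.

Lemma near0_right (P : R -> Prop) : (\forall t \near (0 : R)^'+, P t) ->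
  exists2 d : R, 0 < d & forall t, 0 < t < d -> P t.
Proof.
rewrite near_withinE => /nbhs_ballP[d /= d0 H]; exists d => // t /andP[t0 td].
by apply: H => //; rewrite /ball /= sub0r normrN ger0_norm// ltW.
Qed.

(** The quadratic bound [expR x >= (1 + x / 2) ^ 2] beats the linear factor. *)
Lemma linear_expR_decay (c x : R) : 0 <= c -> 0 < x ->
  (5 + c * x) * expR (- x) <= 2 * (5 + 2 * c) / x.
Proof.
move=> c0 x0; have y0 : 0 < 1 + x / 2 by rewrite addr_gt0// divr_gt0.
have h : (1 + x / 2) ^+ 2 <= expR x.
  have -> : expR x = expR (x / 2) ^+ 2 by rewrite expr2 -expRD -splitr.
  by rewrite lerXn2r ?nnegrE ?expR_ge0 ?expR_ge1Dx// ltW.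
rewrite expRN ler_pdivrMr ?expR_gt0// mulrAC ler_pdivlMr//.
apply: (@le_trans _ _ (2 * (5 + 2 * c) * (1 + x / 2) ^+ 2)); last first.
  by rewrite ler_wpM2l// mulr_ge0// addr_ge0// mulr_ge0.
have cx : 0 <= c * x by rewrite mulr_ge0// ltW.
have cxx : 0 <= c * x * x by rewrite mulr_ge0// ltW.
have -> : 2 * (5 + 2 * c) * (1 + x / 2) ^+ 2 =
  (5 + c * x) * x + (10 + 4 * c + 5 * x + 4 * (c * x) + 5 / 2 * x ^+ 2) by field.
rewrite lerDl; have := sqr_ge0 x; move: (x ^+ 2) (c * x) cx => u v *; lra.
Qed.

(** At a scale [s] with [h s = r], condition [(U)_h] produces a point of the set at distance between
    [r] and [s]: the root of the far tree. *)
Lemma IVT_scale (h : R -> R) (r0 r R0 : R) : scale_function r0 h ->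
  {in `]0, r0[, continuous (fun t => h t / t)} -> 0 < r -> R0 < r0 -> r < h R0 -> r <= R0 ->
  exists2 s, r <= s <= R0 & h s = r.
Proof.
move=> [r00 hr _] ch r_gt0 R0r rh rR.
have cont : {within `[r, R0], continuous (fun t => h t / t * t)}.
  apply: continuous_in_subspaceT => t; rewrite inE /= in_itv /= => /andP[t1 t2].
  apply: (@cvgM _ _ _ _ (fun t => h t / t) id); last exact: cvg_id.
  by apply: ch; rewrite in_itv /= (lt_le_trans r_gt0 t1) (le_lt_trans t2 R0r).
have hE t : r <= t -> h t / t * t = h t.
  by move=> rt; rewrite divfK// gt_eqF// (lt_le_trans r_gt0).
have [|s sb hs] := IVT rR cont (v := r).
  rewrite !hE// ge_min le_max (ltW rh) orbT andbT.
  have /andP[_ /ltW ->//] := hr r ltac:(by rewrite r_gt0 (le_lt_trans rR R0r)).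
exists s; first by move: sb; rewrite in_itv.
by move: sb hs; rewrite in_itv /= => /andP[/hE -> _].
Qed.

Lemma max_norm_le_normc (z : C) (h : R) : 0 < h ->
  ~~ ((`|complex.Re z| < h) && (`|complex.Im z| < h)) -> h <= normc z.
Proof.
move=> h0; rewrite negb_and -!leNgt => /orP[] /le_trans; apply.
  exact: norm_Re_le.
exact: norm_Im_le.
Qed.

End small_scales.

Local Close Scope complex_scope.

Theorem theorem1p5 (R : realType) (Omega : set R[i]^o) (h1 h2 : R -> R)
    (r1 r2 : R)
    (domO : domain Omega) (bndO : bounded_set Omega)
    (wupO : weakly_uniformly_perfect (boundary Omega))
    (h1_scale : scale_function r1 h1) (h2_scale : scale_function r2 h2)
    (U1 : condition_U h1 (boundary Omega))
    (U2 : ~ condition_U h2 (boundary Omega))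
    (h1_cont : {in `]0, r1[, continuous (fun t => h1 t / t)})
    (h1_incr : {in `]0, r1[ &, {homo (fun t => h1 t / t) : s t / s <= t}})
    (h2_cont : {in `]0, r2[, continuous (fun t => h2 t / t)})
    (h2_incr : {in `]0, r2[ &, {homo (fun t => h2 t / t) : s t / s <= t}})
    (h12 : asymp0 (fun t => ln (h1 t / t)) (fun t => ln (h2 t / t)))
    (h1_lim : ln (h1 t / t) @[t --> (0 : R)^'+] --> -oo)
    (h2_lim : ln (h2 t / t) @[t --> (0 : R)^'+] --> -oo) :
  let th1 := fun t : R => 5^-1 * h1 t in
  (exists2 C : R, 0 < C < 2 &
     \forall t \near (0 : R)^'+,
       C * ln (th1 t / t) <= ln (th1 (th1 t) / th1 t)) ->
  exists w : nat -> R[i]^o,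
    [/\ forall n, Omega (w n),
        bdist Omega (w n) @[n --> \oo] --> (0 : R) &
        bergman_metric Omega (w n) * bdist Omega (w n) @[n --> \oo] --> (0 : R)].
Proof.
move=> th1 [C /andP[C0 C2] hC].
have oO : open Omega by case: domO.
have [M OM] := bounded_normc bndO.
have [s0 s00 Hs0] := annulus_in domO.
have [u0 u00 HU1] := U1.
have [dC dC0 HC] := near0_right hC.
have [c1 [c2 [c10 c20 hA]]] := h12.
have [dA dA0 HA] := near0_right hA.
have [r10 h1r _] := h1_scale.
have [r20 h2r _] := h2_scale.
(* Increasing the exponent weakens the hypothesis; [3 / 2] keeps the geometric sum in [scale_expR]
   under control while [Q < 2]. *)
pose Q := Num.max C (3 / 2).
have Q1 : 3 / 2 <= Q by rewrite le_max lexx orbT.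
have Q2 : Q < 2 by rewrite gt_max C2 ltr_pdivrMr//; lra.
have CQ : C <= Q by rewrite le_max lexx.
have q2 : 0 < 2 - Q by rewrite subr_gt0.
pose K := bound_const Q.
have K0 : 0 <= K.
  apply: mulr_ge0; first by apply: mulr_ge0; [exact: ler0n|exact: sqr_ge0].
  apply: addr_ge0; last exact: ler0n.
  apply: mulr_ge0; first exact: ler0n.
  apply: divr_ge0; last exact: ltW.
  by apply: mulr_ge0; exact: ler0n.
pose R0 := Num.min r1 u0 / 2.
have R00 : 0 < R0 by rewrite divr_gt0// lt_min r10.
have [R0r1 R0u0] : R0 < r1 /\ R0 < u0.
  have : R0 < Num.min r1 u0.
    rewrite /R0 ltr_pdivrMr// mulr2n mulrDr mulr1 ltrDl lt_min r10//.
  by rewrite lt_min => /andP[].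
have h1R0 : 0 < h1 R0 by have /andP[] := h1r R0 ltac:(by rewrite R00).
have main (e : R) : 0 < e -> exists w, [/\ Omega w, 0 <= bdist Omega w <= e &
    0 <= bergman_metric Omega w * bdist Omega w <= e].
  move=> e0.
  (* For [x = ln (r / h2 r)], [x >= 63] gives [r / h2 r >= 64] by [expR x >= 1 + x]; the second
     entry makes the final bound [K * (2 * (5 + 2 * c2) / x)] at most [e ^ 2]. *)
  pose X := Num.max 63 (K * (2 * (5 + 2 * c2)) / e ^+ 2).
  have [dX dX0 HX] : exists2 d : R, 0 < d & forall t, 0 < t < d -> ln (h2 t / t) <= - X.
    by apply: near0_right; exact: (h2_lim _ (nbhs_ninfty_le (num_real (- X)))).
  pose m := Num.min (Num.min (Num.min e s0) (Num.min dC dA))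
    (Num.min (Num.min dX r2) (Num.min (h1 R0) R0)).
  have m0 : 0 < m by rewrite !lt_min e0 s00 dC0 dA0 dX0 r20 h1R0.
  (* The failure of condition [(U)_h2] is applied with [m] as the bound on the radii, so the empty
     annulus is as small as all the estimates require. *)
  have : exists a r, [/\ boundary Omega a, 0 < r < m &
      ~ (boundary Omega `&` [set z | h2 r <= normc (z - a) <= r] !=set0)].
    apply: contrapT => N; apply: U2; exists m => // a r ba rm.
    by apply: contrapT => ne; apply: N; exists a, r.
  move=> [a [r [ba /andP[r0 rm] em]]].
  move: (rm); rewrite /m !lt_min => /andP[/andP[/andP[re rs0] /andP[rdC rdA]]
    /andP[/andP[rdX rr2] /andP[rh1 rR0]]].
  have rr1 := lt_trans rR0 R0r1.
  have ru0 := lt_trans rR0 R0u0.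
  have /andP[h20 h2lt] := h2r r ltac:(by rewrite r0).
  have /andP[h10 h1lt] := h1r r ltac:(by rewrite r0).
  (* The boundary point granted by [(U)_h1] at this scale is not in the empty annulus, so its
     distance from [a] is at least [h1 r] and less than [h2 r]. *)
  have h12r : h1 r <= h2 r.
    have [z [bz /= /andP[z1 z2]]] := HU1 a r ba ltac:(by rewrite r0).
    apply: ltW; apply: le_lt_trans z1 _; rewrite ltNge; apply/negP => z3.
    by apply: em; exists z; split=> //=; rewrite z3.
  pose x := ln (r / h2 r).
  have rh20 : 0 < r / h2 r by rewrite divr_gt0.
  have xE : ln (h2 r / r) = - x by rewrite /x -lnV ?posrE// invf_div.
  have xX : X <= x by have := HX r ltac:(by rewrite r0); rewrite xE lerN2.
  have [x63 xK] : 63 <= x /\ K * (2 * (5 + 2 * c2)) / e ^+ 2 <= x.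
    by move: xX; rewrite /X ge_max => /andP[].
  have x0 : 0 < x by apply: lt_le_trans x63; exact: ltr0n.
  have hx : h2 r / r = expR (- x) by rewrite -xE lnK// posrE divr_gt0.
  have hr : 64 * h2 r <= r.
    have : 64 <= r / h2 r.
      rewrite -[leRHS](lnK (_ : r / h2 r \is Num.pos)) ?posrE//.
      by apply: le_trans (expR_ge1Dx _); rewrite -/x; lra.
    by rewrite ler_pdivlMr.
  have rb s : 0 < s <= r -> 0 < s < r1 by move=> /andP[-> /le_lt_trans]; exact.
  have th_scale s : 0 < s <= r -> 0 < th1 s /\ 5 * th1 s <= s.
    move=> /rb /h1r /andP[a1 a2]; rewrite /th1; split; first by rewrite mulr_gt0.
    by rewrite mulrA divff ?mul1r ?ltW// pnatr_eq0.
  have th_ratio s : 0 < s <= r -> ln (th1 s / th1 (th1 s)) <= Q * ln (s / th1 s).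
    move=> sb; have [t1 t2] := th_scale s sb; have /andP[s1 s2] := sb.
    have ts : th1 s <= s by move: (th1 s) t1 t2 => y *; lra.
    have [t3 _] : 0 < th1 (th1 s) /\ 5 * th1 (th1 s) <= th1 s.
      by apply: th_scale; rewrite t1 (le_trans ts).
    have := HC s ltac:(by rewrite s1 (le_lt_trans s2)).
    have -> : ln (th1 s / s) = - ln (s / th1 s) by rewrite -lnV ?posrE ?divr_gt0// invf_div.
    have -> : ln (th1 (th1 s) / th1 s) = - ln (th1 s / th1 (th1 s)).
      by rewrite -lnV ?posrE ?divr_gt0// invf_div.
    rewrite mulrN lerN2 => /le_trans; apply; rewrite ler_wpM2r//.
    by apply: ln_ge0; rewrite ler_pdivlMr// mul1r.
  have thE s p : 0 < s <= r -> boundary Omega p ->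
      exists2 q, boundary Omega q & 5 * th1 s <= normc (q - p) <= s.
    move=> /andP[s1 s2] bp; have [q [bq hq]] := HU1 p s bp ltac:(by rewrite s1 (le_lt_trans s2)).
    by exists q => //; rewrite /th1 mulrA divff ?mul1r// pnatr_eq0.
  have [Rr /andP[rRr RrR0] h1Rr] := IVT_scale h1_scale h1_cont r0 R0r1 rh1 (ltW rR0).
  have Rr0 := lt_le_trans r0 rRr.
  have [a' [ba' /= /andP[ra aR]]] := HU1 a Rr ba ltac:(by rewrite Rr0 (le_lt_trans RrR0)).
  rewrite h1Rr in ra.
  have [th0 _] := th_scale r ltac:(by rewrite r0 lexx).
  have thh : 5 * th1 r <= h2 r by rewrite /th1 mulrA divff ?mul1r// pnatr_eq0.
  have Rle : Rr <= r * expR (ln (r / th1 r)).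
    rewrite lnK ?posrE ?divr_gt0//.
    (* Monotonicity of [h1 t / t] from [r] to [Rr] reads [h1 r / r <= r / Rr]: the far boundary
       point is at distance at most [r ^ 2 / h1 r]. *)
    have := h1_incr r Rr; rewrite !in_itv /= r0 rr1 Rr0 (le_lt_trans RrR0 R0r1) h1Rr.
    move=> /(_ erefl erefl rRr); rewrite ler_pdivlMr// mulrAC ler_pdivrMr// => hh.
    rewrite mulrA ler_pdivlMr// (le_trans _ hh)// mulrC ler_wpM2r// ?(ltW Rr0)//.
    by rewrite /th1 ler_piMl ?(ltW h10)//; lra.
  (* The square frame between the half-sides [h2 r] and [r / 2] lies in the annulus without boundary
     points. *)
  have fr y z : in_frame (complex.Re a) (complex.Im a) (h2 r) (r / 2) y z -> Omega (Complex y z).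
    apply: Hs0 => //; [by move: (h2 r) h20 hr => k *; lra|exact: lt_trans h2lt rs0|].
    move=> {}y {}z [y1 y2 y3] bz; apply: em; exists (Complex y z); split=> //=.
    apply/andP; split.
      by apply: max_norm_le_normc => //; case: (a) y3 => a1 a2.
    apply: le_trans (normc_le_ReIm _) _.
    by case: (a) y1 y2 => a1 a2 /= *; lra.
  have [Ow /andP[bd0 bd] met] := at_scale domO OM r0 Q1 Q2 th_scale th_ratio thE ba ba' ra aR Rle
    h20 hr thh fr.
  exists (point_at r a (h2 r)); split=> //.
    rewrite bd0 /= (le_trans bd)// (le_trans _ (ltW re))//.
    rewrite -[leRHS](ger0_norm (ltW r0)) -sqrtr_sqr ler_wsqrtr//.
    by rewrite expr2 ler_wpM2l// ltW.
  rewrite mulr_ge0 ?sqrtr_ge0//= (le_trans met)//.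
  rewrite -[leRHS](ger0_norm (ltW e0)) -sqrtr_sqr ler_wsqrtr// -/K hx.
  (* The logarithm of the tree scale, governed by [h1], is traded for that of the annulus, governed
     by [h2]; the 5 is [1 + 4] with [ln 5 <= 4] for the factor 1/5 in [th1]. *)
  have L5 : 1 + ln (r / th1 r) <= 5 + c2 * x.
    have -> : r / th1 r = 5 * (r / h1 r).
      by rewrite /th1; field; rewrite gt_eqF.
    rewrite lnM ?posrE ?divr_gt0//.
    have l5 : ln 5 <= 4 :> R.
      rewrite -[leRHS]expRK ler_ln ?posrE ?expR_gt0//.
      by apply: le_trans (expR_ge1Dx _); lra.
    have : ln (r / h1 r) <= c2 * x.
      have /andP[_] := HA r ltac:(by rewrite r0).
      have -> : ln (h1 r / r) = - ln (r / h1 r) by rewrite -lnV ?posrE ?divr_gt0// invf_div.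
      by rewrite xE invrN mulrNN ler_pdivrMr.
    have -> : 5 + c2 * x = 1 + (4 + c2 * x) by ring.
    by move=> h; rewrite lerD2l lerD.
  apply: (@le_trans _ _ (K * (2 * (5 + 2 * c2) / x))).
    rewrite -mulrA ler_wpM2l// (le_trans _ (linear_expR_decay (ltW c20) x0))//.
    by rewrite ler_wpM2r ?expR_ge0.
  by move: xK; rewrite ler_pdivrMr ?exprn_gt0// => xK; rewrite mulrA ler_pdivrMr// [leRHS]mulrC.
have /choice[w Hw] : forall n : nat, exists w, [/\ Omega w, 0 <= bdist Omega w <= n.+1%:R^-1 &
    0 <= bergman_metric Omega w * bdist Omega w <= n.+1%:R^-1].
  by move=> n; apply: main; rewrite invr_gt0.
exists w; split.
- by move=> n; case: (Hw n).
- apply: (@squeeze_cvgr _ _ _ _ (fun=> 0) (fun n => n.+1%:R^-1)); last 2 first.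
  + exact: cvg_cst.
  + exact: cvg_harmonic.
  by near=> n; case: (Hw n).
- apply: (@squeeze_cvgr _ _ _ _ (fun=> 0) (fun n => n.+1%:R^-1)); last 2 first.
  + exact: cvg_cst.
  + exact: cvg_harmonic.
  by near=> n; case: (Hw n).
Unshelve. all: by end_near. Qed.
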